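(* Let $R$ be a Noetherian normal domain containing $\mathbb{Q}$. (i) Let $B$ be an $\mathbb{A}^2$-fibration over $R$ and let $D$ be a non-zero locally nilpotent $R$-derivation of $B$. Then $A:=\operatorname{Ker}(D)$ has the structure of a graded ring $\bigoplus_{i\ge 0}A_i$ with $A_0=R$ and such that for each $i\ge 1$, $A_i$ is a finite reflexive $R$-module of rank one. In fact, when $R$ is not a field, there exists an ideal $I$ of unmixed height one in $R$ such that $A$ is isomorphic to the symbolic Rees algebra $\bigoplus_{n\ge 0}I^{(n)}T^n$. (ii) Conversely, let $I$ be an unmixed ideal of height one in $R$ and let $A$ be the symbolic Rees algebra $\bigoplus_{n\ge 0}I^{(n)}T^n$. Then there exist an $\mathbb{A}^2$-fibration $C$ over $R$ and a locally nilpotent $R$-derivation $D$ of $C$ such that $\operatorname{Ker}(D)$ is isomorphic to $A$ as a graded $R$-algebra. In particular, $A$ can be embedded as an inert subring of $C$.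
   Context: All rings are commutative with unity; isomorphisms are of $R$-algebras. An $R$-algebra $B$ is an $\mathbb{A}^n$-fibration over $R$ if $B$ is finitely generated as an $R$-algebra, flat as an $R$-module, and for each $\mathfrak{p}\in\operatorname{Spec}(R)$, $B\otimes_R k(\mathfrak{p})$ is isomorphic as a $k(\mathfrak p)$-algebra to a polynomial ring in $n$ variables over $k(\mathfrak{p})=R_{\mathfrak p}/\mathfrak pR_{\mathfrak p}$. An $R$-derivation $D:B\to B$ is an $R$-linear map satisfying the Leibniz rule; it is locally nilpotent if for each $b\in B$ there is $n\ge 0$ with $D^n(b)=0$; $\operatorname{Ker}(D)=\{b\in B:D(b)=0\}$. A subring $A$ of an integral domain $B$ is inert in $B$ if for all $a,b\in B\setminus\{0\}$, $ab\in A$ implies $a,b\in A$. An ideal $I$ of $R$ is unmixed of height one if every associated prime of $R/I$ has height one. For such $I$, the $n$-th symbolic power is $I^{(n)}=R\cap\bigcap_{\mathfrak p\in\operatorname{Ass}(R/I)}I^nR_{\mathfrak p}$ (with $I^{(0)}=R$), and the symbolic Rees algebra $\bigoplus_{n\ge0}I^{(n)}T^n$ is the corresponding graded subring of the polynomial ring $R[T]$. *)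

(* Defs.v *)
From HB Require Import structures.
From mathcomp Require Import all_boot all_order all_algebra.
From mathcomp Require Import boolp.
From mathcomp Require Import mpoly.

Set Implicit Arguments.
Unset Strict Implicit.
Unset Printing Implicit Defensive.

Import GRing.Theory.

Local Open Scope ring_scope.
Local Open Scope quotient_scope.

Record submodule (R : comNzRingType) (V : lmodType R) (S : submodClosed V) :=
  Submodule { submodule_val :> V; _ : submodule_val \in S }.

HB.instance Definition _ (R : comNzRingType) (V : lmodType R)
  (S : submodClosed V) := [isSub for @submodule_val R V S].
HB.instance Definition _ (R : comNzRingType) (V : lmodType R)
  (S : submodClosed V) := [Choice of submodule S by <:].
HB.instance Definition _ (R : comNzRingType) (V : lmodType R)
  (S : submodClosed V) := [SubChoice_isSubLmodule of submodule S by <:].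

Record subalgebra (R : comNzRingType) (B : comAlgType R) (S : subalgClosed B) :=
  Subalgebra { subalgebra_val :> B; _ : subalgebra_val \in S }.

HB.instance Definition _ (R : comNzRingType) (B : comAlgType R)
  (S : subalgClosed B) := [isSub for @subalgebra_val R B S].
HB.instance Definition _ (R : comNzRingType) (B : comAlgType R)
  (S : subalgClosed B) := [Choice of subalgebra S by <:].
HB.instance Definition _ (R : comNzRingType) (B : comAlgType R)
  (S : subalgClosed B) := [SubChoice_isSubAlgebra of subalgebra S by <:].
HB.instance Definition _ (R : comNzRingType) (B : comAlgType R)
  (S : subalgClosed B) := [SubNzRing_isSubComNzRing of subalgebra S by <:].


(* A ring, as an algebra along a ring morphism                                *)

Definition along (R S : comNzRingType) (f : {rmorphism R -> S}) : Type := S.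

Section Along.
Variables (R S : comNzRingType) (f : {rmorphism R -> S}).

HB.instance Definition _ := GRing.ComNzRing.on (along f).

Definition along_scale (a : R) (x : along f) : along f := (f a : along f) * x.

Fact along_scaleA a b x :
  along_scale a (along_scale b x) = along_scale (a * b) x.
Proof. by rewrite /along_scale mulrA rmorphM. Qed.

Fact along_scale1 : left_id 1 along_scale.
Proof. by move=> x; rewrite /along_scale rmorph1 mul1r. Qed.

Fact along_scaleDr : right_distributive along_scale +%R.
Proof. by move=> a x y; rewrite /along_scale mulrDr. Qed.

Fact along_scaleDl x : {morph along_scale^~ x : a b / a + b}.
Proof. by move=> a b; rewrite /along_scale rmorphD mulrDl. Qed.

HB.instance Definition _ := GRing.Zmodule_isLmodule.Build R (along f)
  along_scaleA along_scale1 along_scaleDr along_scaleDl.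

Fact along_scaleAl (a : R) (x y : along f) : a *: (x * y) = (a *: x) * y.
Proof. exact: mulrA. Qed.

HB.instance Definition _ := GRing.Lmodule_isLalgebra.Build R (along f)
  along_scaleAl.
HB.instance Definition _ := GRing.Lalgebra_isComAlgebra.Build R (along f).
End Along.


(* Tensor product of modules, by generators and relations: a list of pairs    *)
(* (m, n) stands for the sum of the m (x) n. No rule is needed for opposites, *)
(* since (- m) (x) n is the opposite of m (x) n.                              *)

Section Tensor.
Variables (R : comNzRingType) (M N : lmodType R).

Inductive tensor_rel : seq (M * N) -> seq (M * N) -> Prop :=
| tensor_refl s : tensor_rel s s
| tensor_sym s t : tensor_rel s t -> tensor_rel t s
| tensor_trans s t u : tensor_rel s t -> tensor_rel t u -> tensor_rel s u
| tensor_cat s s' t t' :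
    tensor_rel s s' -> tensor_rel t t' -> tensor_rel (s ++ t) (s' ++ t')
| tensor_catC s t : tensor_rel (s ++ t) (t ++ s)
| tensor_rel0 n : tensor_rel [:: (0, n)] [::]
| tensor_relDl m m' n : tensor_rel [:: (m + m', n)] [:: (m, n); (m', n)]
| tensor_relDr m n n' : tensor_rel [:: (m, n + n')] [:: (m, n); (m, n')]
| tensor_relZ a m n : tensor_rel [:: (a *: m, n)] [:: (m, a *: n)].

Definition tensor_eqv (s t : seq (M * N)) : bool := `[< tensor_rel s t >].

Fact tensor_eqv_class : equiv_class_of tensor_eqv.
Proof.
split=> [s|s t|t s u].
- exact/asboolP/tensor_refl.
- by apply/asboolP/asboolP; exact: tensor_sym.
- by move=> /asboolP st /asboolP tu; apply/asboolP/(tensor_trans st tu).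
Qed.

Canonical tensor_equiv := EquivRelPack tensor_eqv_class.
Canonical tensor_encModRel := defaultEncModRel tensor_eqv.

Definition tensor := {eq_quot tensor_eqv}.

HB.instance Definition _ : EqQuotient _ tensor_eqv tensor :=
  EqQuotient.on tensor.
HB.instance Definition _ := Choice.on tensor.

Lemma tensor_pi s t : tensor_rel s t -> \pi_tensor s = \pi_tensor t.
Proof. by move=> st; apply/eqP; rewrite piE /=; apply/asboolP. Qed.

Lemma tensor_repr s : tensor_rel (repr (\pi_tensor s)) s.
Proof. by have /eqP := reprK (\pi_tensor s); rewrite piE => /asboolP. Qed.

Definition tensor_zero : tensor := \pi_tensor [::].
Definition tensor_add (x y : tensor) : tensor := \pi_tensor (repr x ++ repr y).
Definition tensor_opp (x : tensor) : tensor :=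
  \pi_tensor [seq (- p.1, p.2) | p <- repr x].

Lemma tensor_add_pi s t :
  tensor_add (\pi s) (\pi t) = \pi_tensor (s ++ t).
Proof. exact/tensor_pi/tensor_cat/tensor_repr/tensor_repr. Qed.

Fact tensor_addA : associative tensor_add.
Proof.
move=> x y z; rewrite -[x]reprK -[y]reprK -[z]reprK.
by rewrite !tensor_add_pi catA.
Qed.

Fact tensor_addC : commutative tensor_add.
Proof. by move=> x y; apply/tensor_pi/tensor_catC. Qed.

Fact tensor_add0 : left_id tensor_zero tensor_add.
Proof. by move=> x; rewrite -[x]reprK tensor_add_pi. Qed.

Fact tensor_addN : left_inverse tensor_zero tensor_opp tensor_add.
Proof.
move=> x; rewrite -[in X in tensor_add _ X](reprK x) tensor_add_pi.
apply: tensor_pi; elim: (repr x) => [|[m n] s IHs] /=; first exact: tensor_refl.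
set s' := [seq _ | p <- s] in IHs *.
apply: (@tensor_trans _ ([:: (- m, n); (m, n)] ++ (s' ++ s))).
  rewrite -cat1s -[(m, n) :: s]cat1s -[[:: _; _]]/([:: (- m, n)] ++ [:: (m, n)]).
  rewrite -!catA; apply: tensor_cat; first exact: tensor_refl.
  rewrite !catA; apply: tensor_cat; [exact: tensor_catC | exact: tensor_refl].
rewrite -[[::]]cats0; apply: tensor_cat => //.
apply: (tensor_trans (tensor_sym (tensor_relDl _ _ _))).
by rewrite addNr; exact: tensor_rel0.
Qed.

HB.instance Definition _ := GRing.isZmodule.Build tensor
  tensor_addA tensor_addC tensor_add0 tensor_addN.

Definition tens (m : M) (n : N) : tensor := \pi_tensor [:: (m, n)].

Lemma tensDl m m' n : tens (m + m') n = tens m n + tens m' n.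
Proof.
rewrite /tens -[RHS]/(tensor_add _ _) tensor_add_pi.
exact/tensor_pi/tensor_relDl.
Qed.

Lemma tensDr m n n' : tens m (n + n') = tens m n + tens m n'.
Proof.
rewrite /tens -[RHS]/(tensor_add _ _) tensor_add_pi.
exact/tensor_pi/tensor_relDr.
Qed.

Lemma tensZ a m n : tens (a *: m) n = tens m (a *: n).
Proof. exact/tensor_pi/tensor_relZ. Qed.

Lemma tens0 n : tens 0 n = 0.
Proof. exact/tensor_pi/tensor_rel0. Qed.

Lemma tensor_pi_sum s : \pi_tensor s = \sum_(p <- s) tens p.1 p.2.
Proof.
elim: s => [|[m n] s IHs]; first by rewrite big_nil.
by rewrite big_cons -IHs -[RHS]/(tensor_add _ _) tensor_add_pi.
Qed.

Lemma tensor_ind (P : tensor -> Prop) :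
  P 0 -> (forall m n, P (tens m n)) ->
  (forall x y, P x -> P y -> P (x + y)) -> forall x, P x.
Proof.
move=> P0 Pt PD x; rewrite -[x]reprK tensor_pi_sum.
by apply: big_ind => // p _; exact: Pt.
Qed.

Section Lift.
Variables (V : zmodType) (F : M -> N -> V).

Definition balanced :=
  [/\ forall m m' n, F (m + m') n = F m n + F m' n,
      forall m n n', F m (n + n') = F m n + F m n'
    & forall a m n, F (a *: m) n = F m (a *: n)].

Definition tensor_lift (x : tensor) : V := \sum_(p <- repr x) F p.1 p.2.

Hypothesis Fbal : balanced.

Lemma tensor_lift_pi s : tensor_lift (\pi_tensor s) = \sum_(p <- s) F p.1 p.2.
Proof.
have [Dl Dr Z] := Fbal; have F0 n : F 0 n = 0.
  by apply: (@addrI _ (F 0 n)); rewrite -Dl !addr0.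
rewrite /tensor_lift; have := tensor_repr s; move: (repr _) => t.
elim=> {s t} //.
- by move=> s t u _ -> _ ->.
- by move=> s s' t t' _ IHs _ IHt; rewrite !big_cat IHs IHt.
- by move=> s t; rewrite !big_cat; exact: addrC.
- by move=> n; rewrite big_seq1 big_nil F0.
- by move=> m m' n; rewrite !big_cons !big_nil !addr0 Dl.
- by move=> m n n'; rewrite !big_cons !big_nil !addr0 Dr.
- by move=> a m n; rewrite !big_cons !big_nil Z.
Qed.

Lemma tensor_lift_tens m n : tensor_lift (tens m n) = F m n.
Proof. by rewrite tensor_lift_pi big_seq1. Qed.

Lemma tensor_lift0 : tensor_lift 0 = 0.
Proof. by rewrite -[0]/(\pi_tensor [::]) tensor_lift_pi big_nil. Qed.

Lemma tensor_liftD x y : tensor_lift (x + y) = tensor_lift x + tensor_lift y.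
Proof.
rewrite -[x in LHS]reprK -[y in LHS]reprK -[X in tensor_lift X]/(tensor_add _ _).
by rewrite tensor_add_pi tensor_lift_pi big_cat.
Qed.

End Lift.
End Tensor.

Definition tensor_map (R : comNzRingType) (M N N' : lmodType R) (f : N -> N') :
    tensor M N -> tensor M N' :=
  tensor_lift (fun m n => tens m (f n)).

(* M (x)_R S as an S-module, and as a ring when M is an R-algebra             *)

Section ScalarExtension.
Variables (R : comNzRingType) (M : lmodType R) (S : comAlgType R).

Definition tensor_scale (c : S) : tensor M S -> tensor M S :=
  tensor_lift (fun m x => tens m (c * x)).

Fact tensor_scale_bal (c : S) :
  balanced (fun (m : M) (x : S) => tens m (c * x)).
Proof.
split=> [m m' x|m x x'|a m x]; first exact: tensDl.
  by rewrite mulrDr tensDr.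
by rewrite tensZ scalerAr.
Qed.

Let scaleE c m x : tensor_scale c (tens m x) = tens m (c * x).
Proof. by rewrite /tensor_scale tensor_lift_tens //; exact: tensor_scale_bal. Qed.

Fact tensor_scaleDr : right_distributive tensor_scale +%R.
Proof. by move=> c x y; exact/tensor_liftD/tensor_scale_bal. Qed.

Let scale0 c : tensor_scale c 0 = 0.
Proof. exact/tensor_lift0/tensor_scale_bal. Qed.

Fact tensor_scaleA c d x :
  tensor_scale c (tensor_scale d x) = tensor_scale (c * d) x.
Proof.
elim/tensor_ind: x => [|m y|x y IHx IHy]; first by rewrite !scale0.
  by rewrite !scaleE mulrA.
by rewrite !tensor_scaleDr IHx IHy.
Qed.

Fact tensor_scale1 : left_id 1 tensor_scale.
Proof.
elim/tensor_ind=> [|m y|x y IHx IHy]; first by rewrite !scale0.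
  by rewrite !scaleE mul1r.
by rewrite !tensor_scaleDr IHx IHy.
Qed.

Fact tensor_scaleDl x : {morph tensor_scale^~ x : c d / c + d}.
Proof.
move=> c d /=; elim/tensor_ind: x => [|m y|x y IHx IHy].
- by rewrite !scale0 addr0.
- by rewrite !scaleE mulrDl tensDr.
- by rewrite !tensor_scaleDr IHx IHy addrACA.
Qed.

HB.instance Definition _ := GRing.Zmodule_isLmodule.Build S (tensor M S)
  tensor_scaleA tensor_scale1 tensor_scaleDr tensor_scaleDl.
End ScalarExtension.

Section BaseChange.
Variables (R : comNzRingType) (B S : comAlgType R).

Definition tensor_mul (x y : tensor B S) : tensor B S :=
  tensor_lift (fun b c => tensor_lift (fun b' c' => tens (b * b') (c * c')) y) x.

Fact tensor_mul_balr (b : B) (c : S) :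
  balanced (fun (b' : B) (c' : S) => tens (b * b') (c * c')).
Proof.
split=> [x x' y|x y y'|a x y].
- by rewrite mulrDr tensDl.
- by rewrite mulrDr tensDr.
- by rewrite -!scalerAr tensZ.
Qed.

Fact tensor_mul_ball (y : tensor B S) :
  balanced (fun (b : B) (c : S) =>
    tensor_lift (fun b' c' => tens (b * b') (c * c')) y).
Proof.
have bal := tensor_mul_balr.
split=> [b b' c|b c c'|a b c]; elim/tensor_ind: y => [|u v|x y IHx IHy];
  rewrite ?tensor_lift0 ?tensor_lift_tens ?tensor_liftD ?addr0 //.
- by rewrite mulrDl tensDl.
- by rewrite IHx IHy addrACA.
- by rewrite mulrDl tensDr.
- by rewrite IHx IHy addrACA.
- by rewrite -!scalerAl tensZ.
- by rewrite IHx IHy.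
Qed.

Let mulE b c b' c' : tensor_mul (tens b c) (tens b' c') = tens (b * b') (c * c').
Proof.
rewrite /tensor_mul tensor_lift_tens; last exact: tensor_mul_ball.
by rewrite tensor_lift_tens //; exact: tensor_mul_balr.
Qed.

Fact tensor_mulDl : left_distributive tensor_mul +%R.
Proof. by move=> x y z; exact/tensor_liftD/tensor_mul_ball. Qed.

Let mul0 x : tensor_mul 0 x = 0.
Proof. exact/tensor_lift0/tensor_mul_ball. Qed.

Let mul_tens0 b c : tensor_mul (tens b c) 0 = 0.
Proof.
rewrite /tensor_mul tensor_lift_tens; last exact: tensor_mul_ball.
exact/tensor_lift0/tensor_mul_balr.
Qed.

Let mul_tensD b c x y : tensor_mul (tens b c) (x + y) =
  tensor_mul (tens b c) x + tensor_mul (tens b c) y.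
Proof.
rewrite /tensor_mul !tensor_lift_tens; do ?exact: tensor_mul_ball.
exact/tensor_liftD/tensor_mul_balr.
Qed.

Fact tensor_mulC : commutative tensor_mul.
Proof.
move=> x y; elim/tensor_ind: x => [|b c|x x' IHx IHx'].
- rewrite mul0; elim/tensor_ind: y => [|b c|y y' IHy IHy'].
  + by rewrite mul0.
  + by rewrite mul_tens0.
  + by rewrite tensor_mulDl -IHy -IHy' addr0.
- elim/tensor_ind: y => [|b' c'|y y' IHy IHy'].
  + by rewrite mul0 mul_tens0.
  + by rewrite !mulE mulrC [c * _]mulrC.
  + by rewrite mul_tensD IHy IHy' tensor_mulDl.
- rewrite tensor_mulDl IHx IHx'; elim/tensor_ind: y {IHx IHx'} => [|b c|y y' IHy IHy'].
  + by rewrite !mul0 addr0.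
  + by rewrite mul_tensD.
  + by rewrite !tensor_mulDl addrACA IHy IHy'.
Qed.

Fact tensor_mulA : associative tensor_mul.
Proof.
have mulDr x y z : tensor_mul x (y + z) = tensor_mul x y + tensor_mul x z.
  by rewrite !(tensor_mulC x) tensor_mulDl.
have mulr0 x : tensor_mul x 0 = 0 by rewrite tensor_mulC mul0.
elim/tensor_ind=> [|b c|x x' IHx IHx'] y z; first by rewrite !mul0.
  elim/tensor_ind: y => [|b' c'|y y' IHy IHy'].
  - by rewrite mulr0 mul0 mulr0.
  - elim/tensor_ind: z => [|b'' c''|z z' IHz IHz']; first by rewrite !mulr0.
      by rewrite !mulE !mulrA.
    by rewrite !mulDr IHz IHz'.
  - by rewrite tensor_mulDl !mulDr IHy IHy' tensor_mulDl.
by rewrite !tensor_mulDl IHx IHx'.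
Qed.

Fact tensor_mul1 : left_id (tens 1 1) tensor_mul.
Proof.
elim/tensor_ind=> [|b c|x y IHx IHy]; first exact: mul_tens0.
  by rewrite mulE !mul1r.
by rewrite mul_tensD IHx IHy.
Qed.

HB.instance Definition _ := GRing.Zmodule_isComPzRing.Build (tensor B S)
  tensor_mulA tensor_mulC tensor_mul1 tensor_mulDl.
End BaseChange.


Definition finite_module (R : comNzRingType) (M : lmodType R) : Prop :=
  exists (k : nat) (g : 'I_k -> M), forall x, exists a : 'I_k -> R,
    x = \sum_(i < k) a i *: g i.

Definition flat (R : comNzRingType) (M : lmodType R) : Prop :=
  forall (N N' : lmodType R) (f : {linear N -> N'}),
    injective f -> injective (@tensor_map R M N N' f).

(* An element of the bidual: an R-linear map from M^* = {scalar M} to R. As   *)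
(* {scalar M} carries no module structure, f = a *: g + h is read pointwise.  *)
Definition bidual_elt (R : comNzRingType) (M : lmodType R)
    (Phi : {scalar M} -> R) : Prop :=
  forall (a : R) (f g h : {scalar M}),
    (forall m, f m = a * g m + h m) -> Phi f = a * Phi g + Phi h.

Definition reflexive_module (R : comNzRingType) (M : lmodType R) : Prop :=
  (forall m m' : M, (forall f : {scalar M}, f m = f m') -> m = m') /\
  (forall Phi, bidual_elt Phi ->
     exists m : M, forall f : {scalar M}, Phi f = f m).

Definition frac_alg (R : idomainType) : comAlgType R := along (@tofrac R).

Definition has_rank (R : idomainType) (M : lmodType R) (r : nat) : Prop :=
  exists h : {linear tensor M (frac_alg R) -> 'rV[frac_alg R]_r}, bijective h.

(* Unlike the library's idealr, an ideal may be the whole ring.               *)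
Definition ideal (R : comNzRingType) (I : {pred R}) : Prop :=
  0 \in I /\ forall a, {in I &, forall u v, a * u + v \in I}.

Definition ideal_gen (R : comNzRingType) (X : R -> Prop) : {pred R} :=
  fun x => `[< exists (k : nat) (a g : 'I_k -> R),
    (forall i, X (g i)) /\ x = \sum_(i < k) a i * g i >].

Fixpoint ideal_pow (R : comNzRingType) (I : {pred R}) (n : nat) : {pred R} :=
  if n is n'.+1 then
    ideal_gen (fun x => exists u v,
      [/\ u \in I, v \in ideal_pow I n' & x = u * v])
  else predT.

Definition noetherian (R : comNzRingType) : Prop :=
  forall I : {pred R}, ideal I -> exists (k : nat) (g : 'I_k -> R),
    I =i ideal_gen (fun x => exists i, x = g i).

Definition normal_domain (R : idomainType) : Prop :=
  forall x : {fraction R}, integralOver (@tofrac R) x ->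
    exists a : R, x = tofrac a.

Definition contains_rat (R : comNzRingType) : Prop :=
  exists f : {rmorphism rat -> R}, injective f.

Definition prime_chain (R : comNzRingType) (P : prime_idealr R) (n : nat) :
    Prop :=
  exists c : nat -> prime_idealr R, c n =i P /\
    forall i, (i < n)%N ->
      {subset c i <= c i.+1} /\ ~ {subset c i.+1 <= c i}.

Definition has_height (R : comNzRingType) (P : prime_idealr R) (h : nat) :
    Prop :=
  prime_chain P h /\ forall n, prime_chain P n -> (n <= h)%N.

(* P is the annihilator of the class of x in R / I.                           *)
Definition associated_prime (R : comNzRingType) (I : {pred R})
    (P : prime_idealr R) : Prop :=
  exists x : R, forall r, (r \in P) = (r * x \in I).

Definition unmixed_height_one (R : comNzRingType) (I : {pred R}) : Prop :=
  ideal I /\ forall P : prime_idealr R, associated_prime I P -> has_height P 1.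

Section IdealGen.
Variable R : comNzRingType.
Implicit Types (X Y : R -> Prop) (I : {pred R}).

Lemma ideal_gen_ideal X : ideal (ideal_gen X).
Proof.
split.
  apply/asboolP; exists 0%N, (fun=> 0), (fun=> 0).
  by split=> [[]//|]; rewrite big_ord0.
move=> c u v /asboolP[k [a [g [Xg ->]]]] /asboolP[l [b [h [Xh ->]]]].
apply/asboolP; exists (k + l)%N.
exists (fun i => match split i with inl j => c * a j | inr j => b j end).
exists (fun i => match split i with inl j => g j | inr j => h j end).
split=> [i|]; first by case: (split i).
rewrite big_split_ord mulr_sumr; congr (_ + _); apply: eq_bigr => i _.
  by rewrite (unsplitK (inl i)) mulrA.
by rewrite (unsplitK (inr i)).
Qed.

Lemma idealD I u v : ideal I -> u \in I -> v \in I -> u + v \in I.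
Proof. by move=> [_ IP] Iu Iv; rewrite -[u]mul1r IP. Qed.

Lemma idealMl I a u : ideal I -> u \in I -> a * u \in I.
Proof. by move=> [I0 IP] Iu; rewrite -[_ * _]addr0 IP. Qed.

Lemma ideal_sum I (J : finType) (F : J -> R) :
  ideal I -> (forall j, F j \in I) -> \sum_j F j \in I.
Proof.
move=> idI IF; apply: (big_ind (fun x => x \in I)) => //; first by case: idI.
by move=> u v; exact: idealD.
Qed.

Lemma ideal_gen_in X x : X x -> x \in ideal_gen X.
Proof.
move=> Xx; apply/asboolP; exists 1%N, (fun=> 1), (fun=> x).
by rewrite big_ord1 mul1r.
Qed.

Lemma ideal_gen_ind X I :
  ideal I -> (forall x, X x -> x \in I) -> {subset ideal_gen X <= I}.
Proof.
move=> idI XI x /asboolP[k [a [g [Xg ->]]]].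
by apply: ideal_sum => // i; apply: idealMl => //; apply: XI.
Qed.

Lemma ideal_pow_ideal I n : ideal (ideal_pow I n).
Proof. by case: n => [|n]; [split | exact: ideal_gen_ideal]. Qed.

Lemma ideal_powM I m n u v :
  u \in ideal_pow I m -> v \in ideal_pow I n -> u * v \in ideal_pow I (m + n).
Proof.
elim: m => [|m IHm] in u *; first by move=> _; exact/idealMl/ideal_pow_ideal.
move=> /asboolP[k [a [g [gP ->]]]] Iv; rewrite mulr_suml.
apply: ideal_sum; first exact: ideal_pow_ideal.
move=> i; rewrite -mulrA; apply: idealMl; first exact: ideal_pow_ideal.
have [x [y [Ix Iy ->]]] := gP i; rewrite -mulrA; apply: ideal_gen_in.
by exists x, (y * v); split=> //; apply: IHm.
Qed.
End IdealGen.

(* The localization R_P, inside the fraction field                            *)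

Section Localization.
Variables (R : idomainType) (P : prime_idealr R).

Definition loc_pred : {pred {fraction R}} :=
  fun x => `[< exists a s : R, s \notin P /\ x = tofrac a / tofrac s >].

Fact tofrac_neq0 (s : R) : s \notin P -> tofrac s != 0.
Proof. by rewrite tofrac_eq0; apply: contraNneq => ->; exact: idealr0. Qed.

Fact loc_subring_closed : subring_closed loc_pred.
Proof.
split=> [|x y|x y].
- apply/asboolP; exists 1, 1; rewrite idealr1 tofrac1 divr1; split=> //.
- move=> /asboolP[a [s [Ps ->]]] /asboolP[b [t [Pt ->]]].
  apply/asboolP; exists (a * t - b * s), (s * t).
  rewrite prime_idealrM negb_or Ps Pt; split=> //.
  by rewrite -mulNr addf_div ?tofrac_neq0 // tofracB !tofracM mulNr.
- move=> /asboolP[a [s [Ps ->]]] /asboolP[b [t [Pt ->]]].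
  apply/asboolP; exists (a * b), (s * t).
  rewrite prime_idealrM negb_or Ps Pt; split=> //.
  by rewrite mulf_div !tofracM.
Qed.

HB.instance Definition _ := GRing.isSubringClosed.Build {fraction R} loc_pred
  loc_subring_closed.

Record loc := Loc { loc_val :> {fraction R}; _ : loc_val \in loc_pred }.

HB.instance Definition _ := [isSub for loc_val].
HB.instance Definition _ := [Choice of loc by <:].
HB.instance Definition _ := [SubChoice_isSubComNzRing of loc by <:].

Fact to_loc_subproof (a : R) : tofrac a \in loc_pred.
Proof.
by apply/asboolP; exists a, 1; rewrite idealr1 tofrac1 divr1.
Qed.

Definition to_loc (a : R) : loc := Loc (to_loc_subproof a).

Fact to_loc_zmod : zmod_morphism to_loc.
Proof. by move=> a b; apply: val_inj; rewrite /= tofracB. Qed.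

Fact to_loc_monoid : monoid_morphism to_loc.
Proof. by split=> [|a b]; apply: val_inj; rewrite /= ?tofrac1 ?tofracM. Qed.

HB.instance Definition _ := GRing.isZmodMorphism.Build R loc to_loc to_loc_zmod.
HB.instance Definition _ := GRing.isMonoidMorphism.Build R loc to_loc
  to_loc_monoid.

(* The extended ideal I R_P                                                   *)
Definition loc_ideal (I : {pred R}) : {pred loc} :=
  ideal_gen (fun x => exists2 a, a \in I & x = to_loc a).

Definition loc_max : {pred loc} := loc_ideal P.

Fact loc_max_idealr : idealr_closed loc_max.
Proof.
have [max0 maxD] : ideal loc_max by exact: ideal_gen_ideal.
split=> //; apply/negP=> /asboolP[k [a [g [gP]]]].
pose num_in (x : loc) := exists b s : R,
  [/\ b \in P, s \notin P & val x = tofrac b / tofrac s].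
have : num_in (\sum_i a i * g i).
  apply: (big_ind num_in) => [|x y|i _].
  - by exists 0, 1; rewrite idealr0 idealr1 tofrac0 mul0r.
  - move=> [b [s [Pb Ps xE]]] [c [t [Pc Pt yE]]].
    exists (t * b + s * c), (s * t).
    split; first by rewrite rpredD ?idealMr.
      by rewrite prime_idealrM negb_or Ps Pt.
    rewrite /= in xE yE *; rewrite xE yE addf_div ?tofrac_neq0 //.
    by rewrite tofracD !tofracM [tofrac b * _]mulrC [tofrac c * _]mulrC.
  - have [b Pb ->] := gP i; have /asboolP[c [s [Ps zE]]] := valP (a i).
    exists (c * b), s; rewrite idealMr //; split=> //=.
    by rewrite [loc_val _]zE tofracM mulrAC.
move=> [b [s [Pb Ps sE]]] /esym sum1; rewrite sum1 in sE.
move/esym: sE => /(canRL (divfK (tofrac_neq0 Ps))); rewrite mul1r.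
by move/eqP; rewrite tofrac_eq => /eqP bs; rewrite -bs Pb in Ps.
Qed.

HB.instance Definition _ := isIdealr.Build loc loc_max loc_max_idealr.

(* k(P) = R_P / P R_P                                                         *)
Definition residue_ring : comNzRingType := {ideal_quot loc_max}.

Definition to_residue (a : R) : residue_ring :=
  \pi_{ideal_quot loc_max} (to_loc a).

Fact to_residue_zmod : zmod_morphism to_residue.
Proof. by move=> a b; rewrite /to_residue rmorphB !piE. Qed.

Fact to_residue_monoid : monoid_morphism to_residue.
Proof. by split=> [|a b]; rewrite /to_residue ?rmorph1 ?rmorphM !piE. Qed.

HB.instance Definition _ := GRing.isZmodMorphism.Build R residue_ring to_residue
  to_residue_zmod.
HB.instance Definition _ := GRing.isMonoidMorphism.Build R residue_ring
  to_residue to_residue_monoid.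

Definition residue_alg : comAlgType R := along to_residue.
End Localization.

Arguments to_loc {R} P a.
Arguments loc_ideal {R} P I _.

Definition finitely_generated_algebra (R : comNzRingType) (B : comAlgType R) :
    Prop :=
  exists (k : nat) (b : 'I_k -> B), forall x : B, exists p : {mpoly R[k]},
    x = mmap (in_alg B) b p.

Definition affine_fibration (n : nat) (R : idomainType) (B : comAlgType R) :
    Prop :=
  [/\ finitely_generated_algebra B, flat B
    & forall P : prime_idealr R,
        exists h : {rmorphism tensor B (residue_alg P) ->
                              {mpoly (residue_alg P)[n]}},
          bijective h /\ scalable h].

Record derivation (R : comNzRingType) (B : comAlgType R) := Derivation {
  derivation_val :> {linear B -> B};
  derivationM : forall x y,
    derivation_val (x * y) = derivation_val x * y + x * derivation_val y }.

Definition locally_nilpotent (R : comNzRingType) (B : comAlgType R)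
    (D : derivation B) : Prop :=
  forall b : B, exists n : nat, iter n D b = 0.

Section Kernel.
Variables (R : comNzRingType) (B : comAlgType R) (D : derivation B).

Definition der_ker : {pred B} := fun b => D b == 0.

Fact der_ker_subalg : subalg_closed der_ker.
Proof.
split=> [|a x y /eqP Dx /eqP Dy|x y /eqP Dx /eqP Dy]; apply/eqP.
- have /eqP := derivationM D 1 1.
  by rewrite !mulr1 mul1r -subr_eq0 opprD addNKr oppr_eq0 => /eqP.
- by rewrite linearP Dx Dy scaler0 addr0.
- by rewrite derivationM Dx Dy mul0r mulr0 addr0.
Qed.

HB.instance Definition _ := GRing.isSubalgClosed.Build R B der_ker
  der_ker_subalg.

Definition ker_alg : comAlgType R := subalgebra der_ker.
End Kernel.

Section SymbolicRees.
Variables (R : idomainType) (I : {pred R}).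

Definition symbolic_pow (n : nat) : {pred R} :=
  fun r => `[< forall P : prime_idealr R, associated_prime I P ->
    to_loc P r \in loc_ideal P (ideal_pow I n) >].

Fact symbolic_pow_ideal n : ideal (symbolic_pow n).
Proof.
have locI P : ideal (loc_ideal P (ideal_pow I n)) by exact: ideal_gen_ideal.
split=> [|a u v /asboolP Iu /asboolP Iv]; apply/asboolP=> P PI.
  by rewrite rmorph0; case: (locI P).
by rewrite rmorphD rmorphM (locI P).2 // ?Iu ?Iv.
Qed.

Fact symbolic_pow0 r : r \in symbolic_pow 0.
Proof. by apply/asboolP=> P _; apply: ideal_gen_in; exists r. Qed.

Fact symbolic_powM m n u v : u \in symbolic_pow m -> v \in symbolic_pow n ->
  u * v \in symbolic_pow (m + n).
Proof.
move=> /asboolP Iu /asboolP Iv; apply/asboolP=> P PI; rewrite rmorphM /=.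
have /asboolP[k [a [g [gP uE]]]] := Iu P PI.
have /asboolP[l [b [h [hP vE]]]] := Iv P PI.
rewrite uE vE.
have locI : ideal (loc_ideal P (ideal_pow I (m + n))) by exact: ideal_gen_ideal.
rewrite mulr_suml; apply: ideal_sum => // i.
rewrite mulr_sumr; apply: ideal_sum => // j.
rewrite mulrACA; apply: idealMl => //; apply: ideal_gen_in.
have [x Ix ->] := gP i; have [y Iy ->] := hP j.
by exists (x * y); rewrite ?rmorphM //; apply: ideal_powM.
Qed.

Definition symbolic_rees : {pred {poly R}} :=
  fun p => `[< forall n, p`_n \in symbolic_pow n >].

Fact symbolic_rees_subalg : subalg_closed symbolic_rees.
Proof.
split=> [|a p q /asboolP Ip /asboolP Iq|p q /asboolP Ip /asboolP Iq];
  apply/asboolP=> n.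
- case: n => [|n]; first exact: symbolic_pow0.
  by rewrite coef1; case: (symbolic_pow_ideal n.+1).
- by rewrite coefD coefZ (symbolic_pow_ideal n).2.
- rewrite coefM; apply: ideal_sum; first exact: symbolic_pow_ideal.
  by move=> i; rewrite -[X in symbolic_pow X](subnKC (leq_ord i)) symbolic_powM.
Qed.

HB.instance Definition _ := GRing.isSubalgClosed.Build R {poly R} symbolic_rees
  symbolic_rees_subalg.

Definition rees_alg : comAlgType R := subalgebra symbolic_rees.

(* The component I^(n) T^n                                                    *)
Definition rees_comp (n : nat) : {pred rees_alg} :=
  fun p => `[< exists a : R, val p = a *: 'X^n >].
End SymbolicRees.

Definition grading (R : comNzRingType) (A : comAlgType R)
    (A_ : nat -> submodClosed A) : Prop :=
  [/\ 1 \in A_ 0%N,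
      forall i j, {in A_ i & A_ j, forall x y, x * y \in A_ (i + j)%N},
      forall x, exists (k : nat) (c : nat -> A),
        (forall i, c i \in A_ i) /\ x = \sum_(i < k) c i
    & forall (k : nat) (c : nat -> A), (forall i, c i \in A_ i) ->
        \sum_(i < k) c i = 0 -> forall i, (i < k)%N -> c i = 0].

Definition graded_iso (R : comNzRingType) (A B : comAlgType R)
    (A_ : nat -> submodClosed A) (B_ : nat -> {pred B}) (f : A -> B) : Prop :=
  bijective f /\ forall i x, (f x \in B_ i) = (x \in A_ i).

(* Inertness is a notion for subrings of an integral domain.                  *)
Definition inert (C : comNzRingType) (C0 : C -> Prop) : Prop :=
  GRing.integral_domain_axiom C /\
  forall a b : C, a != 0 -> b != 0 -> C0 (a * b) -> C0 a /\ C0 b.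

(* Main.v *)
From HB Require Import structures.
Require Import Defs.
From mathcomp Require Import all_boot all_order all_algebra.
From mathcomp Require Import boolp.
From mathcomp Require Import mpoly ring.

Set Implicit Arguments.
Unset Strict Implicit.
Unset Printing Implicit Defensive.

Import GRing.Theory.
Local Open Scope ring_scope.
Local Open Scope quotient_scope.

(* (i) Let K be the fraction field of R. Since B is flat with fibre K[X,Y] over
   K, it is a subring of K[X,Y], and by Rentschler's theorem the kernel of D is
   B /\ K[f]: an element of least positive degree of the kernel is irreducible,
   hence prime, and divides every element of the kernel vanishing at the origin.
   Let J be the fractional ideal of the a in K such that a f + c lies in B for
   some c in K. It is finitely generated: a multiple of a partial derivative of
   K[X,Y] preserves the finitely generated algebra B. Over B the equations
   a_i f + c_i = y_i on generators a_i of J are solved by f itself, so by faithful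
   flatness f can be translated by an element of R so that J f is in B. This is
   what makes the kernel graded. After scaling, J is an ideal I of R. If P is a
   prime of height one and a generates I locally at P, then a f is not constant
   in the fibre k(P)[X,Y], hence is transcendental over k(P), so the kernel is
   R_P[a f] locally at P. As B is the intersection of its localizations at
   height one primes, the kernel is the sum of the I^(n) f^n.

   (ii) An unmixed ideal I of height one is a colon ideal (d R : e); take
   C = R[X,Y] and D = e d/dX - d d/dY, whose kernel lies in K[X + (e/d) Y]. The r
   such that r (X + (e/d) Y) lies in C are the elements of I. *)


(** * Noetherian normal domains *)

(** The generator f is determined only up to an affine change, and a f enters B only after adding a
    constant that depends on a. Unless one translation serves all a at once, the homogeneous parts
    of a kernel element leave B and no grading appears. The denominators of J are bounded because f
    can be differentiated down to a constant.

    Normality makes R_P a discrete valuation ring for P of height one. These primes are handled as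
    the associated primes of principal ideals, because a failed divisibility, in R or in the flat
    algebra B, produces such a prime directly. If a f were constant in the fibre at P, then a f - v
    would be divisible by a uniformizer pi at P for some v, and (a/pi) f would satisfy the condition
    defining J locally, against the choice of a.

    In (ii), take a non-zero d in I and H = (dR : I). Then I = (dR : H), and e is an element of H
    that generates it at each of the finitely many height one primes over d. It is found on pencils
    e + t h with t an integer, differences of distinct integers being units of R.

    The field K is realized as the residue field at the prime 0, since the hypothesis on fibres is
    stated there. *)

Definition principal (R : comNzRingType) (a : R) : {pred R} :=
  fun x => `[< exists c, x = c * a >].

Lemma principal_ideal (R : comNzRingType) (a : R) : ideal (principal a).
Proof.
split; first by apply/asboolP; exists 0; rewrite mul0r.
move=> c u v /asboolP[x ->] /asboolP[y ->]; apply/asboolP.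
by exists (c * x + y); rewrite mulrDl mulrA.
Qed.

Definition colon (R : comNzRingType) (I : {pred R}) (x : R) : {pred R} :=
  fun r => r * x \in I.

Lemma in_colon (R : comNzRingType) (I : {pred R}) (x r : R) :
  (r \in colon I x) = (r * x \in I).
Proof. by []. Qed.

Lemma colon_ideal (R : comNzRingType) (I : {pred R}) (x : R) :
  ideal I -> ideal (colon I x).
Proof.
move=> idI; split; first by rewrite in_colon mul0r; case: idI.
by move=> a u v; rewrite !in_colon => ux vx; rewrite mulrDl -mulrA idI.2.
Qed.

Definition mk_prime (R : comNzRingType) (Q : {pred R})
  (idQ : idealr_closed Q) (prQ : prime_idealr_closed Q) : prime_idealr R :=
  HB.pack_for (prime_idealr R) (Q : R -> bool)
    (isIdealr.Build R Q idQ) (isPrimeIdealrClosed.Build R Q prQ).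

Lemma prime_ideal (R : comNzRingType) (P : prime_idealr R) : ideal P.
Proof.
split; first exact: idealr0.
by move=> a u v Pu Pv; rewrite rpredD // idealMr.
Qed.

Section ZeroPrime.
Variable R : idomainType.

Fact zero_idealr : idealr_closed (pred1 (0 : R)).
Proof.
split; rewrite ?inE ?eqxx ?oner_eq0 // => a u v; rewrite !inE.
by move=> /eqP-> /eqP->; rewrite mulr0 addr0.
Qed.

Fact zero_prime_closed : prime_idealr_closed (pred1 (0 : R)).
Proof. by move=> u v; rewrite !inE mulf_eq0. Qed.

Definition zero_prime : prime_idealr R := mk_prime zero_idealr zero_prime_closed.

Lemma in_zero_prime x : (x \in zero_prime) = (x == 0).
Proof. by []. Qed.
End ZeroPrime.

(** * Ascending chains and associated primes *)

Section Noetherian.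
Variables (R : comNzRingType) (noeR : noetherian R).

Lemma noetherian_chain (A : nat -> {pred R}) :
  (forall n, ideal (A n)) -> (forall n, {subset A n <= A n.+1}) ->
  exists n, forall m, {subset A m <= A n}.
Proof.
move=> idA incA.
have subA m n : (m <= n)%N -> {subset A m <= A n}.
  move=> /subnK <-; elim: (n - m)%N => [|k IHk] x Ax //.
  by apply: incA; apply: IHk.
pose U : {pred R} := fun x => `[< exists n, x \in A n >].
have idU : ideal U.
  split; first by apply/asboolP; exists 0%N; case: (idA 0%N).
  move=> a u v /asboolP[m Au] /asboolP[n Av]; apply/asboolP.
  exists (maxn m n); apply: (idA _).2.
    by apply: subA Au; exact: leq_maxl.
  by apply: subA Av; exact: leq_maxr.
have [k [g gU]] := noeR idU.
have Ug i : exists n, g i \in A n.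
  have : g i \in U by rewrite gU ideal_gen_in //; exists i.
  by move/asboolP.
have [n nP] := choice Ug.
exists (\max_i n i)%N => m x Ax.
have : x \in U by apply/asboolP; exists m.
rewrite gU; apply: ideal_gen_ind => // _ [i ->].
by apply: subA (nP i); exact: leq_bigmax.
Qed.

Lemma noetherian_max (F : {pred R} -> Prop) (I0 : {pred R}) :
  (forall I, F I -> ideal I) -> F I0 ->
  exists M : {pred R}, F M /\ forall I, F I -> {subset M <= I} -> {subset I <= M}.
Proof.
move=> idF FI0; apply: contrapT => noM.
have next (M : {pred R}) : exists I : {pred R}, F M ->
    [/\ F I, {subset M <= I} & ~ {subset I <= M}].
  have [FM|nFM] := pselect (F M); last by exists M.
  apply: contrapT => noI; apply: noM; exists M; split=> // I FI MI.
  by apply: contrapT => IM; apply: noI; exists I.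
have [f fP] := choice next.
have Fiter n : F (iter n f I0).
  by elim: n => //= n IHn; case: (fP _ IHn).
have [n nP] := @noetherian_chain (fun n => iter n f I0)
  (fun n => idF _ (Fiter n)) (fun n => let: And3 _ s _ := fP _ (Fiter n) in s).
by case: (fP _ (Fiter n)) => _ _; apply; exact: (nP n.+1).
Qed.

(** A maximal member among the proper ideals (I : c x) is prime. Ranging over multiples of [x],
    rather than over all elements, makes this prime contain (I : x). *)
Lemma associated_above (I : {pred R}) (x : R) : ideal I -> x \notin I ->
  exists2 P : prime_idealr R, associated_prime I P & {subset colon I x <= P}.
Proof.
move=> idI Ix.
pose F (J : {pred R}) := exists c, [/\ c * x \notin I & J =i colon I (c * x)].
have idF J : F J -> ideal J.
  move=> [c [_ Jc]]; have [cI0 cID] := colon_ideal (c * x) idI.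
  by split=> [|a u v]; rewrite !Jc //; exact: cID.
have F0 : F (colon I x) by exists 1; rewrite mul1r.
have [M [FM maxM]] := noetherian_max idF F0.
have {FM} [c [Icx Mc]] := FM.
have ideM : idealr_closed M.
  have [M0 MD] : ideal M by apply: idF; exists c.
  by split=> //; rewrite Mc in_colon mul1r.
have primeM : prime_idealr_closed M.
  move=> u v Muv; apply/orP; have [Mv|nMv] := boolP (v \in M); first by right.
  left; have Fv : F (colon I (v * c * x)).
    exists (v * c); split=> //; rewrite -mulrA.
    by move: nMv; rewrite Mc in_colon.
  apply: (maxM _ Fv) => [r|].
    rewrite Mc !in_colon => Ir; rewrite -mulrA mulrCA; exact: idealMl.
  by move: Muv; rewrite Mc !in_colon !mulrA.
exists (mk_prime ideM primeM).
  by exists (c * x) => r; have := Mc r; rewrite in_colon.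
move=> r; rewrite in_colon => rx; have := Mc r.
by rewrite in_colon mulrCA idealMl.
Qed.

(** A maximal member among the colons (I : x) contained in [P] is prime; it contains [I], so
    minimality makes it equal to [P]. *)
Lemma associated_minimal (I : {pred R}) (P : prime_idealr R) :
  ideal I -> {subset I <= P} ->
  (forall Q : prime_idealr R, {subset I <= Q} -> {subset Q <= P} ->
     {subset P <= Q}) ->
  associated_prime I P.
Proof.
move=> idI IP minP.
pose F (J : {pred R}) := exists x, J =i colon I x /\ {subset J <= P}.
have idF J : F J -> ideal J.
  move=> [x [Jx _]]; have [cI0 cID] := colon_ideal x idI.
  by split=> [|a u v]; rewrite !Jx //; exact: cID.
have F0 : F (colon I 1).
  by exists 1; split=> // r; rewrite in_colon mulr1; exact: IP.
have [M [FM maxM]] := noetherian_max idF F0.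
have {FM} [x [Mx MP]] := FM.
have idM : ideal M by apply: idF; exists x.
have ideM : idealr_closed M.
  by case: idM => M0 MD; split=> //; apply/negP=> /MP; rewrite idealr1.
have primeM : prime_idealr_closed M.
  move=> u v Muv; apply/orP; have [Mu|nMu] := boolP (u \in M); first by left.
  right; have [vxP|nvxP] := pselect ({subset colon I (u * x) <= P}).
    apply: (maxM (colon I (u * x))) => [|r|]; first by exists (u * x).
      by rewrite Mx !in_colon => Ir; rewrite mulrCA idealMl.
    by move: Muv; rewrite Mx !in_colon mulrCA mulrA.
  have [s [sux Ps]] : exists s, s * (u * x) \in I /\ s \notin P.
    apply: contrapT => no; apply: nvxP => r; rewrite in_colon => rI.
    by apply: contrapT => /negP Pr; apply: no; exists r.
  (* As [s] is outside [P], this colon stays inside [P]: r s x in [I] puts r s in [M], hence r in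
     [P]. It contains both [M] and [u], against maximality. *)
  have Fs : F (colon I (s * x)).
    exists (s * x); split=> // r; rewrite in_colon mulrA => rsx.
    have : r * s \in M by rewrite Mx.
    by move/MP; rewrite prime_idealrM (negPf Ps) orbF.
  have MFs : {subset M <= colon I (s * x)}.
    by move=> r; rewrite Mx !in_colon => Ir; rewrite mulrCA idealMl.
  case/negP: nMu; apply: (maxM _ Fs) => //.
  by rewrite in_colon mulrCA.
have PM : {subset P <= M}.
  apply: (minP (mk_prime ideM primeM)) => // r Ir.
  by rewrite -[r \in _]/(r \in M) Mx in_colon mulrC idealMl.
exists x => r; rewrite -[RHS]/(r \in colon I x) -Mx.
by apply/idP/idP => [/PM|/MP].
Qed.

End Noetherian.

Lemma height_one_minimal (R : idomainType) (P Q : prime_idealr R) (d : R) :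
  has_height P 1 -> d != 0 -> d \in Q -> {subset Q <= P} -> {subset P <= Q}.
Proof.
move=> [_ maxP] d0 Qd QP; apply: contrapT => PQ.
suff /maxP : prime_chain P 2 by [].
exists (fun i => if i is i'.+1 then if i' is 0%N then Q else P else zero_prime R).
split=> // -[|[|//]] _ /=; split=> //.
  by move=> x; rewrite in_zero_prime => /eqP->; exact: idealr0.
by move=> /(_ _ Qd); rewrite in_zero_prime (negPf d0).
Qed.

Section NoetherianDomain.
Variables (R : idomainType) (noeR : noetherian R).

Lemma height_one_associated (I : {pred R}) (P : prime_idealr R) (d : R) :
  ideal I -> has_height P 1 -> d != 0 -> d \in I -> {subset I <= P} ->
  associated_prime I P.
Proof.
move=> idI hP d0 Id IP; apply: associated_minimal => // Q IQ QP.
exact: height_one_minimal hP d0 (IQ _ Id) QP.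
Qed.

(** In a Noetherian normal domain these are the height one primes, by [divisorial_height_one] and
    [height_one_divisorial]. The form chosen is the one that a failed divisibility produces. *)
Definition divisorial_prime (P : prime_idealr R) :=
  exists2 a : R, a != 0 & associated_prime (principal a) P.

Lemma divisorial_prime_neq0 P : divisorial_prime P -> exists2 a, a \in P & a != 0.
Proof.
move=> [a a0 [x xP]]; exists a => //; rewrite xP; apply/asboolP.
by exists x; rewrite mulrC.
Qed.

(** This is how R serves as the intersection of its localizations at divisorial primes: [a] divides
    [x] as soon as each such prime misses some element of (aR : x). *)
Lemma divisorial_above (a x : R) : a != 0 -> x \notin principal a ->
  exists2 P : prime_idealr R, divisorial_prime P &
    {subset colon (principal a) x <= P}.
Proof.
move=> a0 ax.
have [P PI sP] := associated_above noeR (principal_ideal a) ax.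
by exists P => //; exists a.
Qed.

(** * Localizations at divisorial primes are discrete valuation rings *)

Section Normal.
Hypothesis norR : normal_domain R.

(** Write P = (aR : b) and y = b/a, so that y P lies in R. If some y g_i is outside P, then g_i is a
    uniformizer. Otherwise y P lies in P, so y is an eigenvalue of a matrix over R, hence integral,
    hence in R by normality; then a divides b and 1 is in P. *)
Lemma divisorial_uniformizer P : divisorial_prime P ->
  exists p u : R, [/\ p \in P, u \notin P &
    forall x, x \in P -> exists r, u * x = r * p].
Proof.
move=> [a a0 [b Pb]].
have [k [g Pg]] := noeR (prime_ideal P).
have gP i : g i \in P by rewrite Pg ideal_gen_in //; exists i.
have cE i : exists c, g i * b = c * a.
  by have := gP i; rewrite Pb => /asboolP.
have [c cP] := choice cE.
have [[i Pi]|allP] := pselect (exists i, c i \notin P).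
  exists (g i), (c i); split=> // x; rewrite Pb => /asboolP[r rE].
  exists r; apply: (mulIf a0).
  transitivity (g i * (x * b)); last by rewrite rE; ring.
  by rewrite [RHS]mulrCA cP; ring.
exfalso.
have mE i : exists m : 'I_k -> R, c i = \sum_j m j * g j.
  have : c i \in P by apply: contrapT => /negP ?; apply: allP; exists i.
  rewrite Pg => /asboolP[l [e [h [hP ->]]]].
  have [s sE] := choice hP.
  exists (fun j => \sum_(t < l | s t == j) e t).
  rewrite (partition_big s xpredT) //=; apply: eq_bigr => j _.
  by rewrite mulr_suml; apply: eq_bigr => t /eqP <-; rewrite {1}sE.
have [m mP] := choice mE.
pose A := \matrix_(i, j) m j i.
pose v := \row_j g j.
pose y := tofrac b / tofrac a : {fraction R}.
have a0' : tofrac a != 0 by rewrite tofrac_eq0.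
have eigA : eigenvalue (map_mx (@tofrac R) A) y.
  apply/eigenvalueP; exists (map_mx (@tofrac R) v).
    apply/rowP=> j; rewrite !mxE; apply: (mulIf a0').
    rewrite [RHS]mulrAC /y divfK // [RHS]mulrC -tofracM cP mP tofracM.
    congr (_ * _); rewrite rmorph_sum; apply: eq_bigr => i _.
    by rewrite !mxE -tofracM mulrC.
  apply/negP=> /eqP/rowP v0.
  have g0 i : g i = 0 by have := v0 i; rewrite !mxE => /eqP; rewrite tofrac_eq0 => /eqP.
  have : a \in P by rewrite Pb; apply/asboolP; exists b; rewrite mulrC.
  rewrite Pg => /asboolP[l [e [h [hP aE]]]]; case/negP: a0; apply/eqP.
  by rewrite aE big1 // => i _; have [j ->] := hP i; rewrite g0 mulr0.
have [r rE] : exists r, y = tofrac r.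
  apply: norR; exists (char_poly A); first exact: char_poly_monic.
  by rewrite map_char_poly -eigenvalue_root_char.
have : 1 \in P.
  rewrite Pb mul1r; apply/asboolP; exists r; apply/eqP.
  by rewrite -(tofrac_eq b) tofracM -rE /y divfK.
by rewrite idealr1.
Qed.

(* [x] is divisible by [y] in the local ring at [P]. *)
Definition ldvd (P : prime_idealr R) (y x : R) :=
  exists s r, s \notin P /\ s * x = r * y.

Lemma ldvd_refl P x : ldvd P x x.
Proof. by exists 1, 1; rewrite idealr1. Qed.

Lemma ldvd_trans P y x z : ldvd P x y -> ldvd P y z -> ldvd P x z.
Proof.
move=> [s [r [Ps sE]]] [t [q [Pt tE]]]; exists (s * t), (q * r).
rewrite prime_idealrM negb_or Ps Pt; split=> //.
by rewrite -mulrA tE mulrCA sE mulrA.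
Qed.

Section Local.
Variables (P : prime_idealr R) (divP : divisorial_prime P).

(** Krull's intersection theorem at [P]. The ideals of those r with p^n r in x R_P ascend; once they
    are stationary at n, a quotient of x by p^(n+1) yields t s = c p with t and s outside [P]. *)
Lemma ldvd_sep (p x : R) : p \in P -> x != 0 ->
  exists n, ~ ldvd P (p ^+ n) x.
Proof.
move=> Pp x0; apply: contrapT => no.
have dv n : ldvd P (p ^+ n) x by apply: contrapT => ?; apply: no; exists n.
have p0 : p != 0.
  apply: contra_not_neq no => p0; exists 1%N; rewrite p0 => -[s [r [Ps]]].
  rewrite expr1 mulr0 => /eqP; rewrite mulf_eq0 (negPf x0) orbF => /eqP s0.
  by rewrite s0 idealr0 in Ps.
pose A n : {pred R} := fun r => `[< exists s c, s \notin P /\ s * p ^+ n * r = c * x >].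
have idA n : ideal (A n).
  split; first by apply/asboolP; exists 1, 0; rewrite idealr1 mulr0 mul0r.
  move=> a u v /asboolP[s [c [Ps sE]]] /asboolP[t [d [Pt tE]]]; apply/asboolP.
  exists (s * t), (a * t * c + s * d); rewrite prime_idealrM negb_or Ps Pt.
  split=> //; rewrite mulrDr mulrDl; congr (_ + _).
    by transitivity (a * t * (s * p ^+ n * u)); [ring | rewrite sE; ring].
  by transitivity (s * (t * p ^+ n * v)); [ring | rewrite tE; ring].
have incA n : {subset A n <= A n.+1}.
  move=> u /asboolP[s [c [Ps sE]]]; apply/asboolP; exists s, (p * c).
  by split=> //; rewrite -[RHS](mulrA p) -sE exprS; ring.
have [n nP] := noetherian_chain noeR idA incA.
have [s [r [Ps sE]]] := dv n.+1.
have : r \in A n.+1 by apply/asboolP; exists 1, s; rewrite idealr1 mul1r mulrC sE mulrC.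
move=> /nP /asboolP[t [c [Pt tE]]].
have : t * s = c * p.
  apply: (mulIf x0); transitivity (t * (s * x)); first by ring.
  by rewrite sE; transitivity (p * (t * p ^+ n * r));
    [rewrite exprS; ring | rewrite tE; ring].
move=> E; have : t * s \in P by rewrite E idealMr.
by rewrite prime_idealrM (negPf Ps) (negPf Pt).
Qed.

(** Repeated division by the uniformizer stops by [ldvd_sep], so a non-zero element is a power of it
    up to elements outside [P]; the exponents are then compared. *)
Lemma ldvd_total x y : ldvd P x y \/ ldvd P y x.
Proof.
have [p [u [Pp Pu uP]]] := divisorial_uniformizer divP.
have val z : z != 0 -> exists n s r,
    [/\ s \notin P, r \notin P & s * z = r * p ^+ n].
  move=> z0; have [N] := ldvd_sep Pp z0.
  elim: N => [|N IHN] nN; first by case: nN; exists 1, z; rewrite idealr1 mulr1 mul1r.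
  have [[s [r [Ps sE]]]|] := pselect (ldvd P (p ^+ N) z); last exact: IHN.
  have [Pr|nPr] := boolP (r \in P); last by exists N, s, r.
  have [q qE] := uP _ Pr; case: nN; exists (u * s), q.
  by rewrite prime_idealrM negb_or Pu Ps; split=> //;
    rewrite -mulrA sE mulrA qE exprS mulrA.
have [->|x0] := eqVneq x 0; first by right; exists 1, 0; rewrite idealr1 mulr0 mul0r.
have [->|y0] := eqVneq y 0; first by left; exists 1, 0; rewrite idealr1 mulr0 mul0r.
have [m [s [r [Ps Pr sE]]]] := val _ x0; have [n [t [q [Pt Pq tE]]]] := val _ y0.
have [le_mn|/ltnW le_nm] := leqP m n.
  left; exists (r * t), (q * p ^+ (n - m) * s).
  rewrite prime_idealrM negb_or Pr Pt; split=> //.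
  rewrite -[LHS]mulrA tE -[RHS]mulrA sE -{1}(subnK le_mn) exprD; ring.
right; exists (q * s), (r * p ^+ (m - n) * t).
rewrite prime_idealrM negb_or Pq Ps; split=> //.
rewrite -[LHS]mulrA sE -[RHS]mulrA tE -{1}(subnK le_nm) exprD; ring.
Qed.

Lemma ldvd_least k (g : 'I_k.+1 -> R) : exists i, forall j, ldvd P (g i) (g j).
Proof.
elim: k g => [|k IHk] g; first by exists ord0 => j; rewrite (ord1 j);
  exact: (ldvd_refl P (g ord0)).
have [i iP] := IHk (fun j => g (lift ord0 j)).
have [le|le] := ldvd_total (g ord0) (g (lift ord0 i)).
  exists ord0 => j; case: (unliftP ord0 j) => [j' ->|->]; last exact: ldvd_refl.
  exact: ldvd_trans le (iP j').
exists (lift ord0 i) => j; case: (unliftP ord0 j) => [j' ->|->] //; exact: iP.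
Qed.

Lemma ideal_local_gen (I : {pred R}) : ideal I ->
  exists2 x, x \in I & forall y, y \in I -> ldvd P x y.
Proof.
move=> idI; have [[|k] [g gI]] := noeR idI.
  exists 0; first by case: idI.
  move=> y; rewrite gI => /asboolP[n [a [h [hP ->]]]].
  exists 1, 0; rewrite idealr1 mul1r mul0r big1 // => i _.
  by have [[]] := hP i.
have [i iP] := ldvd_least g; exists (g i).
  by rewrite gI ideal_gen_in //; exists i.
move=> y; rewrite gI => /asboolP[n [a [h [hP ->]]]].
apply: (big_ind (ldvd P (g i))) => [|x z [s [r [Ps sE]]] [t [q [Pt tE]]]|j _].
- by exists 1, 0; rewrite idealr1 mulr0 mul0r.
- exists (s * t), (r * t + s * q); rewrite prime_idealrM negb_or Ps Pt.
  by split=> //; rewrite mulrDr mulrDl mulrAC sE -mulrA tE; ring.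
- have [l ->] := hP j; have [s [r [Ps sE]]] := iP l.
  by exists s, (a j * r); rewrite mulrCA sE mulrA.
Qed.

(** The product of the denominators of finitely many generators serves every [y] at once, whereas
    [ideal_local_gen] lets the denominator vary with [y]. *)
Lemma ideal_local_principal (I : {pred R}) : ideal I ->
  exists x s, [/\ x \in I, s \notin P & forall y, y \in I -> exists r, s * y = r * x].
Proof.
move=> idI; have [x Ix xP] := ideal_local_gen idI.
have [k [g gI]] := noeR idI.
have gx i : ldvd P x (g i) by apply: xP; rewrite gI ideal_gen_in //; exists i.
have [u uP] := choice gx; have [w wP] := choice uP.
exists x, (\prod_i u i); split=> // [|y].
  apply: (big_ind (fun z => z \notin P)) => [|y z Py Pz|i _].
  - by rewrite idealr1.
  - by rewrite prime_idealrM negb_or Py Pz.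
  - by case: (wP i).
suff sub : {subset I <= colon (principal x) (\prod_i u i)}.
  by move=> /sub; rewrite in_colon mulrC => /asboolP.
move=> {}y; rewrite gI; apply: ideal_gen_ind; first exact/colon_ideal/principal_ideal.
move=> _ [i ->]; rewrite in_colon (bigD1 i) //= mulrA; apply/asboolP.
exists ((\prod_(j < k | j != i) u j) * w i).
by rewrite [g i * _]mulrC (wP i).2 mulrC mulrA.
Qed.

(** A prime Q strictly between 0 and [P] misses the uniformizer, for otherwise [u], being outside Q,
    would force [P] into Q. Hence a non-zero element of Q can be divided at [P] by every power of
    the uniformizer, against [ldvd_sep]. *)
Lemma divisorial_height_one : has_height P 1.
Proof.
have [p [u [Pp Pu uP]]] := divisorial_uniformizer divP.
have [a Pa a0] := divisorial_prime_neq0 divP.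
split=> [|[|[|n]] // [c [cP inc]]].
  exists (fun i => if i is 0%N then zero_prime R else P); split=> // -[|//] _.
  split; first by move=> x; rewrite in_zero_prime => /eqP->; exact: idealr0.
  by move=> /(_ _ Pa); rewrite in_zero_prime (negPf a0).
exfalso; have [] := inc n (leqnSn _); have [] := inc n.+1 (leqnn _).
set Q := c n.+1; rewrite -/Q => QP PQ cQ Qc.
have [x Qx x0] : exists2 x, x \in Q & x != 0.
  apply: contrapT => no; apply: Qc => x Qx.
  have [->|x0] := eqVneq x 0; first exact: idealr0.
  by case: no; exists x.
have QP' : {subset Q <= P} by move=> z /QP; rewrite cP.
have Qp : p \notin Q.
  apply/negP=> Qp; apply: PQ => z; rewrite cP => /uP[r rE].
  have : u * z \in Q by rewrite rE idealMr.
  rewrite prime_idealrM => /orP[/QP'|//]; by rewrite (negPf Pu).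
have [m] := ldvd_sep Pp x0; apply.
elim: m => [|m [s [r [Ps sE]]]]; first by exists 1, x; rewrite idealr1 mulr1 mul1r.
have Qr : r \in Q.
  have : r * p ^+ m \in Q by rewrite -sE idealMr.
  rewrite prime_idealrM => /orP[//|]; elim: m {sE} => [|m IHm].
    by rewrite expr0 idealr1.
  by rewrite exprS prime_idealrM (negPf Qp).
have [q qE] := uP _ (QP' _ Qr); exists (u * s), q.
by rewrite prime_idealrM negb_or Pu Ps -mulrA sE mulrA qE exprS mulrA.
Qed.

End Local.

Lemma height_one_divisorial (P : prime_idealr R) (d : R) :
  has_height P 1 -> d \in P -> d != 0 ->
  associated_prime (principal d) P.
Proof.
move=> hP Pd d0; apply: (height_one_associated _ hP d0).
- exact: principal_ideal.
- by apply/asboolP; exists 1; rewrite mul1r.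
- by move=> _ /asboolP[c ->]; exact: idealMr.
Qed.

End Normal.
End NoetherianDomain.

Lemma avoid_prime (R : comNzRingType) (P : prime_idealr R)
    (s : seq (prime_idealr R)) :
  (forall Q : prime_idealr R, List.In Q s -> ~ {subset Q <= P}) ->
  exists2 q, q \notin P & forall Q : prime_idealr R, List.In Q s -> q \in Q.
Proof.
elim: s => [|Q s IHs] sP; first by exists 1; rewrite ?idealr1.
have [q Pq sq] := IHs (fun Q' Q's => sP Q' (or_intror Q's)).
have [x Qx Px] : exists2 x, x \in Q & x \notin P.
  apply: contrapT => no; apply: (sP Q (or_introl erefl)) => x Qx.
  by apply: contrapT => /negP Px; apply: no; exists x.
exists (x * q); first by rewrite prime_idealrM negb_or Px Pq.
by move=> Q' [<-|/sq]; [rewrite mulrC; exact: idealMr | exact: idealMr].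
Qed.

(** * Height one primes over an element; unmixed ideals as colon ideals *)

Section Finiteness.
Variables (R : idomainType) (noeR : noetherian R).

(* If [P_0, P_1, ...] were distinct and contained [d], the ideals    *)
(* [(d : P_0 /\ ... /\ P_n)] would form a strictly increasing chain. *)
Lemma height_one_finite (d : R) : d != 0 ->
  exists s : seq (prime_idealr R), forall P : prime_idealr R,
    has_height P 1 -> d \in P -> exists2 Q : prime_idealr R, List.In Q s & P =i Q.
Proof.
move=> d0; apply: contrapT => nofin.
pose bad (s : seq (prime_idealr R)) (P : prime_idealr R) :=
  [/\ has_height P 1, d \in P & forall Q : prime_idealr R, List.In Q s -> ~ P =i Q].
have badP s : exists P, bad s P.
  apply: contrapT => nobad; apply: nofin; exists s => P hP Pd.
  apply: contrapT => noQ; apply: nobad; exists P; split=> // Q sQ PQ.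
  by apply: noQ; exists Q.
have [f fP] := choice badP.
pose s := fix s n := if n is n'.+1 then f (s n') :: s n' else [::].
have sin n (Q : prime_idealr R) : List.In Q (s n) -> has_height Q 1 /\ d \in Q.
  by elim: n => //= n IHn [<-|//]; case: (fP (s n)).
pose A n : {pred R} := fun x => `[< forall q,
  (forall Q : prime_idealr R, List.In Q (s n) -> q \in Q) ->
  q * x \in principal d >].
have idA n : ideal (A n).
  have [p0 pD] := principal_ideal d.
  split=> [|a u v /asboolP Au /asboolP Av]; apply/asboolP => q qs.
    by rewrite mulr0.
  by rewrite mulrDr mulrCA; apply: pD; [exact: Au | exact: Av].
have incA n : {subset A n <= A n.+1}.
  move=> x /asboolP Ax; apply/asboolP => q qs; apply: Ax => Q Qs.
  by apply: qs; right.
have [n nP] := noetherian_chain noeR idA incA.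
have [hP Pd Pn] := fP (s n); set P := f (s n) in hP Pd Pn.
have [x xP] := height_one_divisorial noeR hP Pd d0.
have : x \in A n.+1.
  apply/asboolP => q qs; rewrite -xP; apply: qs; exact: or_introl.
move=> /nP /asboolP Ax.
(* None of the earlier primes lies in [P], so some q in all of them is outside [P]; but q x in dR
   means that q is in [P] = (dR : x). *)
have [|q Pq qs] := @avoid_prime _ P (s n).
  move=> Q Qs QP; have [_ Qd] := sin _ _ Qs; apply: (Pn _ Qs).
  have PQ := height_one_minimal hP d0 Qd QP.
  by move=> z; apply/idP/idP => [/PQ|/QP].
by case/negP: Pq; rewrite xP; exact: Ax.
Qed.

Hypotheses (norR : normal_domain R) (ratR : contains_rat R).

Lemma natr_unit (n : nat) : (0 < n)%N -> exists c : R, c * n%:R = 1.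
Proof.
move=> n0; have [f _] := ratR; exists (f (n%:R^-1)).
rewrite -(rmorph_nat f) -rmorphM mulVf ?rmorph1 //.
by rewrite Num.Theory.pnatr_eq0 -lt0n.
Qed.

Lemma natr_notin_prime (P : prime_idealr R) (n : nat) :
  (0 < n)%N -> n%:R \notin P.
Proof.
by move=> /natr_unit[c c1]; apply/negP=> /(idealMr c); rewrite c1 idealr1.
Qed.

(** The difference of two members of the pencil is [b] times a non-zero integer, which is a unit
    because R contains the rationals. *)
Lemma pencil_prime (P : prime_idealr R) (a b : R) (m n : nat) :
  a + m%:R * b \in P -> a + n%:R * b \in P -> m <> n -> a \in P /\ b \in P.
Proof.
wlog lt_mn : m n / (m < n)%N.
  move=> wl Pm Pn mn; have [lt|gt|//] := ltngtP m n; first exact: wl Pm Pn mn.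
  by apply: wl Pn Pm _ => //; exact/nesym.
move=> Pm Pn _; have : (a + n%:R * b) - (a + m%:R * b) \in P by rewrite rpredB.
rewrite opprD addrACA subrr add0r -mulrBl -natrB ?(ltnW lt_mn) // prime_idealrM.
rewrite (negPf (natr_notin_prime _ _)) ?subn_gt0 //= => Pb; split=> //.
by rewrite -(addrK (m%:R * b) a) rpredB // idealMr.
Qed.

Lemma eventually_of_unique (Q : nat -> Prop) :
  (forall m n, ~ Q m -> ~ Q n -> m = n) -> exists N, forall t, (N <= t)%N -> Q t.
Proof.
move=> Qu; have [[m nQm]|noQ] := pselect (exists m, ~ Q m).
  exists m.+1 => t lt_mt; apply: contrapT => nQt.
  by rewrite (Qu _ _ nQt nQm) ltnn in lt_mt.
by exists 0%N => t _; apply: contrapT => nQt; apply: noQ; exists t.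
Qed.

(* On a pencil [e + t h] each prime excludes at most one [t]. *)
Lemma ideal_semilocal_gen (H : {pred R}) (s : seq (prime_idealr R)) :
  ideal H ->
  (forall P : prime_idealr R, List.In P s -> divisorial_prime P) ->
  exists2 e, e \in H &
    forall P : prime_idealr R, List.In P s -> forall h, h \in H -> ldvd P e h.
Proof.
move=> idH; elim: s => [|P s IHs] divs; first by exists 0; first by case: idH.
have [e He eP] := IHs (fun Q sQ => divs Q (or_intror sQ)).
have [h Hh hP] := ideal_local_gen noeR norR (divs P (or_introl erefl)) idH.
pose good (Q : prime_idealr R) t := forall x, x \in H -> ldvd Q (e + t%:R * h) x.
have evP (Q : prime_idealr R) : List.In Q (P :: s) ->
    exists N, forall t, (N <= t)%N -> good Q t.
  move=> sQ; apply: eventually_of_unique => m n.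
  (* Here g generates H at Q, and c (e + t h) = (a + t b) g. So e + t h generates H at Q whenever a
     + t b is outside Q. For the new prime g is [h], for the earlier ones g is [e]. *)
  suff [g [a [b [c [gQ gE ab]]]]] : exists g a b c,
      [/\ forall x, x \in H -> ldvd Q g x,
          forall t : nat, c * (e + t%:R * h) = (a + t%:R * b) * g
        & ~ (a \in Q /\ b \in Q)].
    have goodt t : ~ good Q t -> a + t%:R * b \in Q.
      move=> nt; apply: contrapT => /negP Qt; apply: nt => x Hx.
      by apply: (ldvd_trans _ (gQ _ Hx)); exists (a + t%:R * b), c.
    move=> /goodt Qm /goodt Qn; apply: contrapT => mn.
    by apply: ab; exact: pencil_prime Qm Qn mn.
  case: sQ => [<-|sQ].
    have [c [r [Pc cE]]] := hP _ He; exists h, r, c, c; split=> // [t|[_]].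
      by rewrite mulrDr cE; ring.
    exact/negP.
  have [c [r [Qc cE]]] := eP _ sQ _ Hh; exists e, c, r, c; split=> [|t|[]].
  - exact: eP.
  - by rewrite mulrDr mulrCA cE; ring.
  - by move=> /negPn; rewrite Qc.
have [N NP] : exists N, forall t, (N <= t)%N ->
    forall Q : prime_idealr R, List.In Q (P :: s) -> good Q t.
  elim: (P :: s) evP => [|Q l IHl] ev; first by exists 0%N.
  have [N NP] := IHl (fun Q' lQ' => ev Q' (or_intror lQ')).
  have [M MP] := ev Q (or_introl erefl).
  exists (maxn M N) => t; rewrite geq_max => /andP[Mt Nt] Q' [<-|lQ'].
    exact: MP.
  exact: NP.
exists (e + N%:R * h); last exact: NP.
by rewrite addrC; apply: idH.2.
Qed.

(** Otherwise the zero prime would be associated to [I], and no chain of length one ends at it. *)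
Lemma unmixed_neq0 (I : {pred R}) :
  unmixed_height_one I -> exists2 d, d \in I & d != 0.
Proof.
move=> [idI unI]; apply: contrapT => I0.
have I0P x : x \in I -> x = 0.
  by move=> Ix; apply: contrapT => /eqP x0; apply: I0; exists x.
have : associated_prime I (zero_prime R).
  exists 1 => r; rewrite in_zero_prime mulr1; apply/eqP/idP => [->|/I0P//].
  by case: idI.
move=> /unI[[c [c1 cinc]] _]; have [_] := cinc 0%N (ltn0Sn 0); apply=> x.
by rewrite c1 in_zero_prime => /eqP->; exact: idealr0.
Qed.

(** With H = (dR : I), unmixedness gives I = (dR : H), since membership in [I] is decided at height
    one primes, where [I] is principal. Replacing H by a single [e] that generates it at the height
    one primes over [d] does not change the colon. *)
Lemma unmixed_colon (I : {pred R}) : unmixed_height_one I ->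
  exists d e, d != 0 /\ forall r, (r \in I) = (r * e \in principal d).
Proof.
move=> unmI; have [d Id d0] := unmixed_neq0 unmI; have [idI unI] := unmI.
have prd := principal_ideal d.
pose H : {pred R} := fun h => `[< forall r, r \in I -> r * h \in principal d >].
have idH : ideal H.
  split=> [|a u v /asboolP Hu /asboolP Hv]; apply/asboolP => r Ir.
    by rewrite mulr0; case: prd.
  by rewrite mulrDr mulrCA; apply: prd.2; [exact: Hu | exact: Hv].
have [s sP] := height_one_finite d0.
have divs (P : prime_idealr R) : associated_prime (principal d) P -> divisorial_prime P.
  by exists d.
(* A local generator is available only at divisorial primes, so the others are removed from the
   list. *)
have [s' s'P sub] : exists2 s' : seq (prime_idealr R),
    forall P : prime_idealr R, List.In P s' -> divisorial_prime P &
    forall P : prime_idealr R, List.In P s -> divisorial_prime P -> List.In P s'.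
  elim: s {sP} => [|P s [s' s'P sub]]; first by exists [::].
  have [dP|ndP] := pselect (divisorial_prime P).
    by exists (P :: s') => [Q [<-|/s'P]|Q [<-|/sub sQ /sQ ?]] //; [left | right].
  by exists s' => // Q [<-|/sub].
have [e He eP] := ideal_semilocal_gen idH s'P.
exists d, e; split=> // r; apply/idP/idP => [Ir|rd].
  by move/asboolP: He; exact.
(* A failure would occur at a divisorial prime containing [d], and there [e] generates H. *)
have rH h : h \in H -> r * h \in principal d.
  move=> Hh; apply: contrapT => /negP nrh.
  have [P dP sP'] := divisorial_above noeR d0 nrh.
  have Pd : d \in P.
    by apply: sP'; rewrite in_colon; apply/asboolP; exists (r * h); rewrite mulrC.
  have hP := divisorial_height_one noeR norR dP.
  have [Q sQ PQ] := sP _ hP Pd.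
  have dQ : divisorial_prime Q.
    by have [a a0 [x xP]] := dP; exists a => //; exists x => y; rewrite -PQ.
  have [c [b [Qc cE]]] := eP _ (sub _ sQ dQ) _ Hh.
  case/negP: Qc; rewrite -PQ; apply: sP'; rewrite in_colon mulrCA cE mulrCA.
  exact: idealMl.
apply: contrapT => /negP nIr.
have [P PI sP'] := associated_above noeR idI nIr.
have hP := unI _ PI.
have Pd : d \in P by apply: sP'; rewrite in_colon mulrC idealMl.
have dP : divisorial_prime P by apply: divs; exact: height_one_divisorial.
have [x [t [Ix Pt tP]]] := ideal_local_principal noeR norR dP idI.
have [h tE] := tP _ Id.
have x0 : x != 0.
  apply: contraNneq Pt => x0; move/eqP: tE; rewrite x0 mulr0 mulf_eq0 (negPf d0) orbF.
  by move=> /eqP->; exact: idealr0.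
(* Since t I lies in x R, multiplication by h = t d / x sends I into dR. Then r h in dR gives r t in
   x R, hence in I. *)
have Hh : h \in H.
  apply/asboolP=> y Iy; have [q qE] := tP _ Iy; apply/asboolP; exists q.
  apply: (mulIf x0); rewrite -mulrA -tE mulrCA mulrA qE; ring.
have /asboolP[q qE] := rH _ Hh.
have rt : r * t = q * x.
  apply: (mulIf d0); rewrite -mulrA tE mulrA qE; ring.
case/negP: Pt; apply: sP'; rewrite in_colon mulrC rt.
exact: idealMl.
Qed.

End Finiteness.

(** * Tensor products, flatness and residue fields *)

Section TensorVanishing.
Variables (R : comNzRingType) (M N : lmodType R) (V : zmodType).
Variables (Z : V -> Prop) (F : M -> N -> V).
Hypotheses (Z0 : Z 0) (ZB : forall x y, Z x -> Z y -> Z (x - y)).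
Hypotheses
  (FDl : forall m m' n, Z (F (m + m') n - (F m n + F m' n)))
  (FDr : forall m n n', Z (F m (n + n') - (F m n + F m n')))
  (FZ : forall a m n, Z (F (a *: m) n - F m (a *: n))).

(** Maps out of a tensor product that depend on chosen lifts are balanced only modulo a subgroup
    [Z]. Working modulo [Z] avoids forming the quotient of [V]. *)
Lemma tensor_rel_mod s t : tensor_rel s t ->
  Z (\sum_(p <- s) F p.1 p.2 - \sum_(p <- t) F p.1 p.2).
Proof.
have ZN x : Z x -> Z (- x) by rewrite -sub0r; exact: ZB.
have ZD x y : Z x -> Z y -> Z (x + y) by move=> Zx /ZN; rewrite -{2}[y]opprK; exact: ZB.
elim=> {s t}.
- by move=> s; rewrite subrr.
- by move=> s t _ /ZN; rewrite opprB.
- by move=> s t u _ st _ tu; have := ZD _ _ st tu; rewrite addrA subrK.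
- by move=> s s' t t' _ Zs _ Zt; rewrite !big_cat opprD addrACA; exact: ZD.
- by move=> s t; rewrite !big_cat [X in _ - X]addrC subrr.
- move=> n; rewrite big_seq1 big_nil /= subr0.
  by have /ZN := FDl 0 0 n; rewrite addr0 opprB addrK.
- by move=> m m' n; rewrite !big_cons !big_nil !addr0; exact: FDl.
- by move=> m n n'; rewrite !big_cons !big_nil !addr0; exact: FDr.
- by move=> a m n; rewrite !big_cons !big_nil !addr0; exact: FZ.
Qed.

Lemma tensor_sum0_mod k (m : 'I_k -> M) (n : 'I_k -> N) :
  \sum_i tens (m i) (n i) = 0 -> Z (\sum_i F (m i) (n i)).
Proof.
move=> E; pose s := [seq (m i, n i) | i : 'I_k].
have /eqP : (\pi_(tensor M N) s = \pi_(tensor M N) [::])%qT.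
  by rewrite tensor_pi_sum /s big_image.
rewrite piE => /asboolP/tensor_rel_mod; rewrite big_nil subr0.
by rewrite /s big_image.
Qed.

End TensorVanishing.

Section TensorSum.
Variables (R : comNzRingType) (M N : lmodType R).

Lemma tens_suml (I : finType) (m : I -> M) (n : N) :
  tens (\sum_i m i) n = \sum_i tens (m i) n.
Proof. by apply: (big_morph (fun m => tens m n)) => [x y|]; rewrite ?tensDl ?tens0. Qed.

Lemma tensr0 (m : M) : tens m (0 : N) = 0.
Proof. by apply: (@addrI _ (tens m 0)); rewrite -tensDr !addr0. Qed.

Lemma tens_sumr (I : finType) (m : M) (n : I -> N) :
  tens m (\sum_i n i) = \sum_i tens m (n i).
Proof. by apply: (big_morph (tens m)) => [x y|]; rewrite ?tensDr ?tensr0. Qed.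

Lemma tensor_map_bal (N' : lmodType R) (f : {linear N -> N'}) :
  balanced (fun (m : M) (n : N) => tens m (f n)).
Proof.
split=> [m m' n|m n n'|a m n]; first exact: tensDl.
  by rewrite linearD tensDr.
by rewrite linearZ tensZ.
Qed.

Lemma tensor_map_sum (N' : lmodType R) (f : {linear N -> N'}) (I : finType)
    (m : I -> M) (n : I -> N) :
  tensor_map f (\sum_i tens (m i) (n i)) = \sum_i tens (m i) (f (n i)).
Proof.
rewrite /tensor_map (big_morph _ (tensor_liftD (tensor_map_bal f)) (tensor_lift0
  (tensor_map_bal f))).
by apply: eq_bigr => i _; rewrite tensor_lift_tens //; exact: tensor_map_bal.
Qed.
End TensorSum.

Lemma tensM (R : comNzRingType) (B S : comAlgType R) (b b' : B) (c c' : S) :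
  tens b c * tens b' c' = tens (b * b') (c * c').
Proof.
rewrite -[LHS]/(tensor_mul _ _) /tensor_mul.
rewrite tensor_lift_tens; last exact: tensor_mul_ball.
by rewrite tensor_lift_tens //; exact: tensor_mul_balr.
Qed.

Lemma tens_scale (R : comNzRingType) (M : lmodType R) (S : comAlgType R)
  (m : M) (c x : S) : c *: tens m x = tens m (c * x).
Proof.
rewrite -[LHS]/(tensor_scale _ _) /tensor_scale tensor_lift_tens //.
exact: tensor_scale_bal.
Qed.

(** * The equational criterion of flatness *)

Section FlatSystem.
Variables (R : comNzRingType) (B : lmodType R) (flatB : flat B).
Variables (m n : nat) (A : 'M[R]_(n, m)).

Definition row_image : {pred 'rV[R]_m} := fun w => `[< exists u, w = u *m A >].

Fact row_image_submod : submod_closed row_image.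
Proof.
split; first by apply/asboolP; exists 0; rewrite mul0mx.
move=> a x y /asboolP[u ->] /asboolP[v ->]; apply/asboolP.
by exists (a *: u + v); rewrite mulmxDl scalemxAl.
Qed.

HB.instance Definition _ := GRing.isSubmodClosed.Build R 'rV[R]_m row_image
  row_image_submod.

(** Let S be the image of [A] in R^m. The sum of the b_i tensored with the rows of [A] vanishes in
    the tensor product of B with R^m, hence by flatness already in that of B with S. As S is R^n
    modulo the solutions over R, the vector b is a combination of such solutions. *)
Lemma flat_system (b : 'I_n -> B) :
  (forall j, \sum_i A i j *: b i = 0) ->
  exists (l : nat) (c : 'I_l -> B) (v : 'I_l -> 'rV[R]_n),
    (forall t, v t *m A = 0) /\ forall i, b i = \sum_t v t 0 i *: c t.
Proof.
move=> bA; pose S := submodule row_image.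
pose f : {linear S -> 'rV[R]_m} := \val.
have finj : injective f by exact: val_inj.
have im_in i : row i A \in row_image by apply/asboolP; exists (delta_mx 0 i);
  rewrite rowE.
pose w i : S := Submodule (im_in i).
have w0 : \sum_i tens (b i) (w i) = 0 :> tensor B S.
  apply: (flatB finj); rewrite tensor_map_sum [RHS]/tensor_map.
  rewrite tensor_lift0; last exact: tensor_map_bal.
  transitivity (\sum_i \sum_j tens (A i j *: b i) (delta_mx 0 j : 'rV[R]_m)).
    apply: eq_bigr => i _; rewrite /= {1}[row i A]row_sum_delta tens_sumr.
    by apply: eq_bigr => j _; rewrite mxE tensZ.
  rewrite exchange_big big1 // => j _; rewrite -tens_suml bA; exact: tens0.
(* A section of R^n -> S chosen pointwise; it is linear only modulo the solutions over R, and [Z]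
   absorbs the defect. *)
have [sg sgP] : exists sg : S -> 'rV[R]_n, forall x, val x = sg x *m A.
  have sgE (x : S) : exists u, val x = u *m A by case: x => y yS; exact/asboolP.
  by have [sg sgP] := choice sgE; exists sg.
pose Z (x : {ffun 'I_n -> B}) := exists (l : nat) (c : 'I_l -> B) (v : 'I_l ->
  'rV[R]_n),
    (forall t, v t *m A = 0) /\ forall i, x i = \sum_t v t 0 i *: c t.
have Z1 (c : B) (v : 'rV[R]_n) (x : {ffun 'I_n -> B}) :
    v *m A = 0 -> (forall i, x i = v 0 i *: c) -> Z x.
  move=> vA xE; exists 1%N, (fun=> c), (fun=> v); split=> // i.
  by rewrite big_ord1.
have Z0 : Z 0 by apply: (Z1 0 0) => [|i]; rewrite ?mul0mx // ffunE scaler0.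
have ZB x y : Z x -> Z y -> Z (x - y).
  move=> [l [c [v [vA xE]]]] [l' [c' [v' [vA' yE]]]].
  exists (l + l')%N.
  exists (fun i => match split i with inl j => c j | inr j => - c' j end).
  exists (fun i => match split i with inl j => v j | inr j => v' j end).
  split=> [t|i]; first by case: (split t).
  rewrite !ffunE xE yE big_split_ord -sumrN; congr (_ + _).
    by apply: eq_bigr => t _; rewrite (unsplitK (inl t)).
  by apply: eq_bigr => t _; rewrite (unsplitK (inr t)) scalerN.
pose F (x : B) (y : S) := [ffun i => sg y 0 i *: x].
have ZF : Z (\sum_i F (b i) (w i)).
  apply: (@tensor_sum0_mod _ _ _ _ Z F Z0 ZB _ _ _ _ _ _ w0).
  - by move=> x y z; rewrite (_ : _ - _ = 0) //; apply/ffunP=> i;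
    rewrite !ffunE scalerDr subrr.
  - move=> x y z; apply: (Z1 x (sg (y + z) - (sg y + sg z))).
      by rewrite mulmxBl mulmxDl -!sgP /= subrr.
    by move=> i; rewrite !ffunE !mxE scalerBl scalerDl.
  - move=> a x y; apply: (Z1 x (a *: sg y - sg (a *: y))).
      by rewrite mulmxBl -scalemxAl -!sgP /= subrr.
    by move=> i; rewrite !ffunE !mxE scalerBl scalerA mulrC.
(* The lift of the i-th row differs from the i-th unit vector by a solution over R. *)
have Zb : Z (\sum_i F (b i) (w i) - [ffun i => b i]).
  have -> : \sum_i F (b i) (w i) - [ffun i => b i] =
      \sum_i [ffun j => (sg (w i) - delta_mx 0 i) 0 j *: b i].
    apply/ffunP => j; rewrite ffunE !sum_ffunE !ffunE.
    under [RHS]eq_bigr do rewrite ffunE !mxE scalerBl.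
    rewrite sumrB; congr (_ - _); first by apply: eq_bigr => i _; rewrite ffunE.
    rewrite (bigD1 j) //= eqxx scale1r big1 ?addr0 // => i ij.
    by rewrite eq_sym (negPf ij) scale0r.
  apply: big_ind => // [x y Zx Zy|i _].
    by rewrite -[y]opprK; apply: (ZB _ _) => //; rewrite -sub0r; exact: ZB.
  apply: (Z1 (b i) (sg (w i) - delta_mx 0 i)) => [|j]; last by rewrite ffunE.
  by rewrite mulmxBl -sgP /= rowE subrr.
have [l [c [v [vA bE]]]] : Z [ffun i => b i].
  by rewrite -[[ffun i => b i]](subKr (\sum_i F (b i) (w i))); exact: ZB.
by exists l, c, v; split=> // i; rewrite -bE ffunE.
Qed.
End FlatSystem.

Lemma loc_idealP (R : idomainType) (P : prime_idealr R) (J : {pred R}) (r : R) :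
  ideal J ->
  to_loc P r \in loc_ideal P J <-> exists2 s, s \notin P & s * r \in J.
Proof.
move=> idJ; split=> [/asboolP[k [a [g [gP rE]]]]|[s Ps Jsr]].
  pose num_in (x : loc P) := exists b s : R,
    [/\ b \in J, s \notin P & val x * tofrac s = tofrac b].
  have : num_in (to_loc P r).
    rewrite rE; apply: (big_ind num_in) => [|x y|i _].
    - by exists 0, 1; rewrite idealr1 tofrac0 mul0r; split=> //; case: idJ.
    - move=> [b [s [Jb Ps xE]]] [c [t [Jc Pt yE]]].
      exists (t * b + s * c), (s * t).
      split; first by apply: idealD => //; exact: idealMl.
        by rewrite prime_idealrM negb_or Ps Pt.
      by rewrite tofracD !tofracM -xE -yE /=; ring.
    - have [b Jb ->] := gP i; have /asboolP[c [s [Ps zE]]] := valP (a i).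
      exists (c * b), s; split=> //; first exact: idealMl.
      have : loc_val (a i) * tofrac s = tofrac c by rewrite [loc_val _]zE divfK
        ?(tofrac_neq0 Ps).
      by rewrite /= mulrAC tofracM => ->.
  move=> [b [s [Jb Ps]]]; rewrite /= -tofracM => /eqP; rewrite tofrac_eq => /eqP E.
  by exists s => //; rewrite mulrC E.
have invP : (tofrac s)^-1 \in loc_pred P.
  by apply/asboolP; exists 1, s; rewrite tofrac1 mul1r.
have -> : to_loc P r = Loc invP * to_loc P (s * r).
  by apply: val_inj; rewrite /= tofracM mulKf ?(tofrac_neq0 Ps).
apply: idealMl; first exact: ideal_gen_ideal.
by apply: ideal_gen_in; exists (s * r).
Qed.

(** * Residue fields *)

Section ResidueField.
Variables (R : idomainType) (P : prime_idealr R).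

Lemma to_residue_eq0 a : (to_residue P a == 0) = (a \in P).
Proof.
have -> : (to_residue P a == 0) = (to_loc P a \in @loc_max R P).
  rewrite /to_residue -[to_loc P a in RHS]subr0 Quotient.idealrBE.
  by rewrite -[0 in LHS](rmorph0 \pi_{ideal_quot (@loc_max R P)}).
apply/idP/idP => [/(loc_idealP _ _ (prime_ideal P))[s Ps]|Pa].
  by rewrite prime_idealrM (negPf Ps).
by apply/loc_idealP; [exact: prime_ideal | exists 1; rewrite ?idealr1 ?mul1r].
Qed.

Lemma to_residueV s : s \notin P -> exists x, x * to_residue P s = 1.
Proof.
move=> Ps; have invP : (tofrac s)^-1 \in loc_pred P.
  by apply/asboolP; exists 1, s; rewrite tofrac1 mul1r.
exists (\pi_{ideal_quot (@loc_max R P)} (Loc invP))%qT.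
rewrite /to_residue -rmorphM -[RHS](rmorph1 \pi_{ideal_quot (@loc_max R P)}).
by congr (\pi _)%qT; apply: val_inj; rewrite /= mulVf ?(tofrac_neq0 Ps).
Qed.

Lemma residue_fracP (x : residue_ring P) :
  exists a s, s \notin P /\ to_residue P s * x = to_residue P a.
Proof.
have /asboolP[a [s [Ps xE]]] := valP (repr x); exists a, s; split=> //.
rewrite -[x]reprK /to_residue -rmorphM; congr (\pi _)%qT; apply: val_inj.
by rewrite /= [loc_val _]xE mulrC divfK ?(tofrac_neq0 Ps).
Qed.

Definition residue_inv (x : residue_ring P) : residue_ring P :=
  if pselect (exists y, y * x = 1) is left e then projT1 (cid e) else 0.

Fact residue_mulVf x : x != 0 -> residue_inv x * x = 1.
Proof.
move=> x0; rewrite /residue_inv; case: pselect => [e|[]]; first exact: projT2 (cid e).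
have [a [s [Ps sE]]] := residue_fracP x.
have [y ys] := to_residueV Ps.
have : a \notin P.
  rewrite -to_residue_eq0 -sE; apply: contra_neqN x0 => /eqP sx.
  by rewrite -[x]mul1r -ys -mulrA sx mulr0.
by move=> /to_residueV[z za]; exists (z * to_residue P s); rewrite -mulrA sE.
Qed.

Fact residue_inv0 : residue_inv 0 = 0.
Proof.
rewrite /residue_inv; case: pselect => // e; exfalso; have [y] := e.
by rewrite mulr0 => /esym/eqP; rewrite oner_eq0.
Qed.

(** The same ring under a new name, to which the field structure with classically chosen inverses is
    attached; fibres become polynomial rings over a field. *)
Definition residue_field : Type := residue_ring P.
HB.instance Definition _ := GRing.ComNzRing.on residue_field.
HB.instance Definition _ := GRing.ComNzRing_isField.Build residue_field
  residue_mulVf residue_inv0.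

Definition residue_map : R -> residue_field := to_residue P.
HB.instance Definition _ := GRing.RMorphism.on residue_map.

Lemma residue_map_eq0 a : (residue_map a == 0) = (a \in P).
Proof. exact: to_residue_eq0. Qed.

Lemma residue_field_fracP (x : residue_field) :
  exists a s, s \notin P /\ x = residue_map a / residue_map s.
Proof.
have [a [s [Ps sE]]] := residue_fracP x; exists a, s; split=> //.
have s0 : residue_map s != 0 by rewrite residue_map_eq0.
apply: (mulIf s0); rewrite divfK // mulrC; exact: sE.
Qed.

End ResidueField.

(** * Fibres of affine fibrations *)

(** Horner's scheme: if x is not constant and y = q(x) is non-zero, then y x is not constant, so
    adding a constant cannot give zero. *)
Lemma mpoly_algebraic_const (k : fieldType) (n : nat) (x : {mpoly k[n]})
    (q : {poly k}) :
  q != 0 -> (map_poly (@mpolyC n k) q).[x] = 0 -> exists c, x = c%:MP.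
Proof.
have [/msize1_polyC -> _ _|x1] := leqP (msize x) 1; first by exists x@_0%MM.
suff nz : q != 0 -> (map_poly (@mpolyC n k) q).[x] != 0 by move=> /nz/eqP.
elim/poly_ind: q => [|q c IHq]; first by rewrite eqxx.
rewrite rmorphD rmorphM /= map_polyX map_polyC /= hornerMXaddC.
have [->|q0] := eqVneq q 0.
  rewrite mul0r add0r rmorph0 horner0 mul0r add0r polyC_eq0 => c0.
  by rewrite mpolyC_eq0.
move=> _; have y0 := IHq q0; set y := (map_poly _ q).[x] in y0 *.
have x0 : x != 0 by apply: contraTneq x1 => ->; rewrite msize0.
rewrite addr_eq0; apply: contraTneq x1 => E.
have : msize (y * x) = msize (- c%:MP_[n]) by rewrite E.
rewrite msizeM // msizeN msizeC -leqNgt.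
have : (0 < msize y)%N by rewrite lt0n msize_poly_eq0.
by case: (msize y) (c != 0) => // m [] _; rewrite addSn /= => yx;
  rewrite (leq_trans (leq_addl m _)) ?yx.
Qed.

Fact clear_denom_add (T : comPzRingType) (s1 s2 s3 x y z : T) :
  s2 * s3 * (s1 * x) - s1 * (s3 * (s2 * y) + s2 * (s3 * z)) =
  s1 * (s2 * s3) * (x - (y + z)).
Proof. ring. Qed.

Fact clear_denom_scale (T : comPzRingType) (s1 s2 a x y : T) :
  s1 * (s2 * y) * a - s2 * (s1 * x) = s1 * s2 * (a * y - x).
Proof. ring. Qed.

Section Fibration.
Variables (R : idomainType) (B : comAlgType R) (n : nat).

Definition in_extended (P : {pred R}) (b : B) : Prop :=
  exists (l : nat) (p : 'I_l -> R) (c : 'I_l -> B),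
    (forall i, p i \in P) /\ b = \sum_i p i *: c i.

Lemma in_extended0 P : in_extended P 0.
Proof. by exists 0%N, (fun=> 0), (fun=> 0); split=> [[]//|]; rewrite big_ord0. Qed.

Lemma in_extended1 (P : {pred R}) p b : p \in P -> in_extended P (p *: b).
Proof. by exists 1%N, (fun=> p), (fun=> b); rewrite big_ord1. Qed.

Lemma in_extendedD P b c :
  in_extended P b -> in_extended P c -> in_extended P (b + c).
Proof.
move=> [l [p [x [pP ->]]]] [m [q [y [qP ->]]]]; exists (l + m)%N.
exists (fun i => match split i with inl j => p j | inr j => q j end).
exists (fun i => match split i with inl j => x j | inr j => y j end).
split=> [t|]; first by case: (split t).
rewrite big_split_ord; congr (_ + _); apply: eq_bigr => i _.
  by rewrite (unsplitK (inl i)).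
by rewrite (unsplitK (inr i)).
Qed.

Lemma in_extendedZ P r b : in_extended P b -> in_extended P (r *: b).
Proof.
move=> [l [p [x [pP ->]]]]; exists l, p, (fun i => r *: x i); split=> //.
by rewrite scaler_sumr; apply: eq_bigr => i _; rewrite !scalerA mulrC.
Qed.

Lemma in_extendedN P b : in_extended P b -> in_extended P (- b).
Proof. by rewrite -scaleN1r; exact: in_extendedZ. Qed.

Section FiberMap.
Hypothesis fibB : affine_fibration n B.
Variable P : prime_idealr R.

(** The map from B to its fibre, followed by the given isomorphism; it is surjective up to
    multipliers outside [P]. Its kernel is described inside B only by [fiber_kernel]. *)
Lemma fiber_map : exists iota : {rmorphism B -> {mpoly (residue_field P)[n]}},
  [/\ forall r b, iota (r *: b) = residue_map P r *: iota b,
      forall x, exists s b, s \notin P /\ iota b = residue_map P s *: x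
    & forall b, iota b = 0 -> tens b (1 : residue_alg P) = 0].
Proof.
have [_ _ /(_ P)[h [[g gK hK] hZ]]] := fibB.
pose i (b : B) : {mpoly (residue_field P)[n]} := h (tens b (1 : residue_alg P)).
have iB : zmod_morphism i.
  move=> x y; rewrite /i -rmorphB; congr (h _).
  by apply: (@addIr _ (tens y 1)); rewrite subrK -tensDl subrK.
have iM : monoid_morphism i.
  by split=> [|x y]; rewrite /i ?rmorph1 // -rmorphM tensM mulr1.
pose iota : {rmorphism B -> {mpoly (residue_field P)[n]}} := HB.pack i
  (GRing.isZmodMorphism.Build _ _ i iB) (GRing.isMonoidMorphism.Build _ _ i iM).
have iZ r b : iota (r *: b) = residue_map P r *: iota b.
  rewrite /iota /= /i tensZ -[RHS]hZ tens_scale mulr1.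
  by congr (h (tens _ _)); rewrite -[LHS]/(_ * _) mulr1.
exists iota; split=> // [x|b ib]; last first.
  by apply: (can_inj gK); rewrite rmorph0.
rewrite -[x]hK; elim/tensor_ind: (g x) => [|b c|y z IHy IHz].
- by exists 1, 0; rewrite idealr1 rmorph0 [h 0]rmorph0 scaler0.
- have [a [s [Ps sE]]] := residue_fracP c.
  exists s, (a *: b); split=> //; rewrite iZ -[LHS]hZ -[RHS]hZ !tens_scale.
  by congr (h (tens _ _)); rewrite mulr1; apply/esym.
- have [s [b [Ps sE]]] := IHy; have [t [c [Pt tE]]] := IHz.
  exists (s * t), (t *: b + s *: c); rewrite prime_idealrM negb_or Ps Pt.
  split=> //; rewrite rmorphD !iZ sE tE !scalerA -!rmorphM [t * s]mulrC -scalerDr.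
  by congr (_ *: _); rewrite rmorphD.
Qed.
End FiberMap.

Section Embedding.
Hypothesis fibB : affine_fibration n B.
Local Notation K := (residue_field (zero_prime R)).
Local Notation tau := (residue_map (zero_prime R)).

(** Tensoring the inclusion of R in K with the flat module B keeps it injective. *)
Lemma fibration_embedding : exists iota : {rmorphism B -> {mpoly K[n]}},
  [/\ forall r b, iota (r *: b) = tau r *: iota b,
      forall x, exists s b, s != 0 /\ iota b = tau s *: x
    & injective iota].
Proof.
have [iota [iZ iS i0]] := fiber_map fibB (zero_prime R).
exists iota; split=> //.
suff inj0 b : iota b = 0 -> b = 0.
  by move=> x y xy; apply/subr0_eq/inj0; rewrite rmorphB xy subrr.
move=> /i0 b0; have [_ flatB _] := fibB.
pose f (r : R^o) : residue_alg (zero_prime R) := to_residue (zero_prime R) r.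
have fB : zmod_morphism f by move=> x y; rewrite /f rmorphB.
have fZ : scalable f by move=> a x; rewrite /f /= rmorphM.
pose fl : {linear R^o -> residue_alg (zero_prime R)} := HB.pack f
  (GRing.isZmodMorphism.Build _ _ f fB) (GRing.isScalable.Build _ _ _ _ f fZ).
have finj : injective fl.
  move=> x y /eqP; rewrite -subr_eq0 -[X in X == 0]fB to_residue_eq0.
  by rewrite in_zero_prime subr_eq0 => /eqP.
have : tens b (1 : R^o) = 0.
  apply: (flatB _ _ _ finj).
  have := @tensor_map_sum _ B _ _ fl 'I_1 (fun=> b) (fun=> 1).
  rewrite !big_ord1 => ->; rewrite [RHS]/tensor_map tensor_lift0.
    by rewrite /fl /= /f rmorph1.
  exact: tensor_map_bal.
have bal : balanced (fun (b : B) (r : R^o) => (r : R) *: b).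
  split=> [x y r|x r s|a x r]; [exact: scalerDr | exact: scalerDl |].
  by rewrite scalerA mulrC.
move=> /(congr1 (tensor_lift (fun (b : B) (r : R^o) => (r : R) *: b))).
by rewrite tensor_lift_tens // tensor_lift0 // scale1r.
Qed.

(* The kernel of [B -> B (x) k(P)] is computed by a balanced map to
   [K[X_1..X_n] / P B_P]. *)
Lemma fiber_kernel (P : prime_idealr R) (b : B) : tens b (1 : residue_alg P) = 0 ->
  exists2 s, s \notin P & in_extended P (s *: b).
Proof.
have [iota [iZ _ iI]] := fibration_embedding.
have tau0 s : s \notin P -> tau s != 0.
  by rewrite residue_map_eq0 in_zero_prime; apply: contraNneq => ->; exact: idealr0.
pose rho := residue_map P.
(* Elements of k(P) are lifted by choice to R_P inside K. The lift respects sums and scaling only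
   modulo P R_P, and [Z] below is the image of P B_P. *)
have liftP (x : residue_field P) : exists y : K, exists a s,
    [/\ s \notin P, rho s * x = rho a & tau s * y = tau a].
  have [a [s [Ps sE]]] := residue_field_fracP x; exists (tau a / tau s), a, s.
  have ? : rho s != 0 by rewrite residue_map_eq0.
  by split=> //; rewrite ?sE mulrC divfK ?tau0.
have [lf lfP] := choice liftP.
pose Z (v : {mpoly K[n]}) := exists s c,
  [/\ s \notin P, in_extended P c & iota c = tau s *: v].
have Z0 : Z 0.
  by exists 1, 0; rewrite idealr1 rmorph0 scaler0; split=> //; exact: in_extended0.
have ZB x y : Z x -> Z y -> Z (x - y).
  move=> [s [c [Ps Pc cE]]] [t [d [Pt Pd dE]]].
  exists (s * t), (t *: c - s *: d); split.
  - by rewrite prime_idealrM negb_or Ps Pt.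
  - by apply: in_extendedD; [|apply: in_extendedN]; exact: in_extendedZ.
  - by rewrite rmorphB !iZ cE dE !scalerA -!rmorphM [t * s]mulrC -scalerBr.
pose F (x : B) (y : residue_alg P) := lf y *: iota x.
have Z1 x (q : K) s p : s \notin P -> p \in P -> tau s * q = tau p -> Z (q *: iota x).
  move=> Ps Pp E; exists s, (p *: x); split=> //; first exact: in_extended1.
  by rewrite iZ scalerA E.
move=> b0; have : Z (\sum_(i < 1) F b 1).
  apply: (@tensor_sum0_mod _ B (residue_alg P) _ Z F Z0 ZB); last by rewrite big_ord1.
  - by move=> x y z; rewrite /F rmorphD scalerDr subrr.
  - move=> x y z; rewrite /F -scalerDl -scalerBl.
    have [a1 [s1 [P1 E1 F1]]] := lfP (y + z); have [a2 [s2 [P2 E2 F2]]] := lfP y.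
    have [a3 [s3 [P3 E3 F3]]] := lfP z.
    apply: (@Z1 x _ (s1 * (s2 * s3)) (s2 * s3 * a1 - s1 * (s3 * a2 + s2 * a3))).
    + by rewrite !prime_idealrM !negb_or P1 P2 P3.
    + have {}E1 : rho s1 * ((y : residue_field P) + z) = rho a1 := E1.
      rewrite -residue_map_eq0 rmorphB !rmorphM rmorphD !rmorphM /= -/rho -E1 -E2 -E3.
      by rewrite clear_denom_add subrr mulr0.
    + by rewrite rmorphB !rmorphM rmorphD !rmorphM /= -F1 -F2 -F3 clear_denom_add.
  - move=> a x y; rewrite /F iZ scalerA -scalerBl.
    have [a1 [s1 [P1 E1 F1]]] := lfP (a *: y); have [a2 [s2 [P2 E2 F2]]] := lfP y.
    apply: (@Z1 x _ (s1 * s2) (s1 * a2 * a - s2 * a1)).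
    + by rewrite prime_idealrM negb_or P1 P2.
    + have {}E1 : rho s1 * (rho a * (y : residue_field P)) = rho a1 := E1.
      rewrite -residue_map_eq0 rmorphB !rmorphM /= -/rho -E1 -E2.
      by rewrite clear_denom_scale subrr mulr0.
    + by rewrite rmorphB !rmorphM /= -F1 -F2 clear_denom_scale [tau a * _]mulrC.
rewrite big_ord1 /F => -[s [c [Ps Pc cE]]].
have [a [t [Pt tE tF]]] := lfP 1.
have Pa : a \notin P by rewrite -residue_map_eq0 -/rho -tE mulr1 residue_map_eq0.
exists (s * a); first by rewrite prime_idealrM negb_or Ps Pa.
have -> : (s * a) *: b = t *: c; last exact: in_extendedZ.
apply: iI; rewrite !iZ cE !scalerA rmorphM /= -tF;
  by rewrite ?mulrA [tau t * tau s]mulrC.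
Qed.

(** An element of the polynomial ring over k(P) that is algebraic over k(P) is a constant;
    [fiber_kernel] brings this equality back to B. *)
Lemma fibration_algebraic (P : prime_idealr R) (b : B) m (h : 'I_m -> R) :
  in_extended P (\sum_i h i *: b ^+ i) -> (exists i, h i \notin P) ->
  exists s r, s \notin P /\ in_extended P (s *: b - r%:A).
Proof.
have [iota [iZ _ iI]] := fiber_map fibB P.
have extE c : in_extended P c -> iota c = 0.
  move=> [l [p [x [pP ->]]]]; rewrite rmorph_sum big1 // => i _.
  by rewrite iZ (_ : residue_map P (p i) = 0) ?scale0r //; apply/eqP;
    rewrite residue_map_eq0.
move=> /extE E [j Pj].
have [||c cE] := @mpoly_algebraic_const _ _ (iota b)
  (\poly_(i < m) (if insub i is Some j then residue_map P (h j) else 0)).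
- apply/negP=> /eqP/polyP/(_ j); rewrite coef_poly ltn_ord coef0 valK => /eqP.
  by rewrite residue_map_eq0 (negPf Pj).
- rewrite poly_def rmorph_sum horner_sum -[RHS]E rmorph_sum; apply: eq_bigr => i _.
  rewrite valK iZ rmorphXn /= map_polyZ /= hornerZ map_polyXn hornerXn.
  by rewrite mul_mpolyC.
have [a [s [Ps sE]]] := residue_field_fracP c.
have s0 : residue_map P s != 0 by rewrite residue_map_eq0.
have : iota (s *: b - a%:A) = 0.
  rewrite rmorphB !iZ rmorph1 cE sE -mul_mpolyC -mpolyCM mulrC divfK //.
  by rewrite -[1]mpolyC1 -mul_mpolyC -mpolyCM mulr1 subrr.
move=> /iI/fiber_kernel[t Pt]; rewrite scalerBr !scalerA => PE.
by exists (t * s), (t * a); rewrite prime_idealrM negb_or Pt Ps.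
Qed.

(** Faithful flatness: if the z_i generated a proper ideal, they would lie in a prime P, and 1 would
    vanish in the fibre at P, which is a non-zero ring. *)
Lemma fibration_unimodular (l : nat) (z : 'I_l -> R) (c : 'I_l -> B) :
  noetherian R -> \sum_i z i *: c i = 1 -> exists t : 'I_l -> R, \sum_i t i * z i = 1.
Proof.
move=> noeR E; pose I := ideal_gen (fun x => exists i, x = z i).
have idI : ideal I by exact: ideal_gen_ideal.
have [I1|nI1] := boolP (1 \in I).
  move/asboolP: I1 => [k [a [g [gP gE]]]]; have [s sE] := choice gP.
  exists (fun j => \sum_(i < k | s i == j) a i).
  rewrite [RHS]gE (partition_big s xpredT) //=; apply: eq_bigr => j _.
  by rewrite mulr_suml; apply: eq_bigr => i /eqP <-; rewrite sE.
have [P _ sP] := associated_above noeR idI nI1.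
have [iota [iZ _ _]] := fiber_map fibB P.
have /eqP[] := oner_neq0 {mpoly (residue_field P)[n]}.
rewrite -(rmorph1 iota) -E rmorph_sum big1 // => i _.
rewrite iZ (_ : residue_map P (z i) = 0) ?scale0r //; apply/eqP.
rewrite residue_map_eq0; apply: sP; rewrite in_colon mulr1.
by apply: ideal_gen_in; exists i.
Qed.
End Embedding.

(** * Divisibility in a flat algebra, tested at divisorial primes *)

Section DivisorialFlat.
Hypotheses (noeR : noetherian R) (flatB : flat B).

(* If every [x] with [Q x <= a R] were in [a R], flatness would give the same *)
(* for [B]: the equations [q_j x = a x_j] form a linear system over [R].       *)
Lemma flat_divisorial (a : R) (b : B) : a != 0 -> (forall b', b <> a *: b') ->
  exists2 P : prime_idealr R, divisorial_prime P &
    forall r b', r *: b = a *: b' -> r \in P.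
Proof.
move=> a0 nb; pose Q : {pred R} := fun r => `[< exists b', r *: b = a *: b' >].
have idQ : ideal Q.
  split; first by apply/asboolP; exists 0; rewrite scale0r scaler0.
  move=> c u v /asboolP[x xE] /asboolP[y yE]; apply/asboolP.
  by exists (c *: x + y); rewrite scalerDl -scalerA xE yE scalerDr !scalerA mulrC.
have [m [q qQ]] := noeR idQ.
suff [x xP nx] : exists2 x, forall j, q j * x \in principal a & x \notin principal a.
  have [P dP sP] := divisorial_above noeR a0 nx; exists P => // r b' rE.
  apply: sP; have : r \in Q by apply/asboolP; exists b'.
  rewrite qQ in_colon => /asboolP[k [c [g [gP ->]]]]; rewrite mulr_suml.
  apply: ideal_sum => [|i]; first exact: principal_ideal.
  have [j ->] := gP i; rewrite -mulrA; apply: idealMl;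
    [exact: principal_ideal | exact: xP].
apply: contrapT => no.
have sat x : (forall j, q j * x \in principal a) -> x \in principal a.
  by move=> xP; apply: contrapT => /negP nx; apply: no; exists x.
have bq j : exists b', q j *: b = a *: b'.
  have : q j \in Q by rewrite qQ ideal_gen_in //; exists j.
  by move/asboolP.
have [b' b'E] := choice bq.
pose A : 'M[R]_(1 + m, m) := col_mx (\row_j q j) (- a%:M).
pose bb (i : 'I_(1 + m)) := match split i with inl _ => b | inr j => b' j end.
have sumA (V : lmodType R) (w : 'I_(1 + m) -> V) j :
    \sum_i A i j *: w i = q j *: w (lshift m 0) - a *: w (rshift 1 j).
  rewrite big_split_ord big_ord1 /=; congr (_ + _); first by rewrite col_mxEu mxE.
  rewrite (bigD1 j) //= col_mxEd !mxE eqxx mulr1n scaleNr big1 ?addr0 // => i ij.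
  by rewrite col_mxEd !mxE (negPf ij) mulr0n oppr0 scale0r.
have bbA j : \sum_i A i j *: bb i = 0.
  by rewrite sumA /bb (unsplitK (inl _)) (unsplitK (inr _)) b'E subrr.
have [l [c [v [vA bE]]]] := flat_system flatB bbA.
(* By [sat] the first coordinate of every solution over R is divisible by [a]; being a combination
   of these coordinates, [b] is divisible by [a] as well. *)
have vE t : exists w, v t 0 (lshift m 0) = w * a.
  suff : v t 0 (lshift m 0) \in principal a by move/asboolP.
  apply: sat => j; apply/asboolP; exists (v t 0 (rshift 1 j)).
  have /rowP/(_ j) := vA t; rewrite !mxE.
  under eq_bigr do rewrite mulrC.
  by move: (sumA R^o (fun i => v t 0 i) j) => -> /subr0_eq; rewrite [RHS]mulrC.
have [w wE] := choice vE; apply: (nb (\sum_t w t *: c t)).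
have := bE (lshift m 0); rewrite /bb (unsplitK (inl _)) => ->.
rewrite scaler_sumr; apply: eq_bigr => t _; by rewrite wE scalerA mulrC.
Qed.

(** The form in which B is used as the intersection of its localizations at divisorial primes. *)
Lemma flat_local_global (a : R) (b : B) : a != 0 ->
  (forall P : prime_idealr R, divisorial_prime P ->
     exists s b', s \notin P /\ s *: b = a *: b') ->
  exists b', b = a *: b'.
Proof.
move=> a0 loc; apply: contrapT => nb.
have [|P dP sP] := flat_divisorial (b := b) a0.
  by move=> b' bE; apply: nb; exists b'.
by have [s [b' [/negP Ps /sP]]] := loc P dP.
Qed.
End DivisorialFlat.
End Fibration.

(** * Factoriality of K[X,Y] *)

Section Gauss.
Variable K : fieldType.
Implicit Types (c p q : {poly K}) (a b x y z w h : {poly {poly K}}).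

Lemma irreducible_factor c : (1 < size c)%N ->
  exists2 p, irreducible_poly p & exists q, c = p * q.
Proof.
have [n] := ubnP (size c); elim: n c => // n IHn c; rewrite ltnS => le_cn c1.
have [irr|nirr] := pselect (irreducible_poly c).
  by exists c => //; exists 1; rewrite mulr1.
have [q [q1 qc nqc]] : exists q, [/\ size q != 1%N, q %| c & ~~ (q %= c)].
  apply: contrapT => no; apply: nirr; split=> // q q1 qc.
  by apply: contrapT => /negP nqc; apply: no; exists q.
have c0 : c != 0 by rewrite -size_poly_gt0 (ltn_trans _ c1).
have q0 : q != 0 by apply: contraNneq c0 => q0; move: qc; rewrite q0 dvd0p.
have lt_qc : (size q < size c)%N.
  by rewrite ltn_neqAle (dvdp_leq c0 qc) andbT dvdp_size_eqp.
have [||p irrp [r qE]] := IHn q; first exact: leq_trans lt_qc le_cn.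
  by rewrite ltn_neqAle eq_sym q1 size_poly_gt0.
by have /dvdpP[s ->] := qc; exists p => //; exists (r * s); rewrite qE mulrC mulrA.
Qed.

Definition cdvd p a := forall i, p %| a`_i.

Lemma cdvdP p a : cdvd p a -> exists b, a = p *: b.
Proof.
move=> pa; exists (\poly_(i < size a) (a`_i %/ p)); apply/polyP=> i.
rewrite coefZ coef_poly; case: ltnP => [_|le]; first by rewrite mulrC divpK.
by rewrite mulr0 nth_default.
Qed.

(** Gauss's lemma. If i and j are the least indices at which [p] fails to divide the coefficients of
    [a] and [b], it fails at index i + j of the product. *)
Lemma cdvd_mul p a b : irreducible_poly p -> cdvd p (a * b) -> cdvd p a \/ cdvd p b.
Proof.
move=> irrp pab; apply: contrapT => /not_orP[/existsNP[i0 /negP na] /existsNP[j0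
  /negP nb]].
have exa : exists i, ~~ (p %| a`_i) by exists i0.
have exb : exists i, ~~ (p %| b`_i) by exists j0.
case: (ex_minnP exa) => i nai mini; case: (ex_minnP exb) => j nbj minj.
have := pab (i + j)%N; rewrite coefM.
have lt_i : (i < (i + j).+1)%N by rewrite ltnS leq_addr.
rewrite (bigD1 (Ordinal lt_i)) //= dvdp_addl.
  rewrite addKn; have [irr1 irr2] := irrp.
  have [co|/negPf nco] := boolP (coprimep p a`_i).
    by rewrite Gauss_dvdpr // (negPf nbj).
  have := irr2 (gcdp p a`_i); rewrite -coprimep_def nco => /(_ isT (dvdp_gcdl _ _)).
  by move=> /(eqp_dvdl a`_i); rewrite dvdp_gcdr (negPf nai).
elim/big_rec: _ => [|k u neq pu]; first exact: dvdp0.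
apply: dvdp_add pu.
have [lt_ki|lt_ik|eqk] := ltngtP (val k) i.
- by rewrite dvdp_mulr //; apply: contraTT lt_ki => /mini; rewrite -leqNgt.
- rewrite dvdp_mull //; apply: contraTT lt_ik => /minj.
  by rewrite -leqNgt leq_subRL ?leq_ord // leq_add2r.
- by rewrite -val_eqE /= eqk eqxx in neq.
Qed.

Lemma cscaleI p x y : p != 0 -> p *: x = p *: y -> x = y.
Proof. by move=> p0; rewrite -!mul_polyC; apply: mulfI; rewrite polyC_eq0. Qed.

(** The units of K[X][Y]. *)
Definition bipoly_const a := exists2 c : K, c != 0 & a = c%:P%:P.

Variables (a : {poly {poly K}}).
Hypothesis a0 : a != 0.
Hypothesis irra : forall u v, a = u * v -> bipoly_const u \/ bipoly_const v.

(** The irreducible factors of [c] are removed one at a time: by Gauss's lemma each divides [a] or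
    [w], and it cannot divide [a], which is irreducible of positive degree in Y. *)
Lemma bipoly_clear (c : {poly K}) x w :
  (1 < size a)%N -> c != 0 -> c *: x = a * w -> exists w', x = a * w'.
Proof.
move=> a1; have [n] := ubnP (size c); elim: n c w => // n IHn c w.
rewrite ltnS => le_cn c0 E; have [c1|c1] := ltnP 1 (size c).
  have [p irrp [q cE]] := irreducible_factor c1.
  have p0 : p != 0 by apply: contraNneq c0 => p0; rewrite cE p0 mul0r.
  have [pa|pw] : cdvd p a \/ cdvd p w.
  - apply: cdvd_mul => // i; rewrite -E cE -scalerA coefZ; exact: dvdp_mulIl.
  - have [b aE] := cdvdP pa; exfalso.
    have := irra (u := p%:P) (v := b); rewrite mul_polyC => /(_ aE).
    case=> -[d d0 dE].
      by have [] := irrp; rewrite (polyC_inj dE) size_polyC d0.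
    by move: a1; rewrite aE dE -mul_polyC -polyCM ltnNge size_polyC_leq1.
  have [b wE] := cdvdP pw; apply: (IHn q b).
  - rewrite (leq_trans _ le_cn) // cE size_mul //; last first.
      by apply: contraNneq c0 => q0; rewrite cE q0 mulr0.
    have [] := irrp; case: (size p) => [|[|m]] // _ _.
    by rewrite addSn /= addSn ltnS leq_addl.
  - by apply: contraNneq c0 => q0; rewrite cE q0 mulr0.
  - by apply: (cscaleI p0); rewrite scalerA -cE E wE scalerAr.
have [d dE] : exists d, c = d%:P by exists c`_0; exact: size1_polyC.
exists (d^-1%:P *: w); rewrite -scalerAr -E dE scalerA -polyCM mulVf ?scale1r //.
by apply: contraNneq c0 => d0; rewrite dE d0.
Qed.

(** This says that [a] stays irreducible over K(X): each irreducible factor of [c] is cancelled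
    against [w] or [h] until a factorization of [a] itself remains. *)
Lemma bipoly_cofactor (c : {poly K}) w h :
  (1 < size h)%N -> c != 0 -> c *: a = w * h -> (size w <= 1)%N.
Proof.
have [n] := ubnP (size c); elim: n c w h => // n IHn c w h.
rewrite ltnS => le_cn h1 c0 E; have [c1|c1] := ltnP 1 (size c).
  have [p irrp [q cE]] := irreducible_factor c1.
  have p0 : p != 0 by apply: contraNneq c0 => p0; rewrite cE p0 mul0r.
  have q0 : q != 0 by apply: contraNneq c0 => q0; rewrite cE q0 mulr0.
  have lt_qn : (size q < n)%N.
    rewrite (leq_trans _ le_cn) // cE size_mul //.
    have [] := irrp; case: (size p) => [|[|m]] // _ _.
    by rewrite addSn /= addSn ltnS leq_addl.
  have [pw|ph] : cdvd p w \/ cdvd p h.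
  - apply: cdvd_mul => // i; rewrite -E cE -scalerA coefZ; exact: dvdp_mulIl.
  - have [b wE] := cdvdP pw; rewrite wE size_scale //; apply: (IHn q b h) => //.
    by apply: (cscaleI p0); rewrite scalerA -cE E wE scalerAl.
  - have [b hE] := cdvdP ph; apply: (IHn q w b) => //.
      by move: h1; rewrite hE size_scale.
    by apply: (cscaleI p0); rewrite scalerA -cE E hE scalerAr.
have [d dE] : exists d, c = d%:P by exists c`_0; exact: size1_polyC.
have d0 : d != 0 by apply: contraNneq c0 => d0; rewrite dE d0.
have [|[e e0 eE]|[e e0 hE]] := irra (u := d^-1%:P *: w) (v := h).
- by rewrite -scalerAl -E dE scalerA -polyCM mulVf ?scale1r.
- have : (size (d^-1%:P *: w) <= 1)%N by rewrite eE size_polyC_leq1.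
  by rewrite size_scale // polyC_eq0 invr_eq0.
- by move: h1; rewrite hE ltnNge size_polyC_leq1.
Qed.

(** Suppose [a] has positive degree in Y. If [a] and [x] are coprime over K(X), then [a] divides a
    K[X]-multiple of [y]; if not, [bipoly_cofactor] makes [a] their gcd up to factors from K[X], and
    [a] divides a K[X]-multiple of [x]. [bipoly_clear] removes the multiplier. For [a] in K[X]
    Gauss's lemma is enough. *)
Lemma bipoly_prime x y z : ~ bipoly_const a -> a * z = x * y ->
  (exists w, x = a * w) \/ (exists w, y = a * w).
Proof.
move=> nca E; have [a1|a1] := ltnP 1 (size a).
  have axy : a %| x * y by rewrite -E dvdp_mulIl.
  have [co|nco] := boolP (coprimep a x).
    right; move: axy; rewrite Gauss_dvdpr // => /Pdiv.Idomain.dvdpP[[c w] /= c0 yE].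
    by apply: (bipoly_clear a1 c0); rewrite yE mulrC.
  left; have /Pdiv.Idomain.dvdpP[[c w] /= c0 aE] := dvdp_gcdl a x.
  have h1 : (1 < size (gcdp a x))%N.
    rewrite ltn_neqAle eq_sym -coprimep_def nco size_poly_gt0.
    by rewrite gcdp_eq0 (negPf a0).
  have w1 := bipoly_cofactor h1 c0 aE.
  have w0 : w != 0.
    apply/eqP=> w0; have /eqP := aE; rewrite w0 mul0r -mul_polyC mulf_eq0.
    by rewrite polyC_eq0 (negPf c0) (negPf a0).
  have /Pdiv.Idomain.dvdpP[[d v] /= d0 xE] := dvdp_gcdr a x.
  have wE := size1_polyC w1; have w00 : w`_0 != 0.
    by apply: contraNneq w0 => w00; rewrite wE w00.
  apply: (@bipoly_clear (w`_0 * d) x (c *: v)) => //; first exact: mulf_neq0.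
  by rewrite -scalerA xE -[LHS]mul_polyC -wE mulrCA -aE -!scalerAr mulrC.
have [p aE] : exists p, a = p%:P by exists a`_0; exact: size1_polyC.
have p0 : p != 0 by rewrite -(polyC_eq0 p) -aE.
have irrp : irreducible_poly p.
  split.
    rewrite ltnNge; apply/negP=> /size1_polyC pE; apply: nca; exists p`_0.
      by apply: contraNneq p0 => p00; rewrite pE p00.
    by rewrite aE {1}pE.
  move=> q q1 /dvdpP[r pE]; have [|[c c0 rE]|[c c0 qE]] := irra (u := r%:P) (v := q%:P).
  - by rewrite aE pE polyCM.
  - by rewrite pE (polyC_inj rE) mul_polyC eqp_sym eqp_scale.
  - by rewrite (polyC_inj qE) size_polyC c0 in q1.
have [px|py] : cdvd p x \/ cdvd p y.
- by apply: cdvd_mul => // i; rewrite -E aE mul_polyC coefZ dvdp_mulIl.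
- by left; have [b ->] := cdvdP px; exists b; rewrite aE mul_polyC.
- by right; have [b ->] := cdvdP py; exists b; rewrite aE mul_polyC.
Qed.

End Gauss.

Section TwoVariables.
Variable K : fieldType.
Local Notation KXY := {mpoly K[2]}.

Definition bivariate : KXY -> {poly {poly K}} :=
  mmap (polyC \o polyC) (fun i : 'I_2 => if i == 0 then 'X%:P else 'X).
HB.instance Definition _ := GRing.RMorphism.on bivariate.

Definition bivariate_inv (p : {poly {poly K}}) : KXY :=
  (map_poly (fun q => (map_poly (@mpolyC 2 K) q).['X_0]) p).['X_1].

Let in0 (q : {poly K}) : KXY := (map_poly (@mpolyC 2 K) q).['X_0].
Fact in0_zmod : zmod_morphism in0.
Proof. by move=> p q; rewrite /in0 rmorphB hornerD hornerN. Qed.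
Fact in0_monoid : monoid_morphism in0.
Proof. by split=> [|p q]; rewrite /in0 ?rmorph1 ?hornerC // rmorphM hornerM. Qed.
HB.instance Definition _ := GRing.isZmodMorphism.Build _ _ in0 in0_zmod.
HB.instance Definition _ := GRing.isMonoidMorphism.Build _ _ in0 in0_monoid.

Fact bivariate_inv_zmod : zmod_morphism bivariate_inv.
Proof.
by move=> p q; rewrite /bivariate_inv -/in0 rmorphB hornerD hornerN.
Qed.
Fact bivariate_inv_monoid : monoid_morphism bivariate_inv.
Proof.
by split=> [|p q]; rewrite /bivariate_inv -/in0 ?rmorph1 ?hornerC // rmorphM hornerM.
Qed.
HB.instance Definition _ :=
  GRing.isZmodMorphism.Build _ _ bivariate_inv bivariate_inv_zmod.
HB.instance Definition _ :=
  GRing.isMonoidMorphism.Build _ _ bivariate_inv bivariate_inv_monoid.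

Lemma bivariate_invC (c : K) : bivariate_inv c%:P%:P = c%:MP.
Proof. by rewrite /bivariate_inv -/in0 map_polyC hornerC /= /in0 map_polyC hornerC. Qed.

Lemma bivariateC (c : K) : bivariate c%:MP = c%:P%:P.
Proof. by rewrite /bivariate mmapC. Qed.

Lemma bivariateK : cancel bivariate bivariate_inv.
Proof.
move=> p; rewrite {1}(mpolyE p) (rmorph_sum bivariate) (rmorph_sum bivariate_inv) /=.
rewrite [RHS]mpolyE; apply: eq_bigr => m _.
rewrite -mul_mpolyC rmorphM [LHS]rmorphM /= bivariateC bivariate_invC; congr (_ * _).
rewrite /bivariate mmapX /mmap1 rmorph_prod mpolyXE_id; apply: eq_bigr => i _.
rewrite rmorphXn /=; congr (_ ^+ _); rewrite /bivariate_inv -/in0.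
case: eqP => [->|i0]; first by rewrite map_polyC hornerC /= /in0 map_polyX hornerX.
rewrite map_polyX hornerX; congr 'X_ _; apply/val_inj; move/eqP: i0.
by case: i => [[|[|//]] ?]; rewrite -val_eqE.
Qed.

Lemma bivariate_invK : cancel bivariate_inv bivariate.
Proof.
move=> p; elim/poly_ind: p => [|p q IHp]; first by rewrite !raddf0.
rewrite rmorphD rmorphM [LHS]rmorphD [X in X + _]rmorphM /= IHp; congr (_ * _ + _).
  rewrite /bivariate_inv -/in0 map_polyX hornerX /bivariate.
  by rewrite mmapX mmap1U.
elim/poly_ind: q => [|q c IHq]; first by rewrite !raddf0.
rewrite polyCD polyCM rmorphD rmorphM [LHS]rmorphD [X in X + _]rmorphM /= IHq
  bivariate_invC bivariateC; congr (_ * _ + _).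
rewrite /bivariate_inv -/in0 map_polyC hornerC /= /in0 map_polyX hornerX.
by rewrite /bivariate mmapX mmap1U.
Qed.

Lemma mpoly2_prime (a x y z : KXY) :
  (forall u v : KXY, a = u * v -> (msize u <= 1)%N \/ (msize v <= 1)%N) ->
  (1 < msize a)%N -> a * z = x * y ->
  (exists w, x = a * w) \/ (exists w, y = a * w).
Proof.
move=> irra a1 E; have a0 : a != 0 by apply: contraTneq a1 => ->; rewrite msize0.
have cst (u : KXY) : u != 0 -> (msize u <= 1)%N -> bipoly_const (bivariate u).
  move=> u0 /msize1_polyC uE; exists u@_0%MM; last by rewrite {1}uE bivariateC.
  by apply: contraNneq u0 => u00; rewrite uE u00.
have [||||[w xE]|[w yE]] := @bipoly_prime K (bivariate a) _ _
  (bivariate x) (bivariate y) (bivariate z).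
- by rewrite -(rmorph0 bivariate) (inj_eq (can_inj bivariateK)).
- move=> u v aE; have aE' : a = bivariate_inv u * bivariate_inv v.
    by rewrite -rmorphM -aE /= bivariateK.
  have u0 : bivariate_inv u != 0 by apply: contraNneq a0 => u0; rewrite aE' u0 mul0r.
  have v0 : bivariate_inv v != 0 by apply: contraNneq a0 => v0; rewrite aE' v0 mulr0.
  by have [/(cst _ u0)|/(cst _ v0)] := irra _ _ aE'; rewrite bivariate_invK;
    [left|right].
- move=> [c c0 aE]; have : a = c%:MP by rewrite -[a]bivariateK aE bivariate_invC.
  by move=> aE'; rewrite aE' ltnNge msizeC in a1; case: (c != 0) in a1.
- by rewrite -!rmorphM E.
- by left; exists (bivariate_inv w); rewrite -[x]bivariateK xE rmorphM /= bivariateK.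
- by right; exists (bivariate_inv w); rewrite -[y]bivariateK yE rmorphM /= bivariateK.
Qed.

End TwoVariables.

(** * Kernels of locally nilpotent derivations of K[X,Y] *)

Section DerivationTheory.
Variables (R : comNzRingType) (C : comAlgType R) (D : derivation C).

Lemma der_iter_add n x y : iter n D (x + y) = iter n D x + iter n D y.
Proof. by elim: n => //= n ->; rewrite linearD. Qed.

Lemma der_iter0 n : iter n D 0 = 0.
Proof. by elim: n => //= n ->; rewrite linear0. Qed.

Lemma der_iter_ge m n x : (m <= n)%N -> iter m D x = 0 -> iter n D x = 0.
Proof. by move=> /subnK <- x0; rewrite iterD x0 der_iter0. Qed.

Lemma der1 : D 1 = 0.
Proof.
have /eqP := derivationM D 1 1.
by rewrite !mulr1 mul1r -subr_eq0 opprD addNKr oppr_eq0 => /eqP.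
Qed.

Lemma derX (s : C) n : D (s ^+ n) = s ^+ n.-1 * D s *+ n.
Proof.
elim: n => [|n IHn]; first by rewrite expr0 der1 mulr0n.
rewrite exprS derivationM IHn mulrnAr mulrA -exprS mulrS mulrC; congr (_ + _).
by case: n {IHn} => [|n] //=; rewrite !mulr0n.
Qed.

Lemma der_horner (p : {poly C}) (s : C) : (forall i, D p`_i = 0) ->
  D p.[s] = p^`().[s] * D s.
Proof.
elim/poly_ind: p => [|p c IHp] Dp; first by rewrite deriv0 !horner0 linear0 mul0r.
have Dc : D c = 0 by have := Dp 0%N; rewrite coefD coefMX coefC add0r.
have /IHp {}IHp i : D p`_i = 0 by have := Dp i.+1; rewrite coefD coefMX coefC addr0.
rewrite hornerMXaddC linearD derivationM IHp // Dc addr0 derivD derivM derivX derivC.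
by rewrite addr0 mulr1 hornerD hornerMX mulrDl mulrAC.
Qed.

(** The only surviving term of Leibniz's expansion. In a domain of characteristic zero it makes the
    order of nilpotency behave like a degree; the induction is Pascal's rule. *)
Lemma der_iter_top m n x y : iter m.+1 D x = 0 -> iter n.+1 D y = 0 ->
  iter (m + n) D (x * y) = (iter m D x * iter n D y) *+ 'C(m + n, m).
Proof.
move Ek : (m + n)%N => k; elim: k m n x y Ek => [|k IHk] m n x y.
  by case: m n => [|//] [|//] _ _ _.
move=> Ek Dx Dy; rewrite iterSr derivationM der_iter_add.
case: m n Ek Dx Dy => [|m] [|n] //.
- rewrite add0n => -[Ek] Dx Dy; subst k.
  have Dx0 : D x = 0 by [].
  rewrite Dx0 mul0r der_iter0 add0r (IHk 0%N n) // -?iterSr //.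
  by rewrite !bin0.
- rewrite addn0 => -[Ek] Dx Dy; subst k.
  have Dy0 : D y = 0 by [].
  rewrite Dy0 mulr0 der_iter0 addr0 (IHk m 0%N) // ?addn0 // -?iterSr //.
  by rewrite !binn.
- rewrite addSn addnS => -[Ek] Dx Dy.
  have Ek' : (m + n.+1)%N = k by rewrite addnS.
  have Dx' : iter m.+1 D (D x) = 0 by rewrite -iterSr.
  have Dy' : iter n.+1 D (D y) = 0 by rewrite -iterSr.
  rewrite (IHk m n.+1 _ _ Ek' Dx' Dy) (IHk m.+1 n _ _ Ek Dx Dy') -!iterSr.
  by rewrite binS addnC mulrnDr.
Qed.

Section Domain.
Hypothesis domC : forall x y : C, x * y = 0 -> x = 0 \/ y = 0.
Hypothesis charC : forall n (x : C), (0 < n)%N -> x *+ n = 0 -> x = 0.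

Lemma der_order (x : C) : locally_nilpotent D -> x != 0 ->
  exists n, iter n D x != 0 /\ iter n.+1 D x = 0.
Proof.
move=> nilD x0; have exn : exists n, iter n D x == 0.
  by have [n /eqP] := nilD x; exists n.
case: (ex_minnP exn) => -[|n] /eqP nx min; first by rewrite [x]nx eqxx in x0.
by exists n; split=> //; apply/negP=> /min; rewrite ltnn.
Qed.

(** The orders of [x] and [y] add up to that of the product, which is zero. *)
Lemma der_ker_inert (x y : C) : locally_nilpotent D ->
  x != 0 -> y != 0 -> D (x * y) = 0 -> D x = 0 /\ D y = 0.
Proof.
move=> nilD x0 y0 Dxy.
have [m [mx mx']] := der_order nilD x0; have [n [ny ny']] := der_order nilD y0.
have := der_iter_top mx' ny'; have [|mn] := posnP (m + n).
  by move/eqP; rewrite addn_eq0 => /andP[/eqP m0 /eqP n0] _; rewrite m0 n0 in mx' ny'.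
rewrite (@der_iter_ge 1 _ (x * y)) // => /esym/charC; rewrite bin_gt0 leq_addr.
by move=> /(_ isT)/domC[/eqP|/eqP]; rewrite ?(negPf mx) ?(negPf ny).
Qed.

Lemma local_slice : locally_nilpotent D -> (exists b, D b <> 0) ->
  exists s, D s != 0 /\ D (D s) = 0.
Proof.
move=> nilD [b /eqP Db]; have b0 : b != 0.
  by apply: contraNneq Db => ->; rewrite linear0.
have [[|n] [nb nb']] := der_order nilD b0; first by case/eqP: Db.
by exists (iter n D b).
Qed.

(** Applying [D] to p(s) = 0 gives p'(s) D s = 0, a relation of smaller degree. By induction p' = 0,
    so p is constant in characteristic zero. *)
Lemma slice_transcendental (s : C) (p : {poly C}) : D s != 0 ->
  (forall i, D p`_i = 0) -> p.[s] = 0 -> p = 0.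
Proof.
move=> Ds; have [n] := ubnP (size p); elim: n p => // n IHn p lt_pn Dp ps.
have p'0 : p^`() = 0.
  have [p0|p0] := eqVneq p 0; first by rewrite p0 deriv0.
  apply: IHn.
  - exact: leq_trans (lt_size_deriv p0) lt_pn.
  - by move=> i; rewrite coef_deriv linearMn Dp mul0rn.
  - have := der_horner s Dp; rewrite ps linear0 => /esym/domC[//|/eqP].
    by rewrite (negPf Ds).
have pC : p = (p`_0)%:P.
  apply/polyP=> -[|i]; rewrite coefC //=; apply: (charC (n := i.+1)) => //.
  by rewrite -coef_deriv p'0 coef0.
by move: ps; rewrite pC hornerC => ->.
Qed.

End Domain.
End DerivationTheory.

Lemma kermx_nontrivial (K : fieldType) p q (A : 'M[K]_(p, q)) :
  (q < p)%N -> exists2 u : 'rV[K]_p, u != 0 & u *m A = 0.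
Proof.
move=> lt_qp; have : kermx A != 0.
  rewrite kermx_eq0 /row_free; apply: contraTneq lt_qp => rA.
  by rewrite -leqNgt -rA rank_leq_col.
by move=> /rowV0Pn[u /sub_kermxP uA u0]; exists u.
Qed.

(** * Algebraic dependence by counting monomials *)

Section TranscendenceDegree.
Variable K : fieldType.
Local Notation KXY := {mpoly K[2]}.

Definition tdeg (p : KXY) := (msize p).-1.

Lemma tdegM (p q : KXY) : (tdeg (p * q) <= tdeg p + tdeg q)%N.
Proof.
have [->|p0] := eqVneq p 0; first by rewrite mul0r /tdeg msize0.
have [->|q0] := eqVneq q 0; first by rewrite mulr0 /tdeg msize0.
rewrite /tdeg msizeM // (mpolySpred _ p0) (mpolySpred _ q0) /=.
by rewrite ?addSn ?addnS /=.
Qed.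

Lemma tdegX (p : KXY) n : (tdeg (p ^+ n) <= tdeg p * n)%N.
Proof.
elim: n => [|n IHn]; first by rewrite expr0 /tdeg msize1.
by rewrite exprS mulnS (leq_trans (tdegM _ _)) // leq_add2l.
Qed.

(* The [N^3] monomials of degree [< N] in each of three polynomials of degree *)
(* at most [d] lie in a space of dimension [(3 d N)^2].                       *)
Lemma three_dependent (x y z : KXY) :
  exists N (c : 'I_N -> 'I_N -> 'I_N -> K),
    (exists i j l, c i j l != 0) /\
    \sum_i \sum_j \sum_l c i j l *: (x ^+ i * y ^+ j * z ^+ l) = 0.
Proof.
have [d [dx dy dz d0]] : exists d,
    [/\ (tdeg x <= d)%N, (tdeg y <= d)%N, (tdeg z <= d)%N & (0 < d)%N].
  exists (tdeg x + tdeg y + tdeg z).+1; split=> //; apply: leqW.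
  - by rewrite -addnA leq_addr.
  - by rewrite addnAC leq_addl.
  - exact: leq_addl.
(* The inequality (3 d N)^2 < N^3 amounts to 9 d^2 < N. *)
have [N NP] : exists N, (9 * d ^ 2 < N)%N by exists (9 * d ^ 2).+1.
have N0 : (0 < N)%N by apply: leq_trans NP.
pose M := (3 * d * N)%N.
pose I := ('I_N * 'I_N * 'I_N)%type; pose J := ('I_M * 'I_M)%type.
pose mon (i : I) : KXY := x ^+ i.1.1 * y ^+ i.1.2 * z ^+ i.2.
pose A := \matrix_(i < #|{: I}|, j < #|{: J}|)
  (mon (enum_val i))@_[multinom [tuple (enum_val j).1 : nat; (enum_val j).2 : nat]].
have lt_card : (#|{: J}| < #|{: I}|)%N.
  rewrite !card_prod !card_ord /M.
  have -> : (3 * d * N * (3 * d * N) = N * N * (9 * d ^ 2))%N.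
    by rewrite expnS expn1; ring.
  by rewrite ltn_pmul2l // muln_gt0 N0.
have [u u0 uA] := kermx_nontrivial A lt_card.
have sum0 : \sum_(i : I) u 0 (enum_rank i) *: mon i = 0.
  apply/mpolyP=> m; rewrite mcoeff0 raddf_sum /=.
  (* Coefficients at exponents below [M] are killed by the choice of [u]; at all others the degree
     bound makes every term zero. *)
  have [small|big] := boolP ((m ord0 < M) && (m ord_max < M))%N.
    have /andP[m0 m1] := small.
    have /rowP/(_ (enum_rank (Ordinal m0, Ordinal m1))) := uA; rewrite !mxE => E.
    rewrite -[RHS]E.
    rewrite (reindex (@enum_rank I)) /=; last exact: onW_bij (enum_rank_bij _).
    apply: eq_bigr => i _; rewrite mcoeffZ !mxE !enum_rankK; congr (_ * _@_ _).
    apply/mnmP=> t; rewrite multinomE (tnth_nth 0%N).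
    by case: t => [[|[|//]] ?] /=; congr (m _); apply: val_inj.
  rewrite big1 // => i _; rewrite mcoeffZ; apply/eqP; rewrite mulf_eq0;
    apply/orP; right.
  rewrite mcoeff_eq0; apply: msize_mdeg_ge.
  have deg_mon : (tdeg (mon i) <= d * (i.1.1 + i.1.2 + i.2))%N.
    apply: leq_trans (tdegM _ _) _; rewrite mulnDr; apply: leq_add.
      apply: leq_trans (tdegM _ _) _; rewrite mulnDr; apply: leq_add.
        by apply: leq_trans (tdegX _ _) _; rewrite leq_mul2r dx orbT.
      by apply: leq_trans (tdegX _ _) _; rewrite leq_mul2r dy orbT.
    by apply: leq_trans (tdegX _ _) _; rewrite leq_mul2r dz orbT.
  have le3 : (i.1.1 + i.1.2 + i.2 < 3 * N)%N.
    have -> : (3 * N = N + N + N)%N by ring.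
    rewrite -addnS; apply: leq_add => //; apply: leq_add; exact: ltnW.
  have degM : (msize (mon i) <= M)%N.
    rewrite -[msize _]/(msize (mon i)); apply: leq_trans (leqSpred _) _.
    rewrite -/(tdeg _); apply: leq_ltn_trans deg_mon _.
    by rewrite /M -mulnA mulnCA ltn_pmul2l.
  apply: leq_trans degM _; move: big; rewrite negb_and -!leqNgt mdegE.
  rewrite big_ord_recl big_ord1 => /orP[|] le; first exact: leq_trans le (leq_addr _ _).
  by apply: leq_trans le _; rewrite (_ : lift _ _ = ord_max) ?leq_addl //;
    apply: val_inj.
exists N, (fun i j l => u 0 (enum_rank (i, j, l))); split.
  have /rV0Pn[k uk] := u0; exists (enum_val k).1.1, (enum_val k).1.2, (enum_val k).2.
  by rewrite -!surjective_pairing enum_valK.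
rewrite -[RHS]sum0 pair_big /= pair_big /=; apply: eq_bigr => -[[i j] l] _ /=.
by [].
Qed.
End TranscendenceDegree.

(** * The kernel over a field of characteristic zero *)

Section Rentschler.
Variable K : fieldType.
Hypothesis charK : forall n, (0 < n)%N -> n%:R != 0 :> K.
Local Notation KXY := {mpoly K[2]}.
Local Notation ev p f := (map_poly (@mpolyC 2 K) p).[f].

Lemma mpoly_char n (x : KXY) : (0 < n)%N -> x *+ n = 0 -> x = 0.
Proof.
move=> n0 /eqP; rewrite -scaler_nat -mul_mpolyC mulf_eq0 mpolyC_eq0.
by rewrite (negPf (charK n0)) => /eqP.
Qed.

Lemma mpoly_domain (x y : KXY) : x * y = 0 -> x = 0 \/ y = 0.
Proof. by move/eqP; rewrite mulf_eq0 => /orP[/eqP|/eqP]; [left|right]. Qed.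

Lemma mpolyC_alg (c : K) : c%:MP = c%:A :> KXY.
Proof. by rewrite -mul_mpolyC mulr1. Qed.

Lemma der_mpolyC (D : derivation KXY) c : D c%:MP = 0.
Proof. by rewrite mpolyC_alg linearZ /= der1 scaler0. Qed.

Lemma der_evC (D : derivation KXY) (p : {poly K}) i : D (map_poly (@mpolyC 2 K)
  p)`_i = 0.
Proof. by rewrite coef_map der_mpolyC. Qed.

Definition partial (i : 'I_2) : derivation KXY :=
  Derivation (derivation_val := mderiv i) (mderivM i).

(** If X = p(s) and Y = q(s), the chain rule for X shows that p'(s) is non-zero and that s does not
    depend on Y; then neither does q(s). *)
Lemma not_one_generated (s : KXY) : exists b, forall p : {poly K}, b <> ev p s.
Proof.
apply: contrapT => no.
have gen b : exists p : {poly K}, b = ev p s.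
  by apply: contrapT => nb; apply: no; exists b => p bE; apply: nb; exists p.
have chain (i : 'I_2) (p : {poly K}) : partial i (ev p s) =
    (map_poly (@mpolyC 2 K) p)^`().[s] * partial i s.
  exact/der_horner/der_evC.
have [p pE] := gen 'X_0; have [q qE] := gen 'X_1.
have pX i j : partial i 'X_j = (j == i)%:R.
  rewrite -[LHS]/(mderiv i 'X_j) mderivX mnm1E; case: eqP => [->|_].
    rewrite scale1r (_ : (_ - _)%MM = 0%MM) ?mpolyX0 //.
    by apply/mnmP=> k; rewrite mnmBE mnm0E subnn.
  by rewrite scale0r.
have := chain 0 p; rewrite -pE pX eqxx => e1.
have := chain 1 p; rewrite -pE pX => /esym/mpoly_domain[p'0|s1].
  by move/eqP: e1; rewrite p'0 mul0r oner_eq0.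
have := chain 1 q; rewrite -qE pX eqxx s1 mulr0 => /eqP.
by rewrite oner_eq0.
Qed.

Variables (D : derivation KXY).
Hypotheses (nilD : locally_nilpotent D) (D0 : exists b, D b <> 0).

(** If the kernel were K, a local slice s would have D s in K, and subtracting multiples of powers
    of s would lower the order of any polynomial to zero. All of K[X,Y] would be K[s]. *)
Lemma kernel_nonconstant : exists x : KXY, D x = 0 /\ (1 < msize x)%N.
Proof.
apply: contrapT => no.
have cst x : D x = 0 -> exists c, x = c%:MP.
  move=> Dx; exists x@_0%MM; apply: msize1_polyC; rewrite leqNgt; apply/negP=> x1.
  by apply: no; exists x.
have [s [Ds /cst[c cE]]] := local_slice nilD D0.
have c0 : c != 0 by apply: contraNneq Ds => c0; rewrite cE c0.
have [b bP] := not_one_generated s.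
have [n nb] := nilD b.
elim: n b nb bP => [|n IHn] b nb bP; first by apply: (bP 0); rewrite rmorph0 horner0.
have [d dE] := cst (iter n D b) nb.
have iter_s k : iter k D (s ^+ k) = (c ^+ k * k`!%:R)%:MP.
  elim: k => [|k IHk]; first by rewrite /= expr0 mul1r.
  rewrite iterSr derX -pred_Sn cE.
  have -> : s ^+ k * c%:MP *+ k.+1 = (c * k.+1%:R) *: s ^+ k.
    by rewrite mulrC mul_mpolyC -scaler_nat scalerA mulrC.
  have iterZ m a (x : KXY) : iter m D (a *: x) = a *: iter m D x.
    by elim: m => //= m ->; rewrite linearZ.
  by rewrite iterZ IHk -mul_mpolyC -mpolyCM exprS factS natrM; congr _%:MP; ring.
have iterZ m a (x : KXY) : iter m D (a *: x) = a *: iter m D x.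
  by elim: m => //= m ->; rewrite linearZ.
(* The n-th iterate of [D] takes s^n to c^n n!, so e s^n has the same n-th iterate [d] as [b]. *)
pose e := d / (c ^+ n * n`!%:R).
have nz : c ^+ n * n`!%:R != 0 by rewrite mulf_neq0 ?expf_neq0 ?charK ?fact_gt0.
apply: (IHn (b - e *: s ^+ n)) => [|p bE].
  rewrite der_iter_add -scaleN1r !iterZ iter_s dE -[e *: _]mul_mpolyC -mpolyCM divfK //.
  by rewrite scaleN1r subrr.
apply: (bP (p + e *: 'X^n)); rewrite rmorphD /= hornerD -bE map_polyZ /= hornerZ.
by rewrite map_polyXn hornerXn mul_mpolyC subrK.
Qed.

(** A local slice s is transcendental over the kernel, so in a dependence between [a], [g] and s the
    coefficient of each power of s vanishes separately. *)
Lemma kernel_dependent (a g : KXY) : D a = 0 -> D g = 0 ->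
  exists (N : nat) (c : 'I_N -> 'I_N -> K),
    (exists i j, c i j != 0) /\ \sum_i \sum_j c i j *: (a ^+ i * g ^+ j) = 0.
Proof.
move=> Da Dg; have [s [Ds _]] := local_slice nilD D0.
have [N [c [[i0 [j0 [l0 nz]]] E]]] := three_dependent a g s.
exists N, (fun i j => c i j l0); split; first by exists i0, j0.
pose q l := \sum_i \sum_j c i j l *: (a ^+ i * g ^+ j).
pose P := \poly_(l < N) (if insub l is Some l' then q l' else 0).
suff P0 : P = 0.
  have /polyP/(_ l0) := P0; rewrite coef_poly ltn_ord valK coef0; exact.
apply: (@slice_transcendental _ _ D mpoly_domain mpoly_char s P Ds) => [l|].
  rewrite coef_poly; case: ifP => _; last by rewrite linear0.
  case: insub => [l'|]; last by rewrite linear0.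
  rewrite linear_sum big1 // => i _; rewrite linear_sum big1 // => j _.
  by rewrite linearZ /= derivationM !derX Da Dg !mulr0 !mul0rn !(mul0r, mulr0)
    addr0 scaler0.
rewrite /P poly_def horner_sum -[RHS]E.
under [RHS]eq_bigr do rewrite exchange_big.
rewrite exchange_big; apply: eq_bigr => l _ /=.
rewrite valK hornerZ hornerXn mulr_suml; apply: eq_bigr => i _.
by rewrite mulr_suml; apply: eq_bigr => j _; rewrite -scalerAl.
Qed.

(** Group the dependence by powers of [a] and divide by the lowest power that occurs: its
    coefficient, a polynomial in [g], is a multiple of [a]. *)
Lemma kernel_algebraic_mod (a g : KXY) : a != 0 -> D a = 0 -> D g = 0 ->
  exists chi : {poly K}, chi != 0 /\ exists w, ev chi g = a * w.
Proof.
move=> a0 Da Dg; have [N [c [nz E]]] := kernel_dependent Da Dg.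
have exi : exists i, [exists i' : 'I_N, (i == i' :> nat) && [exists j, c i' j != 0]].
  have [i [j cij]] := nz; exists i; apply/existsP; exists i; rewrite eqxx /=.
  by apply/existsP; exists j.
case: (ex_minnP exi) => i /existsP[i' /andP[/eqP ii' /existsP[j cij]]] mini.
subst i; pose row (t : 'I_N) := \poly_(l < N) (if insub l is Some l' then c t l'
  else 0).
have rowE t : ev (row t) g = \sum_l c t l *: g ^+ l.
  rewrite /row poly_def rmorph_sum horner_sum; apply: eq_bigr => l _.
  by rewrite valK /= map_polyZ /= hornerZ map_polyXn hornerXn mul_mpolyC.
exists (row i'); split.
  by apply: contraNneq cij => /polyP/(_ j);
    rewrite coef_poly ltn_ord valK coef0 => /eqP.
have low (t : 'I_N) : (t < i')%N -> row t = 0.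
  move=> lt; apply/polyP=> l; rewrite coef_poly coef0; case: ifP => // _.
  case: insubP => // l' _ _; apply/eqP; apply: contraTT lt => ctl.
  rewrite -leqNgt; apply: mini; apply/existsP; exists t; rewrite eqxx /=.
  by apply/existsP; exists l'.
exists (- \sum_(t : 'I_N | (i' < t)%N) a ^+ (t - i').-1 * ev (row t) g).
apply: (@mulfI _ (a ^+ i')); first by rewrite expf_neq0.
have : \sum_(t : 'I_N) a ^+ t * ev (row t) g = 0.
  rewrite -[RHS]E; apply: eq_bigr => t _; rewrite rowE mulr_sumr.
  by apply: eq_bigr => l _; rewrite scalerAr.
rewrite (bigD1 i') //= => /eqP; rewrite addr_eq0 => /eqP ->.
rewrite mulrN mulrN; congr (- _); rewrite mulrA -exprSr mulr_sumr.
rewrite [LHS](bigID (fun t : 'I_N => (i' < t)%N)) /= [X in _ + X]big1 ?addr0.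
  apply: eq_big => [t|t /andP[_ lt]].
    by rewrite andb_idl // => lt; apply: contraTneq lt => ->; rewrite ltnn.
  rewrite mulrA -exprD; congr (_ ^+ _ * _).
  by rewrite addSnnS prednK ?subn_gt0 // subnKC // ltnW.
move=> t /andP[neq]; rewrite -leqNgt => le; rewrite low ?rmorph0 ?horner0 ?mulr0 //.
by rewrite ltn_neqAle le andbT.
Qed.

(* A kernel element of least degree vanishing at the origin is irreducible in *)
(* [K[X,Y]], hence prime; it divides every other one.                         *)
Lemma rentschler : exists f : KXY, (1 < msize f)%N /\
  forall x, D x = 0 <-> exists p : {poly K}, x = ev p f.
Proof.
have Dev p f : D f = 0 -> D (ev p f) = 0.
  by move=> Df; rewrite (der_horner _ (der_evC D p)) Df mulr0.
pose Q n := `[< exists x : KXY, [/\ D x = 0, x@_0%MM = 0, (1 < msize x)%N &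
  msize x = n] >].
have msize_const (x : KXY) c : (1 < msize x)%N -> (msize (x - c%:MP) <= msize x)%N /\
    (1 < msize (x - c%:MP))%N.
  move=> x1; split.
    apply: leq_trans (msizeD_le _ _) _; rewrite geq_max leqnn msizeN msizeC.
    by case: (c != 0); rewrite // ltnW.
  rewrite ltnNge; apply: contraTN x1 => /msize1_polyC E; rewrite -leqNgt.
  by rewrite -[x](subrK c%:MP) E -mpolyCD msizeC; case: (_ != 0).
have exQ : exists n, Q n.
  have [x [Dx x1]] := kernel_nonconstant; exists (msize (x - (x@_0%MM)%:MP)).
  apply/asboolP; exists (x - (x@_0%MM)%:MP); split=> //.
  - by rewrite linearB /= Dx der_mpolyC subr0.
  - by rewrite mcoeffB mcoeffC eqxx mulr1 subrr.
  - by case: (msize_const x x@_0%MM x1).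
case: (ex_minnP exQ) => n /asboolP[a [Da az a1 an]] min0.
have min x : D x = 0 -> (1 < msize x)%N -> (msize a <= msize x)%N.
  move=> Dx x1; have [le lt] := msize_const _ x@_0%MM x1.
  apply: leq_trans le; rewrite an; apply: min0; apply/asboolP.
  exists (x - (x@_0%MM)%:MP); split=> //.
    by rewrite linearB /= Dx der_mpolyC subr0.
  by rewrite mcoeffB mcoeffC eqxx mulr1 subrr.
have a0 : a != 0 by apply: contraTneq a1 => ->; rewrite msize0.
have inertA := der_ker_inert mpoly_domain mpoly_char nilD.
have irra u v : a = u * v -> (msize u <= 1)%N \/ (msize v <= 1)%N.
  move=> aE; have u0 : u != 0 by apply: contraNneq a0 => u0; rewrite aE u0 mul0r.
  have v0 : v != 0 by apply: contraNneq a0 => v0; rewrite aE v0 mulr0.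
  have [Du Dv] : D u = 0 /\ D v = 0 by apply: inertA; rewrite -?aE.
  have [u1|u1] := leqP (msize u) 1; [by left | right].
  have := min _ Du u1; rewrite aE msizeM // (mpolySpred _ u0) (mpolySpred _ v0).
  by rewrite addSn addnS /= ltnS -{2}[(msize u).-1]addn0 leq_add2l leqn0 => /eqP->.
have prime := mpoly2_prime irra a1.
have eval0M (x y : KXY) : (x * y)@_0%MM = x@_0%MM * y@_0%MM := rmorphM (mcoeff
  0%MM) x y.
have eval0ev (p : {poly K}) (x : KXY) : x@_0%MM = 0 -> (ev p x)@_0%MM = p`_0.
  move=> x0; elim/poly_ind: p => [|p c _];
    first by rewrite rmorph0 horner0 mcoeff0 coef0.
  rewrite rmorphD rmorphM /= map_polyX map_polyC hornerMXaddC mcoeffD eval0M x0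
    mulr0 add0r.
  by rewrite mcoeffC eqxx mulr1 coefD coefMX add0r coefC.
have dvd g : D g = 0 -> g@_0%MM = 0 -> exists w, g = a * w.
  move=> Dg g0; have [chi [chi0 [w wE]]] := kernel_algebraic_mod a0 Da Dg.
  (* Write chi = q X^m with q(0) non-zero. The prime [a] divides q(g) g^m; it does not divide q(g),
     which is non-zero at the origin, so it divides g. *)
  have [m [q]] := multiplicity_XsubC chi 0; rewrite chi0 /= => nq chiE.
  have q0 : (ev q g)@_0%MM != 0 by rewrite eval0ev // -horner_coef0.
  move: wE; rewrite chiE rmorphM rmorphXn /= polyC0 subr0 map_polyX hornerM hornerXn.
  move=> /esym/prime[[u uE]|].
    by move: q0; rewrite uE eval0M az mul0r eqxx.
  elim: m {chiE} => [|m IHm] [u uE].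
    by have := eval0M a u; rewrite -uE expr0 az mul0r mcoeff1 eqxx => /eqP;
      rewrite oner_eq0.
  by move: uE; rewrite exprS => /esym/prime[|/IHm].
exists a; split=> // x; split=> [|[p ->]]; last exact: Dev.
(* Induction on the degree: x - x(0) = a w, where w is again in the kernel by inertness and has
   smaller degree. *)
have [k] := ubnP (msize x); elim: k x => // k IHk x lt_xk Dx.
have [x1|x1] := leqP (msize x) 1.
  by exists (x@_0%MM)%:P; rewrite map_polyC hornerC /= -msize1_polyC.
pose y := x - (x@_0%MM)%:MP; have [le_yx y1] := msize_const _ x@_0%MM x1.
have Dy : D y = 0 by rewrite linearB /= Dx der_mpolyC subr0.
have [w yE] : exists w, y = a * w.
  by apply: dvd => //; rewrite mcoeffB mcoeffC eqxx mulr1 subrr.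
have w0 : w != 0 by apply: contraTneq y1 => w0; rewrite -/y yE w0 mulr0 msize0.
have [_ Dw] : D a = 0 /\ D w = 0 by apply: inertA; rewrite -?yE.
have [|p pE] := IHk w _ Dw.
  rewrite -ltnS; apply: leq_trans lt_xk; rewrite ltnS; apply: leq_trans le_yx.
  rewrite -/y yE msizeM // (mpolySpred _ w0) addnS /=.
  exact: (leq_add a1 (leqnn _)).
exists (p * 'X + (x@_0%MM)%:P); rewrite rmorphD rmorphM /= map_polyX map_polyC.
by rewrite hornerMXaddC -pE mulrC -yE subrK.
Qed.
End Rentschler.

(** * The ideal of coefficients *)

Section FaithfullyFlatDescent.
Variables (R : idomainType) (B : comAlgType R) (n : nat).
Hypotheses (noeR : noetherian R) (fibB : affine_fibration n B).

(** Homogenize with an extra unknown z, equal to 1 in the given solution. [flat_system] writes it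
    through solutions over R; their z-coordinates generate the unit ideal by [fibration_unimodular],
    so a combination of them over R has z = 1. *)
Lemma fibration_descent k (a c : 'I_k -> R) (d : R) (x : B) (y : 'I_k -> B) :
  (forall i, a i *: x + (c i)%:A = d *: y i) ->
  exists (x0 : R) (y0 : 'I_k -> R), forall i, a i * x0 + c i = d * y0 i.
Proof.
move=> E; have [_ flatB _] := fibB.
pose A : 'M[R]_(1 + (1 + k), k) := col_mx (\row_j a j) (col_mx (\row_j c j) (- d%:M)).
pose ix : 'I_(1 + (1 + k)) := lshift _ 0.
pose iz : 'I_(1 + (1 + k)) := rshift 1 (lshift _ 0).
pose iy (j : 'I_k) : 'I_(1 + (1 + k)) := rshift 1 (rshift 1 j).
pose b (i : 'I_(1 + (1 + k))) : B := match split i with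
  | inl _ => x | inr j => match split j with inl _ => 1 | inr j => y j end end.
have sumA (V : lmodType R) (w : 'I_(1 + (1 + k)) -> V) j :
    \sum_i A i j *: w i = a j *: w ix + c j *: w iz - d *: w (iy j).
  rewrite big_split_ord big_ord1 big_split_ord big_ord1 /= addrA.
  congr (_ + _ + _); rewrite /A ?col_mxEu ?col_mxEd ?col_mxEu ?mxE //.
  rewrite (bigD1 j) //= !col_mxEd !mxE eqxx mulr1n scaleNr big1 ?addr0 // => i ij.
  by rewrite !col_mxEd !mxE (negPf ij) mulr0n oppr0 scale0r.
have bA j : \sum_i A i j *: b i = 0.
  rewrite sumA /b (unsplitK (inl _)) (unsplitK (inr _)) (unsplitK (inl _)).
  by rewrite !(unsplitK (inr _)) E subrr.
have [l [z [v [vA bE]]]] := flat_system flatB bA.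
have vE t j : a j * v t 0 ix + c j * v t 0 iz = d * v t 0 (iy j).
  apply/subr0_eq; rewrite -(sumA R^o (fun i => v t 0 i)).
  have /rowP/(_ j) := vA t; rewrite !mxE => E0; rewrite -[RHS]E0.
  by apply: eq_bigr => i _; rewrite mulrC.
have [t tE] : exists t : 'I_l -> R, \sum_i t i * v i 0 iz = 1.
  apply: (fibration_unimodular fibB (c := z) noeR).
  by rewrite -(bE iz) /b (unsplitK (inr _)) (unsplitK (inl _)).
exists (\sum_i t i * v i 0 ix), (fun j => \sum_i t i * v i 0 (iy j)) => j.
rewrite -[c j in LHS]mulr1 -tE !mulr_sumr -big_split; apply: eq_bigr => i _ /=.
by rewrite mulrCA [c j * _]mulrCA -mulrDr vE mulrCA.
Qed.
End FaithfullyFlatDescent.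

Section FractionField.
Variables (R : idomainType) (K : fieldType) (tau : {rmorphism R -> K}).
Hypothesis tau_eq0 : forall a, (tau a == 0) = (a == 0).
Hypothesis tau_frac : forall x, exists a s, s != 0 /\ x = tau a / tau s.

Lemma tau_inj : injective tau.
Proof.
by move=> a b ab; apply/eqP; rewrite -subr_eq0 -tau_eq0 rmorphB ab subrr.
Qed.

Lemma common_denominator (I : finType) (x : I -> K) :
  exists d (a : I -> R), d != 0 /\ forall i, x i = tau (a i) / tau d.
Proof.
have [a aP] := choice (fun i => tau_frac (x i)); have [s sP] := choice aP.
exists (\prod_i s i), (fun i => a i * \prod_(j | j != i) s j).
split=> [|i]; first by apply/prodf_neq0 => i _; case: (sP i).
have [si ->] := sP i; rewrite [X in _ = _ / tau X](bigD1 i) //= !rmorphM.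
have nz : tau (\prod_(j | j != i) s j) != 0.
  by rewrite tau_eq0; apply/prodf_neq0 => j _; case: (sP j).
by rewrite -mulf_div divff ?mulr1.
Qed.
End FractionField.

Section Core.
Variables (R : idomainType) (noeR : noetherian R) (norR : normal_domain R).
Variables (B : comAlgType R) (n : nat) (fibB : affine_fibration n B).
Variables (K : fieldType) (tau : {rmorphism R -> K}).
Hypothesis tau_eq0 : forall a, (tau a == 0) = (a == 0).
Hypothesis tau_frac : forall x, exists a s, s != 0 /\ x = tau a / tau s.
Variables (iota : {rmorphism B -> {mpoly K[2]}}).
Hypothesis iotaZ : forall r b, iota (r *: b) = tau r *: iota b.
Hypothesis iota_inj : injective iota.
Local Notation KXY := {mpoly K[2]}.
Local Notation ev p f := (map_poly (@mpolyC 2 K) p).[f].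

Definition inB (x : KXY) := exists b, x = iota b.

Lemma inBD x y : inB x -> inB y -> inB (x + y).
Proof. by move=> [b ->] [c ->]; exists (b + c); rewrite rmorphD. Qed.
Lemma inBM x y : inB x -> inB y -> inB (x * y).
Proof. by move=> [b ->] [c ->]; exists (b * c); rewrite rmorphM. Qed.
Lemma inBZ r x : inB x -> inB (tau r *: x).
Proof. by move=> [b ->]; exists (r *: b); rewrite iotaZ. Qed.
Lemma inB0 : inB 0. Proof. by exists 0; rewrite rmorph0. Qed.
Lemma inB1 : inB 1. Proof. by exists 1; rewrite rmorph1. Qed.
Lemma inBC r : inB (tau r)%:MP.
Proof. by rewrite -[_%:MP]mulr1 mul_mpolyC; apply/inBZ/inB1. Qed.
Lemma inB_sum (I : finType) (x : I -> KXY) : (forall i, inB (x i)) -> inB (\sum_i x i).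
Proof. by move=> xP; apply: big_ind => //; [exact: inB0 | exact: inBD]. Qed.

Lemma scale_mpolyI (c : K) (x y : KXY) : c != 0 -> c *: x = c *: y -> x = y.
Proof. by move=> c0; rewrite -!mul_mpolyC; apply: mulfI; rewrite mpolyC_eq0. Qed.

(** For c = a/s, the equation a = s y is solvable in B, hence in R by descent. *)
Lemma inB_const (c : K) : inB c%:MP -> exists r, c = tau r.
Proof.
move=> [b bE]; have [a [s [s0 cE]]] := tau_frac c.
have ts : tau s != 0 by rewrite tau_eq0.
have [|x0 [y0 E]] := @fibration_descent _ _ _ noeR fibB 1 (fun=> 0) (fun=> a) s
  0 (fun=> b).
  move=> _; rewrite scale0r add0r; apply: iota_inj.
  rewrite !iotaZ rmorph1 -bE cE -mul_mpolyC mulr1 -mul_mpolyC -mpolyCM.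
  by rewrite mulrC divfK.
exists (y0 0); have := E 0; rewrite mul0r add0r => aE.
by rewrite cE aE rmorphM mulrC mulKf.
Qed.

Lemma inB_local_global (a : R) (x : KXY) : a != 0 -> inB (tau a *: x) ->
  (forall P : prime_idealr R, divisorial_prime P ->
     exists2 s, s \notin P & inB (tau s *: x)) ->
  inB x.
Proof.
move=> a0 [b bE] loc; have [_ flatB _] := fibB.
have ta : tau a != 0 by rewrite tau_eq0.
have [|b' b'E] := flat_local_global noeR flatB (b := b) a0.
  move=> P /loc[s Ps [b' b'E]]; exists s, b'; split=> //; apply: iota_inj.
  by rewrite !iotaZ -bE -b'E !scalerA mulrC.
by exists b'; apply: (scale_mpolyI ta); rewrite bE b'E iotaZ.
Qed.

(** * Coefficients of kernel elements for a normalized generator *)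

Section Normalized.
Variable f : KXY.
(** The three conditions met by [kernel_generator_normalize]: the generator is already translated,
    its admissible coefficients lie in R, and they are not all zero. *)
Hypothesis fsplit : forall a b : K, inB (a *: f + b%:MP) -> inB (a *: f).
Hypothesis fint : forall a : K, inB (a *: f) -> exists r, a = tau r.
Hypothesis fnz : exists2 r, r != 0 & inB (tau r *: f).

Definition coef_ideal : {pred R} := fun r => `[< inB (tau r *: f) >].
Local Notation I := coef_ideal.

Lemma coef_idealP r : reflect (inB (tau r *: f)) (r \in I).
Proof. exact: asboolP. Qed.

Lemma coef_ideal_ideal : ideal I.
Proof.
split=> [|a u v /coef_idealP Iu /coef_idealP Iv]; apply/coef_idealP.
  by rewrite rmorph0 scale0r; exact: inB0.
by rewrite rmorphD rmorphM scalerDl -scalerA; apply: inBD => //; exact: inBZ.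
Qed.

Lemma coef_ideal_pow m u : u \in ideal_pow I m -> inB (tau u *: f ^+ m).
Proof.
elim: m u => [|m IHm] u; first by move=> _; rewrite expr0; apply/inBZ/inB1.
move=> /asboolP[k [a [g [gP ->]]]]; rewrite rmorph_sum scaler_suml.
apply: inB_sum => i; have [x [y [/coef_idealP Ix Iy ->]]] := gP i.
rewrite !rmorphM -scalerA; apply: inBZ; rewrite -scalerA exprS.
by rewrite scalerAr scalerAl; apply: inBM => //; exact: IHm.
Qed.

(** Let P = (I : x) and b = d f in B. As x b is not in dB, [flat_divisorial] gives a divisorial
    prime containing the r with r x b in dB, that is P. It has height one and P contains [d], so the
    two primes agree. *)
Lemma coef_ideal_associated (P : prime_idealr R) :
  associated_prime I P -> divisorial_prime P.
Proof.
move=> [x xP]; have [d d0 [b bE]] := fnz; have td : tau d != 0 by rewrite tau_eq0.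
have nIx : x \notin I by rewrite -[x]mul1r -xP idealr1.
have [_ flatB _] := fibB.
have [|P' dP' sP'] := flat_divisorial noeR flatB (b := x *: b) d0.
  move=> b' E; case/negP: nIx; apply/coef_idealP; exists b'.
  apply: (scale_mpolyI td); rewrite -[RHS]iotaZ -E iotaZ -bE !scalerA; by rewrite mulrC.
have PP' : {subset P <= P'}.
  move=> r; rewrite xP => /coef_idealP[b' b'E]; apply: (sP' r b').
  apply: iota_inj; rewrite !iotaZ -bE -b'E !scalerA rmorphM; congr (_ *: _).
  ring.
have Pd : d \in P.
  by rewrite xP mulrC; apply: idealMl coef_ideal_ideal _; apply/coef_idealP; exists b.
have P'P : {subset P' <= P}.
  exact: (height_one_minimal (divisorial_height_one noeR norR dP') d0 Pd PP').
have [a a0 [y yP]] := dP'; exists a => //; exists y => r; rewrite -yP.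
by apply/idP/idP => [/PP'|/P'P].
Qed.

Lemma coef_ideal_unmixed : unmixed_height_one I.
Proof.
split; first exact: coef_ideal_ideal.
by move=> P /coef_ideal_associated; exact: divisorial_height_one.
Qed.

(** Tested at each divisorial prime: if it is associated to I, the symbolic power provides the
    multiplier; if not, it does not contain I, and the m-th power of an element of I outside it
    serves. *)
Lemma symbolic_inB m r : r \in symbolic_pow I m -> inB (tau r *: f ^+ m).
Proof.
move=> /asboolP Ir; have [d d0 /coef_idealP Id] := fnz.
have Xin (P : prime_idealr R) t : t \in I -> t ^+ m \in ideal_pow I m.
  move=> It; elim: m {Ir} => [|k IHk] //; rewrite exprS; apply: ideal_gen_in.
  by exists t, (t ^+ k).
have pow_in t : t \in I -> t ^+ m * r \in ideal_pow I m.
  move=> It; rewrite mulrC; apply: idealMl; first exact: ideal_pow_ideal.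
  exact: (Xin (zero_prime R)).
apply: (@inB_local_global (d ^+ m)); first by rewrite expf_neq0.
  by rewrite scalerA -rmorphM; apply/coef_ideal_pow/pow_in.
move=> P dP; suff [s Ps sr] : exists2 s, s \notin P & s * r \in ideal_pow I m.
  by exists s => //; rewrite scalerA -rmorphM; exact: coef_ideal_pow.
have [aP|naP] := pselect (associated_prime I P).
  by have /loc_idealP[|s] := Ir P aP; [exact: ideal_pow_ideal | exists s].
have [t It Pt] : exists2 t, t \in I & t \notin P.
  apply: contrapT => no; apply: naP.
  apply: (height_one_associated noeR coef_ideal_ideal _ d0 Id).
    exact: divisorial_height_one.
  by move=> t It; apply: contrapT => /negP Pt; apply: no; exists t.
exists (t ^+ m); last exact: pow_in.
elim: m {Ir Xin pow_in} => [|k IHk]; first by rewrite expr0 idealr1.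
by rewrite exprS prime_idealrM negb_or Pt.
Qed.

(* If some [p_i / a^i] were not integral at [P], reduction modulo [P] of a *)
(* suitable multiple of [p(f)] would make [a f] algebraic over [k(P)], hence  *)
(* constant, against the choice of [a] as a local generator of [I].          *)
Lemma coef_local (P : prime_idealr R) (a : R) (p : {poly K}) :
  divisorial_prime P -> a \in I -> (forall i, i \in I -> ldvd P a i) ->
  inB (ev p f) -> forall i, exists s r, s \notin P /\ tau s * p`_i = tau r * tau a ^+ i.
Proof.
move=> dP Ia aP [g gE] i; have [d d0 /coef_idealP Id] := fnz.
have a0 : a != 0.
  have [s [r [Ps E]]] := aP _ Id; apply: contraNneq Ps => a0.
  move/eqP: E; rewrite a0 mulr0 mulf_eq0 (negPf d0) orbF => /eqP->.
  exact: idealr0.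
have ta : tau a != 0 by rewrite tau_eq0.
have tai k : tau a ^+ k != 0 by rewrite expf_neq0.
have /coef_idealP[b bE] := Ia.
have [|lt_ip] := leqP (size p) i.
  move=> le; exists 1, 0; rewrite idealr1 rmorph0 mul0r nth_default ?mulr0 //.
(* The h_j / c are the coefficients of p(f) as a polynomial in a f. The claim is that [c] divides
   each h_j at [P]. *)
have [c [h [c0 hE]]] := common_denominator tau_eq0 tau_frac
  (fun j : 'I_(size p) => p`_j / tau a ^+ j).
have tc : tau c != 0 by rewrite tau_eq0.
have hE' j : tau (h j) * tau a ^+ j = tau c * p`_j.
  move: (hE j) => /(canLR (divfK tc))/= <-.
  by rewrite mulrAC divfK // mulrC.
suff div : forall j, ldvd P c (h j).
  have [s [r [Ps sE]]] := div (Ordinal lt_ip); exists s, r; split=> //.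
  apply: (mulfI tc); rewrite mulrCA -(hE' (Ordinal lt_ip)) mulrA -rmorphM sE.
  by rewrite rmorphM mulrAC mulrC.
pose G (t : 'I_(size p).+1) := if unlift ord0 t is Some j then h j else c.
have [t0 t0P] := ldvd_least noeR norR dP G.
have Glift j : G (lift ord0 j) = h j by rewrite /G liftK.
have G0 : G ord0 = c by rewrite /G unlift_none.
move=> j0; case: (unliftP ord0 t0) t0P => [m ->|-> t0P];
  last by rewrite -[h j0]Glift -{1}G0.
rewrite Glift => mP; have [cm|ncm] := pselect (ldvd P c (h m)).
  by apply: ldvd_trans cm _; rewrite -[h j0]Glift.
exfalso; have hm0 : h m != 0.
  by apply: contra_not_neq ncm => ->; exists 1, 0; rewrite idealr1 mulr0 mul0r.
(* If h_m has the least value at [P] and lies strictly below [c], dividing by it turns c p(f) into a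
   relation for [b] whose m-th coefficient is outside [P] and whose right side is in PB. *)
have [sc [rc [Psc scE]]] : ldvd P (h m) c by rewrite -G0.
have Prc : rc \in P.
  by apply: contrapT => /negP Prc; apply: ncm; exists rc, sc.
have hP j : ldvd P (h m) (h j) by rewrite -[h j]Glift.
have [s sP] := choice hP; have [r rP] := choice sP.
pose S := sc * \prod_j s j.
have PS : S \notin P.
  rewrite prime_idealrM negb_or Psc /=.
  apply: (big_ind (fun z => z \notin P)) => [|y z Py Pz|j _].
  - by rewrite idealr1.
  - by rewrite prime_idealrM negb_or Py Pz.
  - by case: (rP j).
pose q j := sc * r j * \prod_(k | k != j) s k.
have qE j : S * h j = q j * h m.
  rewrite /S /q (bigD1 j) //=; have [_ sE] := rP j.
  transitivity (sc * (s j * h j) * \prod_(k | k != j) s k); first by ring.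
  by rewrite sE; ring.
have qm : q m \notin P by rewrite -(mulIf hm0 (qE m)).
pose rc' := rc * \prod_j s j.
have rcE : S * c = rc' * h m.
  transitivity (sc * c * \prod_j s j); first by rewrite /S; ring.
  by rewrite scE /rc'; ring.
have sumE : \sum_j q j *: b ^+ j = rc' *: g.
  have thm : tau (h m) != 0 by rewrite tau_eq0.
  apply: iota_inj; apply: (scale_mpolyI thm).
  rewrite [in RHS]iotaZ scalerA -rmorphM mulrC -rcE -gE.
  rewrite (@horner_coef_wide _ (size p)); last exact: size_poly.
  rewrite rmorph_sum !scaler_sumr; apply: eq_bigr => j _.
  rewrite iotaZ scalerA -rmorphM mulrC -qE rmorphXn /= -bE coef_map /=.
  rewrite exprZn mul_mpolyC !scalerA; congr (_ *: _).
  by rewrite !rmorphM -mulrA hE' mulrA.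
have [|u [v [Pu PE]]] := @fibration_algebraic R B n fibB P b _ q _ (ex_intro _ m qm).
  by rewrite sumE; apply: in_extended1; rewrite /rc' mulrC idealMr.
have [pi [w [Ppi Pw wP]]] := divisorial_uniformizer noeR norR dP.
have pi0 : pi != 0.
  have [x Px x0] := divisorial_prime_neq0 dP; have [z zE] := wP _ Px.
  apply: contraNneq x0 => pi0; move/eqP: zE; rewrite pi0 mulr0 mulf_eq0.
  by case/orP => // /eqP w0; rewrite w0 idealr0 in Pw.
have tpi : tau pi != 0 by rewrite tau_eq0.
have [b' b'E] : exists b', w *: (u *: b - v%:A) = pi *: b'.
  have [l [x [y [xP ->]]]] := PE; have [z zE] := choice (fun j => wP _ (xP j)).
  exists (\sum_j z j *: y j); rewrite !scaler_sumr; apply: eq_bigr => j _.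
  by rewrite !scalerA zE mulrC.
(* Up to a constant, which [fsplit] removes, e f is in B. So [e] belongs to I while its value at [P]
   is smaller than that of [a]. *)
pose e := tau (w * u * a) / tau pi.
have te : tau pi * e = tau (w * u * a) by rewrite /e mulrC divfK.
pose e' := tau (w * v) / tau pi.
have te' : tau pi * e' = tau (w * v) by rewrite /e' mulrC divfK.
have : inB (e *: f).
  apply: (@fsplit _ (- e')); exists b'.
  apply: (scale_mpolyI tpi); rewrite -[RHS]iotaZ -b'E scalerDr scalerA te.
  have -> : tau pi *: (- e')%:MP_[2] = - (tau (w * v))%:MP.
    by rewrite -mul_mpolyC -mpolyCM mulrN te' mpolyCN.
  rewrite iotaZ rmorphB !iotaZ rmorph1 -bE scalerBr !scalerA !rmorphM.
  congr (_ - _); first by rewrite mulrA.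
  by rewrite -rmorphM -[RHS]mul_mpolyC mulr1.
move=> Ie; have [i0 i0E] := fint Ie.
have Ii0 : i0 \in I by apply/coef_idealP; rewrite -i0E.
have wua : w * u * a = pi * i0.
  by apply: (tau_inj tau_eq0); rewrite [RHS]rmorphM -i0E te.
have [s' [r' [Ps' s'E]]] := aP _ Ii0.
have : s' * (w * u) = pi * r'.
  apply: (mulIf a0); transitivity (s' * (w * u * a)); first by ring.
  rewrite wua; transitivity (pi * (s' * i0)); first by ring.
  by rewrite s'E; ring.
move=> E; have : s' * (w * u) \in P by rewrite E mulrC idealMr.
by rewrite !prime_idealrM (negPf Ps') (negPf Pw) (negPf Pu).
Qed.

(** By [coef_local] the i-th coefficient lies in a^i R_P at every divisorial P. These conditions put
    it in R, and at the primes associated to I they are those defining the symbolic power. *)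
Lemma coef_symbolic (p : {poly K}) : inB (ev p f) ->
  forall i, exists2 r, r \in symbolic_pow I i & p`_i = tau r.
Proof.
move=> Bp i.
have loc (P : prime_idealr R) : divisorial_prime P ->
    exists a s r, [/\ a \in I, s \notin P & tau s * p`_i = tau r * tau a ^+ i].
  move=> dP; have [a Ia aP] := ideal_local_gen noeR norR dP coef_ideal_ideal.
  by have [s [r [Ps sE]]] := coef_local dP Ia aP Bp i; exists a, s, r.
have [x [s [s0 pE]]] := tau_frac p`_i; have ts : tau s != 0 by rewrite tau_eq0.
have [r rE] : exists r, p`_i = tau r.
  have /asboolP[r xE] : x \in principal s.
    apply: contrapT => /negP nx; have [P dP sP] := divisorial_above noeR s0 nx.
    have [a [t [r [_ Pt tE]]]] := loc P dP; case/negP: Pt; apply: sP.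
    rewrite in_colon; apply/asboolP; exists (r * a ^+ i).
    apply: (tau_inj tau_eq0); rewrite !rmorphM rmorphXn /= -tE pE.
    by rewrite -mulrA divfK.
  by exists r; rewrite pE xE rmorphM mulfK.
exists r => //; apply/asboolP=> P /coef_ideal_associated/loc[a [t [q [Ia Pt tE]]]].
apply/loc_idealP; first exact: ideal_pow_ideal.
exists t => //; have -> : t * r = q * a ^+ i.
  by apply: (tau_inj tau_eq0); rewrite !rmorphM rmorphXn /= -rE.
apply: idealMl; first exact: ideal_pow_ideal.
elim: (i) => [|k IHk] //; rewrite exprS; apply: ideal_gen_in.
by exists a, (a ^+ k).
Qed.

Lemma kernel_rees (p : {poly K}) :
  inB (ev p f) <-> exists2 q, q \in symbolic_rees I & p = map_poly tau q.
Proof.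
split=> [Bp|[q /asboolP Iq ->]].
  have exr i : exists r, r \in symbolic_pow I i /\ p`_i = tau r.
    by have [r] := coef_symbolic Bp i; exists r.
  have [r rP] := choice exr; have rI i := (rP i).1; have rE i := (rP i).2.
  exists (\poly_(i < size p) r i).
    apply/asboolP=> i; rewrite coef_poly; case: ifP => // _.
    by case: (symbolic_pow_ideal I i).
  apply/polyP=> i; rewrite coef_map coef_poly; case: ltnP => [_|le]; first exact: rE.
  by rewrite nth_default // [RHS]rmorph0.
rewrite horner_coef; apply: inB_sum => i; rewrite !coef_map /= mul_mpolyC.
exact/symbolic_inB/Iq.
Qed.

End Normalized.
End Core.

(** * Normalizing a generator of the kernel *)

Lemma msize_mderiv (R : nzRingType) n (i : 'I_n) (p : {mpoly R[n]}) :
  (msize p^`M(i) <= (msize p).-1)%N.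
Proof.
rewrite [X in (X <= _)%N]msizeE; apply/bigmax_leqP_seq => k.
rewrite mcoeff_msupp => kp _; have : (k + U_(i))%MM \in msupp p.
  rewrite mcoeff_msupp; apply: contraNneq kp => kp.
  by rewrite mcoeff_deriv kp mul0rn.
by move=> /msize_mdeg_lt; rewrite mdegD mdeg1 addn1; case: (msize p).
Qed.

Section PartialDerivative.
Variable K : fieldType.
Hypothesis charK : forall n, (0 < n)%N -> n%:R != 0 :> K.

Lemma mderiv_descent (h : {mpoly K[2]}) : (1 < msize h)%N ->
  exists i, h^`M(i) != 0 /\ (msize h^`M(i) < msize h)%N.
Proof.
move=> h1; have [m mh m0] : exists2 m, m \in msupp h & m != 0%MM.
  apply: contrapT => no; move: h1; rewrite ltnNge msizeE => /negP; apply.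
  apply/bigmax_leqP_seq => m mh _; rewrite ltnS leqn0 mdeg_eq0.
  by apply: contrapT => /negP m0; apply: no; exists m.
have [i mi] : exists i, (0 < m i)%N.
  apply: contrapT => no; case/eqP: m0; apply/mnmP=> i; rewrite mnm0E.
  by apply/eqP; rewrite eqn0Ngt; apply/negP=> mi; apply: no; exists i.
exists i; split.
  apply/eqP=> /mpolyP/(_ (m - U_(i))%MM); rewrite mcoeff_deriv mcoeff0.
  rewrite submK; last by apply/mnm_lepP => k; rewrite mnm1E; case: eqP => // <-.
  move=> /eqP; rewrite -mulr_natr mulf_eq0 (negPf (charK (ltn0Sn _))) orbF.
  by rewrite mcoeff_eq0 mh.
apply: (leq_ltn_trans (msize_mderiv _ _)); by rewrite prednK // ltnW.
Qed.
End PartialDerivative.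

Section Normalization.
Variables (R : idomainType) (noeR : noetherian R).
Variables (B : comAlgType R) (n : nat) (fibB : affine_fibration n B).
Variables (K : fieldType) (tau : {rmorphism R -> K}).
Hypothesis charK : forall n, (0 < n)%N -> n%:R != 0 :> K.
Hypothesis tau_eq0 : forall a, (tau a == 0) = (a == 0).
Hypothesis tau_frac : forall x, exists a s, s != 0 /\ x = tau a / tau s.
Variables (iota : {rmorphism B -> {mpoly K[2]}}).
Hypothesis iotaZ : forall r b, iota (r *: b) = tau r *: iota b.
Hypothesis iota_inj : injective iota.
Hypothesis iota_frac : forall x, exists s b, s != 0 /\ iota b = tau s *: x.
Local Notation KXY := {mpoly K[2]}.
Local Notation inB := (inB iota).

Lemma inB_mderiv : exists2 d, d != 0 & forall i x, inB x -> inB (tau d *: x^`M(i)).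
Proof.
have [[k [g gP]] _ _] := fibB.
have dP (t : 'I_2 * 'I_k) : exists d, d != 0 /\ inB (tau d *: (iota (g t.2))^`M(t.1)).
  have [s [b [s0 bE]]] := iota_frac (iota (g t.2))^`M(t.1).
  by exists s; split=> //; exists b.
have [d dE] := choice dP; exists (\prod_t d t).
  by apply/prodf_neq0 => t _; case: (dE t).
move=> i _ [b ->]; set e := \prod_t d t.
pose Q (b : B) := inB (tau e *: (iota b)^`M(i)).
have QD x y : Q x -> Q y -> Q (x + y).
  by rewrite /Q rmorphD mderivD scalerDr; exact: (inBD (iota := iota)).
have QM x y : Q x -> Q y -> Q (x * y).
  rewrite /Q rmorphM mderivM scalerDr scalerAl scalerAr => Qx Qy.
  by apply: inBD; apply: inBM => //; [exists y | exists x].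
have QC r : Q r%:A.
  rewrite /Q iotaZ rmorph1 -[tau r *: 1]mul_mpolyC mulr1 mderivC scaler0; exact: inB0.
have Qg j : Q (g j).
  rewrite /Q /e (bigD1 (i, j)) //= mulrC rmorphM -scalerA.
  by apply: (inBZ iotaZ); case: (dE (i, j)).
have Q1 : Q 1 by rewrite -[1]scale1r; exact: QC.
have [p ->] := gP b; rewrite -/(Q _) /mmap.
apply: (big_ind Q _ QD) => [|m _]; first by rewrite -[0](scale0r 1); exact: QC.
apply: (QM _ _); first exact: QC.
apply: (big_ind Q Q1 QM) => j _.
by elim: (m j) => [|l IHl]; rewrite ?expr0 // exprS; apply: (QM _ _).
Qed.

(** Differentiate [h] down to a non-zero constant, each derivative costing a factor [d]; there
    [inB_const] applies. This bound is what makes J finitely generated. *)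
Lemma inB_bounded (h : KXY) : h != 0 ->
  exists2 e, e != 0 & forall a, inB (a *: h) -> exists r, a * tau e = tau r.
Proof.
have [d d0 dP] := inB_mderiv.
have [k] := ubnP (msize h); elim: k h => // k IHk h lt_hk h0.
have [h1|h1] := leqP (msize h) 1.
  have hE := msize1_polyC h1; set c := h@_0%MM in hE.
  have c0 : c != 0 by apply: contraNneq h0 => c0; rewrite hE c0.
  have [x [s [s0 cE]]] := tau_frac c.
  have x0 : x != 0 by apply: contraNneq c0 => x0; rewrite cE x0 rmorph0 mul0r.
  exists x => // a; rewrite hE -mul_mpolyC -mpolyCM => /(inB_const noeR fibB
    tau_eq0 tau_frac iotaZ iota_inj)[r rE].
  exists (r * s); rewrite rmorphM -rE cE mulrA divfK //.
  by rewrite tau_eq0.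
have [i [hi lt_hi]] := mderiv_descent charK h1.
have [|e e0 eP] := IHk h^`M(i) _ hi; first exact: leq_trans lt_hi _.
exists (d * e); first exact: mulf_neq0.
move=> a /(dP i); rewrite mderivZ scalerA => /eP[r rE]; exists r.
by rewrite -rE rmorphM mulrCA mulrA.
Qed.

(* The equations for the constant translating [f] are solved over [B] by [f] *)
(* itself, hence over [R] by faithfully flat descent.                         *)
Lemma kernel_generator_normalize (f : KXY) : (1 < msize f)%N ->
  exists u v : K, let g := u *: f + v%:MP in
    [/\ u != 0, forall a b : K, inB (a *: g + b%:MP) -> inB (a *: g),
        forall a : K, inB (a *: g) -> exists r, a = tau r
      & exists2 r, r != 0 & inB (tau r *: g)].
Proof.
move=> f1; have [s0 [b0 [s0n b0E]]] := iota_frac f.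
have ts0 : tau s0 != 0 by rewrite tau_eq0.
have [i [fi _]] := mderiv_descent charK f1.
have [d d0 dP] := inB_mderiv; have td : tau d != 0 by rewrite tau_eq0.
pose f0 := iota b0; have f0i : f0^`M(i) != 0.
  by rewrite /f0 b0E mderivZ -mul_mpolyC mulf_neq0 // mpolyC_eq0.
have [e' e'0 e'P] := inB_bounded f0i.
(* One differentiation discards the unknown constant [c]; the derivative of [f0] being non-zero,
   [inB_bounded] applies to it. *)
have [e e0 bound] : exists2 e, e != 0 &
    forall a c, inB (a *: f0 + c%:MP) -> exists r, a * tau e = tau r.
  exists (d * e'); first exact: mulf_neq0.
  move=> a c /(dP i); rewrite mderivD mderivC addr0 mderivZ scalerA => /e'P[r rE].
  by exists r; rewrite -rE rmorphM mulrCA mulrA.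
have te : tau e != 0 by rewrite tau_eq0.
(* The fractional ideal of admissible coefficients of [f0] is J / e; its numerators form an ideal of
   R. *)
pose J : {pred R} := fun r => `[< exists c, inB ((tau r / tau e) *: f0 + c%:MP) >].
have idJ : ideal J.
  split=> [|a x y /asboolP[c Jx] /asboolP[c' Jy]]; apply/asboolP.
    by exists 0; rewrite rmorph0 mul0r scale0r add0r; exact: inB0.
  exists (tau a * c + c'); rewrite rmorphD rmorphM mulrDl scalerDl mpolyCD addrACA.
  apply: inBD => //; rewrite -mulrA -scalerA mpolyCM mul_mpolyC -scalerDr.
  exact: (inBZ iotaZ).
have [k [g gJ]] := noeR idJ.
have gE j : exists c, inB ((tau (g j) / tau e) *: f0 + c%:MP).
  have : g j \in J by rewrite gJ ideal_gen_in //; exists j.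
  by move/asboolP.
have [c cP] := choice gE; have [y yP] := choice cP.
have [D [C [D0 CE]]] := common_denominator tau_eq0 tau_frac c.
have tD : tau D != 0 by rewrite tau_eq0.
(* These are the equations (g_j / e) x + C_j / D = y_j with denominators cleared; [f0] solves them
   in B. *)
have [|x0 [y0 xyE]] := @fibration_descent R B n noeR fibB k
    (fun j => g j * D) (fun j => C j * e) (e * D) b0 y.
  move=> j; apply: iota_inj; rewrite rmorphD !iotaZ rmorph1 -yP -/f0 scalerDr scalerA.
  congr (_ + _); first by congr (_ *: _); rewrite !rmorphM; field; rewrite te.
  rewrite -[_ *: 1]mul_mpolyC mulr1 -[RHS]mul_mpolyC -mpolyCM CE; congr _%:MP.
  by rewrite !rmorphM; field; rewrite tD.
pose f1' := f0 - (tau x0)%:MP.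
have Jf1 r : r \in J -> inB ((tau r / tau e) *: f1').
  rewrite gJ => /asboolP[l [a [h [hP ->]]]].
  rewrite rmorph_sum mulr_suml scaler_suml; apply: (inB_sum (iota := iota)) => t.
  have [j ->] := hP t; rewrite rmorphM -mulrA -scalerA; apply: (inBZ iotaZ).
  have -> : (tau (g j) / tau e) *: f1' = iota (y j) - (tau (y0 j))%:MP.
    rewrite -yP /f1' scalerBr -addrA; congr (_ + _).
    rewrite -[_ *: _%:MP]mul_mpolyC -mpolyCM -mpolyCB -mpolyCN; congr _%:MP.
    apply: (mulfI te); apply: (mulfI tD); rewrite CE.
    have := congr1 tau (xyE j); rewrite rmorphD !rmorphM => E.
    transitivity (- (tau (g j) * tau D * tau x0)); first by field.
    transitivity (tau (C j) * tau e - tau e * tau D * tau (y0 j)); last by field.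
    by rewrite -E; ring.
  by apply: inBD; [exists (y j) | rewrite -mpolyCN -rmorphN; exact: inBC].
have Ja a v : inB (a *: f0 + v%:MP) -> exists2 r, a = tau r / tau e & r \in J.
  move=> Ba; have [r rE] := bound _ _ Ba; exists r; first by rewrite -rE mulfK.
  by apply/asboolP; exists v; rewrite -rE mulfK.
(* The new generator is (f0 - x0) / e: the translation makes the constants disappear, and the
   division by e replaces J / e by J. *)
exists (tau s0 / tau e), (- (tau x0 / tau e)).
have gE' a b : a *: ((tau s0 / tau e) *: f + (- (tau x0 / tau e))%:MP) + b%:MP =
    (a / tau e) *: f1' + b%:MP.
  rewrite /f1' /f0 b0E scalerDr scalerBr !scalerA; congr (_ + _ + _).
    by congr (_ *: _); field.
  rewrite -mul_mpolyC -mpolyCM -mul_mpolyC -mpolyCM -mpolyCN; congr _%:MP; by field.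
have gE0 a : a *: ((tau s0 / tau e) *: f + (- (tau x0 / tau e))%:MP) = (a / tau
  e) *: f1'.
  by have := gE' a 0; rewrite !addr0.
move=> G; rewrite /G; split.
- by rewrite mulf_neq0 ?invr_eq0.
- move=> a b; rewrite gE' gE0 => Ba.
  have [|r -> Jr] := Ja (a / tau e) (b - (a / tau e) * tau x0); last exact: Jf1.
  suff -> : (a / tau e) *: f0 + (b - a / tau e * tau x0)%:MP = (a / tau e) *:
    f1' + b%:MP by [].
  rewrite /f1' scalerBr -addrA; congr (_ + _).
  by rewrite mpolyCB mpolyCM mul_mpolyC addrC.
- move=> a; rewrite gE0 => Ba.
  have [|r aE _] := Ja (a / tau e) (- ((a / tau e) * tau x0)).
    suff -> : (a / tau e) *: f0 + (- (a / tau e * tau x0))%:MP = (a / tau e) *: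
      f1' by [].
    by rewrite /f1' scalerBr mpolyCN mpolyCM mul_mpolyC.
  by exists r; apply: (mulIf (invr_neq0 te)).
- exists e => //; rewrite gE0 divff // scale1r /f1'.
  by apply: inBD; [exists b0 | rewrite -mpolyCN -rmorphN; exact: inBC].
Qed.

End Normalization.

(** * The polynomial ring as an affine fibration *)

Section PolynomialTensor.
Variables (R : comNzRingType) (n : nat).
Local Notation C := {mpoly R[n]}.

Section Coefficients.
Variable N : lmodType R.

Definition tensor_coef (m : 'X_{1..n}) : tensor C N -> N :=
  tensor_lift (fun (p : C) (v : N) => p@_m *: v).

Lemma tensor_coef_bal m : balanced (fun (p : C) (v : N) => p@_m *: v).
Proof.
split=> [p q v|p v w|a p v]; first by rewrite mcoeffD scalerDl.
  by rewrite scalerDr.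
by rewrite mcoeffZ mulrC scalerA.
Qed.

Lemma tensor_coef_tens m p v : tensor_coef m (tens p v) = p@_m *: v.
Proof. exact/tensor_lift_tens/tensor_coef_bal. Qed.

Lemma tensor_coefD m x y : tensor_coef m (x + y) = tensor_coef m x + tensor_coef m y.
Proof. exact/tensor_liftD/tensor_coef_bal. Qed.

Lemma tensor_coef0 m : tensor_coef m 0 = 0.
Proof. exact/tensor_lift0/tensor_coef_bal. Qed.

(** The monomials form a basis of C. The expansion is stated for all large [k] so that two tensors
    can be expanded over the same range. *)
Lemma tensor_mpolyE (x : tensor C N) : exists k0, forall k, (k0 <= k)%N ->
  x = \sum_(m : 'X_{1..n < k}) tens 'X_[m] (tensor_coef m x).
Proof.
elim/tensor_ind: x => [|p v|x y [k IHx] [l IHy]].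
- by exists 0%N => k _; rewrite big1 // => m _; rewrite tensor_coef0 tensr0.
- exists (msize p) => k le_pk; rewrite {1}(mpolywE le_pk) tens_suml.
  by apply: eq_bigr => m _; rewrite tensor_coef_tens -tensZ.
- exists (maxn k l) => t; rewrite geq_max => /andP[kt lt].
  rewrite {1}(IHx t kt) {1}(IHy t lt) -big_split; apply: eq_bigr => m _.
  by rewrite tensor_coefD tensDr.
Qed.

Lemma tensor_coef_inj (x y : tensor C N) :
  (forall m, tensor_coef m x = tensor_coef m y) -> x = y.
Proof.
have [k xE] := tensor_mpolyE x; have [l yE] := tensor_mpolyE y => E.
rewrite (xE (maxn k l)) ?leq_maxl // (yE (maxn k l)) ?leq_maxr //.
by apply: eq_bigr => m _; rewrite E.
Qed.
End Coefficients.

Lemma mpoly_flat : @flat R C.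
Proof.
move=> N N' f finj x y E; apply: tensor_coef_inj => m; apply: finj.
have nat z : tensor_coef m (tensor_map f z) = f (tensor_coef m z).
  rewrite /tensor_map; elim/tensor_ind: z => [|p v|z w IHz IHw].
  - by rewrite tensor_lift0 ?tensor_coef0 ?linear0 //; exact: tensor_map_bal.
  - rewrite tensor_lift_tens ?tensor_coef_tens ?linearZ //; exact: tensor_map_bal.
  - rewrite tensor_liftD ?tensor_coefD ?linearD ?IHz ?IHw //; exact: tensor_map_bal.
by rewrite -!nat E.
Qed.

Lemma mpoly_finitely_generated : @finitely_generated_algebra R C.
Proof.
exists n, (fun i => 'X_i) => p; exists p; rewrite /mmap [LHS]mpolyE.
by apply: eq_bigr => m _; rewrite mmap1_id /= mulr_algl.
Qed.

Section BaseChange.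
Variable S : comAlgType R.

Definition mpoly_base_change : tensor C S -> {mpoly S[n]} :=
  tensor_lift (fun (p : C) (s : S) => s *: map_mpoly (in_alg S) p).

Lemma mpoly_base_change_bal :
  balanced (fun (p : C) (s : S) => s *: map_mpoly (in_alg S) p).
Proof.
split=> [p q s|p s t|a p s]; first by rewrite rmorphD scalerDr.
  by rewrite scalerDl.
by rewrite map_mpolyZ scalerA /= mulr_algr.
Qed.

Let h := mpoly_base_change.

Lemma mpoly_base_change_tens p s : h (tens p s) = s *: map_mpoly (in_alg S) p.
Proof. exact/tensor_lift_tens/mpoly_base_change_bal. Qed.

Let hD x y : h (x + y) = h x + h y.
Proof. exact/tensor_liftD/mpoly_base_change_bal. Qed.

Let h0 : h 0 = 0.
Proof. exact/tensor_lift0/mpoly_base_change_bal. Qed.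

Lemma mpoly_base_change_zmod : zmod_morphism h.
Proof. by move=> x y; apply: (@addIr _ (h y)); rewrite -hD !subrK. Qed.

Lemma mpoly_base_change_monoid : monoid_morphism h.
Proof.
split=> [|x y]; first by rewrite mpoly_base_change_tens rmorph1 scale1r.
elim/tensor_ind: x => [|p s|x x' IHx IHx']; first by rewrite mul0r h0 mul0r.
  elim/tensor_ind: y => [|q t|y y' IHy IHy']; first by rewrite mulr0 h0 mulr0.
    rewrite tensM !mpoly_base_change_tens rmorphM -scalerAl -scalerAr scalerA.
    by [].
  by rewrite mulrDr !hD IHy IHy' mulrDr.
by rewrite mulrDl !hD IHx IHx' mulrDl.
Qed.

Lemma mpoly_base_change_scalable : scalable h.
Proof.
move=> c x; elim/tensor_ind: x => [|p s|x x' IHx IHx'].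
- by rewrite scaler0 h0 scaler0.
- by rewrite tens_scale !mpoly_base_change_tens scalerA.
- by rewrite scalerDr !hD IHx IHx' scalerDr.
Qed.

Lemma mpoly_base_change_coef m x : (h x)@_m = tensor_coef m x.
Proof.
elim/tensor_ind: x => [|p s|x x' IHx IHx'].
- by rewrite h0 mcoeff0 tensor_coef0.
- by rewrite mpoly_base_change_tens tensor_coef_tens mcoeffZ mcoeff_map_mpoly mulr_algr.
- by rewrite hD mcoeffD IHx IHx' tensor_coefD.
Qed.

Lemma mpoly_base_change_bij : bijective h.
Proof.
have hinj : injective h.
  move=> x y E; apply: tensor_coef_inj => m.
  by rewrite -!mpoly_base_change_coef E.
pose g (q : {mpoly S[n]}) : tensor C S := \sum_(m <- msupp q) tens 'X_[m] q@_m.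
have hg q : h (g q) = q.
  rewrite /g [RHS]mpolyE; have -> : h (\sum_(m <- msupp q) tens 'X_[m] q@_m) =
      \sum_(m <- msupp q) h (tens 'X_[m] q@_m) by exact: (big_morph h hD h0).
  by apply: eq_bigr => m _; rewrite mpoly_base_change_tens map_mpolyX.
by exists g => // x; apply: hinj; rewrite hg.
Qed.
End BaseChange.
End PolynomialTensor.

Lemma mpoly_fibration (R : idomainType) n : @affine_fibration n R {mpoly R[n]}.
Proof.
split; [exact: mpoly_finitely_generated | exact: mpoly_flat |] => P.
pose h := @mpoly_base_change R n (residue_alg P).
pose hm : {rmorphism tensor {mpoly R[n]} (residue_alg P) -> {mpoly (residue_alg
  P)[n]}} :=
  HB.pack h
  (GRing.isZmodMorphism.Build _ _ h (@mpoly_base_change_zmod R n (residue_alg P)))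
  (GRing.isMonoidMorphism.Build _ _ h (@mpoly_base_change_monoid R n (residue_alg P))).
exists hm.
by split; [exact: mpoly_base_change_bij | exact: mpoly_base_change_scalable].
Qed.

(** * Graded pieces *)

Section ReesGrading.
Variables (R : idomainType) (I : {pred R}) (A : comAlgType R).
Variables (phi : {lrmorphism A -> rees_alg I}).
Hypothesis phi_bij : bijective phi.

Definition rees_grading (i : nat) : {pred A} := fun x => phi x \in rees_comp i.

Lemma rees_compP i (q : rees_alg I) :
  reflect (exists a, val q = a *: 'X^i) (q \in rees_comp i).
Proof. exact: asboolP. Qed.

Fact val_reesM (p q : rees_alg I) : val (p * q) = val p * val q.
Proof. exact: rmorphM. Qed.
Fact val_reesD (p q : rees_alg I) : val (p + q) = val p + val q.
Proof. exact: rmorphD. Qed.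
Fact val_rees1 : val (1 : rees_alg I) = 1.
Proof. exact: rmorph1. Qed.
Fact val_rees0 : val (0 : rees_alg I) = 0.
Proof. exact: rmorph0. Qed.
Fact val_reesZ a (p : rees_alg I) : val (a *: p) = a *: val p.
Proof. exact: linearZ. Qed.
Fact val_rees_sum (J : finType) (p : J -> rees_alg I) :
  val (\sum_j p j) = \sum_j val (p j).
Proof. exact: rmorph_sum. Qed.

Fact rees_grading_submod i : submod_closed (rees_grading i).
Proof.
split=> [|a x y]; rewrite !unfold_in.
  by rewrite rmorph0; apply/rees_compP; exists 0; rewrite scale0r.
move=> /rees_compP[b xE] /rees_compP[c yE].
rewrite linearP; apply/rees_compP; exists (a * b + c).
by rewrite val_reesD val_reesZ xE yE scalerDl scalerA.
Qed.

HB.instance Definition _ i := GRing.isSubmodClosed.Build R A (rees_grading i)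
  (rees_grading_submod i).

Lemma monomial_rees (a : R) i : a \in symbolic_pow I i -> a *: 'X^i \in symbolic_rees I.
Proof.
move=> Ia; apply/asboolP=> k; rewrite coefZ coefXn.
case: eqP => [->|_]; first by rewrite mulr1.
by rewrite mulr0; case: (symbolic_pow_ideal I k).
Qed.

Lemma rees_grading_grading : grading (fun i => rees_grading i : submodClosed A).
Proof.
have [psi phiK psiK] := phi_bij; split.
- by apply/rees_compP; exists 1; rewrite rmorph1 val_rees1 expr0 scale1r.
- move=> i j x y /rees_compP[a xE] /rees_compP[b yE]; apply/rees_compP.
  exists (a * b); rewrite rmorphM val_reesM xE yE.
  by rewrite -scalerAl -scalerAr scalerA exprD.
- move=> x; pose q : {poly R} := val (phi x).
  have qI i : q`_i \in symbolic_pow I i.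
    by have /asboolP := valP (phi x); apply.
  pose c i := psi (Subalgebra (monomial_rees (qI i))).
  exists (size q), c; split=> [i|].
    by apply/rees_compP; rewrite /c psiK; exists q`_i.
  apply: (can_inj phiK); apply: val_inj; rewrite [in RHS]rmorph_sum val_rees_sum.
  rewrite -[LHS]/q -{1}[q]coefK poly_def; apply: eq_bigr => i _.
  exact: (congr1 val (esym (psiK (Subalgebra (monomial_rees (qI i)))))).
- move=> k c cP c0 i lt_ik; have [a aE] := choice (fun i => elimT (rees_compP i
  _) (cP i)).
  apply: (can_inj phiK); rewrite rmorph0; apply: val_inj; rewrite aE val_rees0.
  have : \sum_(j < k) a j *: 'X^j = 0.
    rewrite -[RHS]val_rees0 -(rmorph0 phi) -c0 rmorph_sum val_rees_sum.
    by apply: eq_bigr => j _; exact/esym/aE.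
  rewrite -(poly_def k a) => /polyP/(_ i); rewrite coef_poly lt_ik coef0 => ->.
  by rewrite scale0r.
Qed.

Lemma rees_graded_iso :
  graded_iso (fun i => rees_grading i : submodClosed A) (@rees_comp R I) phi.
Proof. by split=> // i x; rewrite unfold_in. Qed.

Lemma val_phi_alg (r : R) : val (phi r%:A) = r%:P.
Proof.
have -> : phi r%:A = r%:A by rewrite linearZZ rmorph1.
by rewrite val_reesZ val_rees1 alg_polyC.
Qed.

Lemma rees_algebra_inj : injective (fun r : R => r%:A : A).
Proof.
move=> r s /= E; have : val (phi r%:A) = val (phi s%:A) by rewrite E.
by rewrite !val_phi_alg => /polyC_inj.
Qed.

Lemma rees_grading0 x : x \in rees_grading 0 <-> exists r : R, x = r%:A.
Proof.
have [psi phiK psiK] := phi_bij; split=> [/rees_compP[a xE]|[r ->]].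
  exists a; apply: (can_inj phiK); apply: val_inj.
  by rewrite xE val_phi_alg expr0 alg_polyC.
by apply/rees_compP; exists r; rewrite val_phi_alg expr0 alg_polyC.
Qed.

Section Coordinate.
Variable i : nat.

(** This coordinate identifies the i-th component with the ideal I^(i) of R, where finiteness,
    reflexivity and rank are read off. *)
Definition rees_coord (m : submodule (rees_grading i)) : R := (val (phi (val m)))`_i.

Fact rees_coord_zmod : zmod_morphism rees_coord.
Proof. by move=> x y; rewrite /rees_coord !raddfB coefB. Qed.

Fact rees_coord_scalable : scalable_for *%R rees_coord.
Proof. by move=> a x; rewrite /rees_coord !linearZ /= coefZ. Qed.

HB.instance Definition _ := GRing.isZmodMorphism.Build _ _ rees_coord rees_coord_zmod.
HB.instance Definition _ := GRing.isScalable.Build _ _ _ _ rees_coord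
  rees_coord_scalable.

Lemma rees_coordE m : val (phi (val m)) = rees_coord m *: 'X^i.
Proof.
have /rees_compP[a aE] : phi (val m) \in rees_comp i by exact: (valP m).
by rewrite /rees_coord aE coefZ coefXn eqxx mulr1.
Qed.

Lemma rees_coord_inj : injective rees_coord.
Proof.
have [psi phiK _] := phi_bij; move=> x y E.
by apply/val_inj/(can_inj phiK)/val_inj; rewrite !rees_coordE E.
Qed.

Lemma rees_coord_image r : (exists m, rees_coord m = r) <-> r \in symbolic_pow I i.
Proof.
have [psi phiK psiK] := phi_bij; split=> [[m <-]|Ir].
  by have /asboolP := valP (phi (val m)); apply.
have gr : psi (Subalgebra (monomial_rees Ir)) \in rees_grading i.
  by apply/rees_compP; exists r; rewrite psiK.
exists (Submodule gr); rewrite /rees_coord /= psiK /=.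
by rewrite coefZ coefXn eqxx mulr1.
Qed.
End Coordinate.
End ReesGrading.

(** * Modules isomorphic to a non-zero ideal *)

Section IdealModule.
Variables (R : idomainType) (noeR : noetherian R) (norR : normal_domain R).
Variables (M : lmodType R) (rho : {scalar M}) (J : {pred R}).
Hypotheses (rho_inj : injective rho) (idJ : ideal J).
Hypothesis rho_im : forall r, (exists m, rho m = r) <-> r \in J.
Hypothesis J_neq0 : exists2 r, r \in J & r != 0.

(** Any two elements of an ideal are proportional; both the rank and the reflexivity rest on
    this. *)
Lemma ideal_module_coord (x y : M) : rho x *: y = rho y *: x.
Proof. by apply: rho_inj; rewrite !linearZ /= mulrC. Qed.

Lemma ideal_module_finite : finite_module M.
Proof.
have [k [g gJ]] := noeR idJ.
have gE i : exists m, rho m = g i by apply/rho_im; rewrite gJ ideal_gen_in //; exists i.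
have [m mE] := choice gE; exists k, m => x.
have : rho x \in J by apply/rho_im; exists x.
rewrite gJ => /asboolP[l [a [h [hP xE]]]]; have [s sE] := choice hP.
exists (fun j => \sum_(i < l | s i == j) a i); apply: rho_inj.
rewrite xE linear_sum (partition_big s xpredT) //=; apply: eq_bigr => j _.
rewrite linearZ /= mE mulr_suml; apply: eq_bigr => i /eqP <-; by rewrite sE.
Qed.

Lemma ideal_module_rank : has_rank M 1.
Proof.
pose F := frac_alg R; have [r0 Jr r0n] := J_neq0.
have /rho_im[m0 m0E] := Jr.
have fr0 : tofrac r0 != 0 by rewrite tofrac_eq0.
pose c (m : M) (x : F) : F := tofrac (rho m) * x.
have cbal : balanced c.
  split=> [m m' x|m x y|a m x]; rewrite /c.
  - by rewrite linearD tofracD mulrDl.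
  - exact: mulrDr.
  - by rewrite linearZ /= tofracM -mulrA mulrCA.
pose h (t : tensor M F) : 'rV[F]_1 := const_mx (tensor_lift c t).
have hlin : linear h.
  move=> a x y; apply/rowP=> i; rewrite !mxE tensor_liftD //; congr (_ + _).
  elim/tensor_ind: x => [|m b|x z IHx IHz].
  - by rewrite scaler0 tensor_lift0 // mulr0.
  - by rewrite tens_scale !tensor_lift_tens // /c mulrCA.
  - by rewrite scalerDr !tensor_liftD // IHx IHz mulrDr.
(* By proportionality every tensor is a pure tensor on [m0], which provides the inverse map. *)
have tE (t : tensor M F) : t = tens m0 (tensor_lift c t / tofrac r0 : F).
  elim/tensor_ind: t => [|m x|x y IHx IHy].
  - by rewrite tensor_lift0 // mul0r tensr0.
  - rewrite tensor_lift_tens // /c.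
    have xE : x = r0 *: (x / tofrac r0 : F).
      by rewrite -[RHS]/(tofrac r0 * (x / tofrac r0)) mulrC divfK.
    rewrite {1}xE -tensZ -m0E ideal_module_coord tensZ; congr (tens _ _).
    by rewrite -[LHS]/(tofrac (rho m) * (x / tofrac (rho m0))) mulrA.
  - by rewrite {1}IHx {1}IHy tensor_liftD // mulrDl tensDr.
exists (HB.pack_for {linear tensor M F -> 'rV[F]_1} h (GRing.isLinear.Build _ _
  _ _ h hlin)).
exists (fun v : 'rV[F]_1 => tens m0 (v 0 0 / tofrac r0 : F)) => [t|v] /=.
  by rewrite /h mxE -tE.
apply/rowP=> i; rewrite ord1 /h mxE tensor_lift_tens // /c m0E.
by rewrite mulrC divfK.
Qed.

(* Evaluating at the inclusion [rho] turns an element of the bidual into an *)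
(* element of [R], which divisoriality of [J] puts into [J].                 *)
Lemma ideal_module_reflexive :
  (forall x, (forall P : prime_idealr R, divisorial_prime P ->
     exists2 s, s \notin P & s * x \in J) -> x \in J) ->
  reflexive_module M.
Proof.
move=> divJ; split=> [m m' E|Phi PhiE]; first exact/rho_inj/E.
have zlin : scalar (fun _ : M => 0 : R) by move=> a x y; rewrite mulr0 addr0.
pose z : {scalar M} := HB.pack_for {scalar M} (fun _ : M => 0 : R)
  (GRing.isLinear.Build _ _ _ _ (fun _ : M => 0 : R) zlin).
have Phi0 : Phi z = 0.
  by apply: (@addIr _ (Phi z)); rewrite add0r -{1}[Phi z]mul1r -(PhiE 1 z) // =>
    m; rewrite mulr0 addr0.
have PhiZ a (u v : {scalar M}) : (forall m, u m = a * v m) -> Phi u = a * Phi v.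
  by move=> E; rewrite (PhiE a u v z) ?Phi0 ?addr0 // => m; rewrite E addr0.
have scaled a (v : {scalar M}) : exists u : {scalar M}, forall m, u m = a * v m.
  have ulin : scalar (fun m => a * v m).
    by move=> b x y; rewrite linearP mulrDr mulrCA.
  by exists (HB.pack_for {scalar M} (fun m => a * v m)
    (GRing.isLinear.Build _ _ _ _ (fun m => a * v m) ulin)).
have [m mE] : exists m, rho m = Phi rho.
  apply/rho_im/divJ => P dP.
  have [x [s [Jx Ps xP]]] := ideal_local_principal noeR norR dP idJ.
  have [r0 Jr r0n] := J_neq0; have x0 : x != 0.
    apply: contraNneq Ps => x0; have [q /eqP] := xP _ Jr.
    by rewrite x0 mulr0 mulf_eq0 (negPf r0n) orbF => /eqP->; exact: idealr0.
  (* As s J lies in x R, q = (s/x) [rho] is a functional on M, and s Phi(rho) = x Phi(q) lies in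
     [J]. *)
  have qE m : exists q, s * rho m = q * x by apply: xP; apply/rho_im; exists m.
  have [q qP] := choice qE.
  have qlin : scalar q.
    move=> a u v; apply: (mulIf x0); rewrite -qP linearP mulrDl -mulrA -!qP.
    by rewrite mulrDr mulrCA.
  pose qs : {scalar M} := HB.pack_for {scalar M} q (GRing.isLinear.Build _ _ _ _
    q qlin).
  have [u uE] := scaled s rho; exists s => //.
  rewrite -(PhiZ s u rho uE) (PhiZ x u qs) => [|m]; last by rewrite uE qP mulrC.
  by rewrite mulrC; apply: idealMl.
exists m => v; have [r0 /rho_im[m0 m0E] r0n] := J_neq0.
(* By proportionality r0 v = v(m0) [rho], so [Phi] is determined by its value at [rho]. *)
have [u uE] := scaled r0 v.
apply: (mulfI r0n); rewrite -(PhiZ r0 u v uE) (PhiZ (v m0) u rho) => [|x].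
  by rewrite -mE -m0E mulrC -!linearZ /= ideal_module_coord linearZ.
rewrite uE -m0E; have := congr1 v (ideal_module_coord m0 x).
by rewrite !linearZ /= => ->; rewrite mulrC.
Qed.
End IdealModule.

(** The symbolic power is cut out by conditions at the primes associated to [I], which have height
    one and are therefore divisorial. *)
Lemma symbolic_pow_divisorial (R : idomainType) (I : {pred R}) n x :
  noetherian R -> normal_domain R -> contains_rat R -> unmixed_height_one I ->
  (forall P : prime_idealr R, divisorial_prime P ->
     exists2 s, s \notin P & s * x \in symbolic_pow I n) ->
  x \in symbolic_pow I n.
Proof.
move=> noeR norR ratR unmI loc; apply/asboolP=> P PI; have [idI unI] := unmI.
have [d Id d0] := unmixed_neq0 unmI; have hP := unI _ PI.
have Pd : d \in P.
  by have [y yP] := PI; rewrite yP mulrC; exact: idealMl.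
have [|s Ps /asboolP/(_ P PI)/loc_idealP] := loc P.
  by exists d => //; exact: height_one_divisorial.
case; first exact: ideal_pow_ideal.
move=> t Pt tE; apply/loc_idealP; first exact: ideal_pow_ideal.
by exists (t * s); rewrite ?prime_idealrM ?negb_or ?Pt // -mulrA.
Qed.

(** * The kernel as a symbolic Rees algebra *)

Section PolynomialSubring.
Variable K : fieldType.
Local Notation KXY := {mpoly K[2]}.
Local Notation ev p f := (map_poly (@mpolyC 2 K) p).[f].

Lemma ev_comp (p q : {poly K}) (f : KXY) : ev (p \Po q) f = ev p (ev q f).
Proof. by rewrite map_comp_poly horner_comp. Qed.

Lemma ev_affine (u v : K) (f : KXY) : ev (u%:P * 'X + v%:P) f = u *: f + v%:MP.
Proof.
rewrite rmorphD rmorphM /= !map_polyC map_polyX hornerMXaddC hornerC.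
by rewrite mul_mpolyC.
Qed.

Lemma ev_affine_range (u v : K) (f x : KXY) : u != 0 ->
  (exists p, x = ev p (u *: f + v%:MP)) <-> exists p, x = ev p f.
Proof.
move=> u0; split=> -[p ->]; first by rewrite -ev_affine -ev_comp;
  exists (p \Po (u%:P * 'X + v%:P)).
exists (p \Po (u^-1%:P * 'X + (- (u^-1 * v))%:P)); rewrite ev_comp ev_affine;
  congr _.[_].
rewrite scalerDr scalerA mulVf // scale1r -addrA -[u^-1 *: _]mul_mpolyC -mpolyCM
  -mpolyCD.
by rewrite subrr addr0.
Qed.

Lemma ev_inj (f : KXY) (p q : {poly K}) : (1 < msize f)%N -> ev p f = ev q f -> p = q.
Proof.
move=> f1 E; apply/eqP; rewrite -subr_eq0; apply: contraTT f1 => pq.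
have [|c ->] := mpoly_algebraic_const (x := f) pq.
  by rewrite rmorphB hornerD hornerN E subrr.
by rewrite msizeC -leqNgt; case: (c != 0).
Qed.
End PolynomialSubring.

Section ResidueFieldOfZero.
Variable R : idomainType.
Local Notation tau := (residue_map (zero_prime R)).

Fact tau0_eq0 a : (tau a == 0) = (a == 0).
Proof. by rewrite residue_map_eq0 in_zero_prime. Qed.

Fact tau0_frac (x : residue_field (zero_prime R)) :
  exists a s, s != 0 /\ x = tau a / tau s.
Proof. by have [a [s [s0 ->]]] := residue_field_fracP x; exists a, s. Qed.

Fact tau0_char n : contains_rat R -> (0 < n)%N ->
  n%:R != 0 :> residue_field (zero_prime R).
Proof.
move=> ratR n0; rewrite -(rmorph_nat (residue_map (zero_prime R))) tau0_eq0.
have [c c1] := natr_unit ratR n0; apply: contra_eq_neq c1 => ->.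
by rewrite mulr0 eq_sym oner_eq0.
Qed.
End ResidueFieldOfZero.

(** * From the derivation over K to the kernel in B *)

Section Assembly.
Variables (R : idomainType) (K : fieldType) (tau : {rmorphism R -> K}).
Hypothesis charK : forall n, (0 < n)%N -> n%:R != 0 :> K.
Hypothesis tau_eq0 : forall a, (tau a == 0) = (a == 0).
Hypothesis tau_frac : forall x, exists a s, s != 0 /\ x = tau a / tau s.
Local Notation KXY := {mpoly K[2]}.
Local Notation ev p f := (map_poly (@mpolyC 2 K) p).[f].

Variables (B : comAlgType R) (iota : {rmorphism B -> KXY}).
Hypothesis iotaZ : forall r b, iota (r *: b) = tau r *: iota b.
Hypothesis iota_inj : injective iota.

Lemma embedded_domain (x y : B) : x * y = 0 -> x = 0 \/ y = 0.
Proof.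
move=> /(congr1 iota); rewrite rmorphM rmorph0 => /mpoly_domain[] E; [left|right];
  by apply: iota_inj; rewrite E rmorph0.
Qed.

Lemma embedded_char n (x : B) : (0 < n)%N -> x *+ n = 0 -> x = 0.
Proof.
move=> n0 /(congr1 iota); rewrite rmorphMn rmorph0 => /(mpoly_char charK n0) E.
by apply: iota_inj; rewrite E rmorph0.
Qed.

(** K[X,Y] is a localization of B at non-zero scalars. The extension is defined with chosen
    denominators, and [dP] shows that it does not depend on them. *)
Lemma extend_derivation (D : derivation B) :
  (forall x, exists s b, s != 0 /\ iota b = tau s *: x) ->
  exists DK : derivation KXY, forall b, DK (iota b) = iota (D b).
Proof.
move=> iota_frac; have [s sP] := choice iota_frac; have [b bP] := choice sP.
have ts a : a != 0 -> tau a != 0 by rewrite tau_eq0.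
pose d x := (tau (s x))^-1 *: iota (D (b x)).
have dP x t c : t != 0 -> iota c = tau t *: x -> tau t *: d x = iota (D c).
  move=> t0 cE; have [s0 bE] := bP x; apply: (scale_mpolyI (ts _ s0)).
  rewrite /d !scalerA mulrAC mulfV ?ts // mul1r -!iotaZ -!linearZ /=;
    congr (iota (D _)).
  by apply: iota_inj; rewrite !iotaZ bE cE !scalerA mulrC.
have dlin : linear d.
  move=> a x y; have [p [q [q0 aE]]] := tau_frac a.
  have [sx bx] := bP x; have [sy by_] := bP y.
  have nz : q * (s x * s y) != 0 by rewrite !mulf_neq0.
  apply: (scale_mpolyI (ts _ nz)).
  rewrite (dP _ _ ((p * s y) *: b x + (q * s x) *: b y) nz).
    rewrite linearD !linearZ rmorphD !iotaZ -(dP x _ _ sx bx) -(dP y _ _ sy by_).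
    by rewrite scalerDr !scalerA aE !rmorphM; congr (_ *: _ + _ *: _); field;
      rewrite ?ts.
  rewrite rmorphD !iotaZ bx by_ scalerDr !scalerA aE !rmorphM.
  by congr (_ *: _ + _ *: _); field; rewrite ?ts.
pose DKl : {linear KXY -> KXY} := HB.pack_for {linear KXY -> KXY} d
  (GRing.isLinear.Build _ _ _ _ d dlin).
have dM x y : d (x * y) = d x * y + x * d y.
  have [sx bx] := bP x; have [sy by_] := bP y.
  have nz : s x * s y != 0 by rewrite mulf_neq0.
  apply: (scale_mpolyI (ts _ nz)); rewrite (dP _ _ (b x * b y) nz); last first.
    by rewrite rmorphM bx by_ -scalerAl -scalerAr scalerA rmorphM.
  rewrite derivationM rmorphD !rmorphM -(dP x _ _ sx bx) -(dP y _ _ sy by_) bx by_.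
  rewrite scalerDr -!scalerAl -!scalerAr !scalerA.
  by congr (_ *: _ + _ *: _); field; rewrite ?ts.
exists (@Derivation _ _ DKl dM) => c; rewrite -[LHS]scale1r -(rmorph1 tau).
by apply: dP; rewrite ?oner_eq0 // rmorph1 scale1r.
Qed.

Lemma kernel_generator (D : derivation B) :
  (forall x, exists s b, s != 0 /\ iota b = tau s *: x) ->
  locally_nilpotent D -> (exists b, D b <> 0) ->
  exists f : KXY, (1 < msize f)%N /\
    forall b, D b = 0 <-> exists p : {poly K}, iota b = ev p f.
Proof.
move=> iota_frac nilD [b Db]; have [DK DKE] := extend_derivation D iota_frac.
have iterE n c : iter n DK (iota c) = iota (iter n D c).
  by elim: n => //= n ->; rewrite DKE.
have nilK : locally_nilpotent DK.
  move=> x; have [s [c [s0 cE]]] := iota_frac x; have [n nc] := nilD c; exists n.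
  have ts : tau s != 0 by rewrite tau_eq0.
  apply: (scale_mpolyI ts); rewrite scaler0 -(rmorph0 iota) -nc -iterE cE.
  by elim: n {nc} => //= n <-; rewrite linearZ.
have nzK : exists x, DK x <> 0.
  exists (iota b); rewrite DKE => E; apply: Db; apply: iota_inj.
  by rewrite E rmorph0.
have [f [f1 fP]] := rentschler charK nilK nzK; exists f; split=> // c.
rewrite -fP DKE; split=> [->|E]; first by rewrite rmorph0.
by apply: iota_inj; rewrite E rmorph0.
Qed.

Section KernelIso.
Variables (D : derivation B) (f : KXY).
Hypothesis f1 : (1 < msize f)%N.
Hypothesis kerE : forall b, D b = 0 <-> exists p : {poly K}, iota b = ev p f.
Local Notation I := (coef_ideal tau iota f).
Hypothesis reesE : forall p : {poly K}, inB iota (ev p f) <->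
  exists2 q, q \in symbolic_rees I & p = map_poly tau q.

(** Sending T to f embeds the Rees algebra in K[X,Y] with the same image as the kernel. The two maps
    between them are chosen pointwise, and their laws are checked in K[X,Y]. *)
Lemma kernel_rees_iso : exists phi : {lrmorphism ker_alg D -> rees_alg I},
  bijective phi.
Proof.
pose E (q : rees_alg I) : KXY := ev (map_poly tau (val q)) f.
have E_inj : injective E.
  move=> p q /(ev_inj f1) pq; apply/val_inj/polyP=> i.
  have /polyP/(_ i) := pq; rewrite !coef_map => /eqP; rewrite -subr_eq0 -rmorphB.
  by rewrite tau_eq0 subr_eq0 => /eqP.
have toE (x : ker_alg D) : exists q, iota (val x) = E q.
  have /eqP Dx : val x \in der_ker D := valP x.
  have [p pE] := (kerE _).1 Dx.
  have [q qI qE] : exists2 q, q \in symbolic_rees I & p = map_poly tau q.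
    by apply/reesE; exists (val x).
  by exists (Subalgebra qI); rewrite pE qE.
have ofE (q : rees_alg I) : exists x : ker_alg D, iota (val x) = E q.
  have [b bE] : inB iota (E q) by apply/reesE; exists (val q) => //; exact: valP q.
  have Db : b \in der_ker D by apply/eqP/kerE; exists (map_poly tau (val q)).
  by exists (Subalgebra Db).
have [phi phiE] := choice toE; have [psi psiE] := choice ofE.
have ED p q : E (p + q) = E p + E q by rewrite /E !rmorphD hornerD.
have EM p q : E (p * q) = E p * E q by rewrite /E !rmorphM hornerM.
have E1 : E 1 = 1 by rewrite /E !rmorph1 hornerC.
have EZ r p : E (r *: p) = tau r *: E p.
  by rewrite /E val_reesZ !map_polyZ hornerZ mul_mpolyC.
have phiD : zmod_morphism phi.
  move=> x y; apply: E_inj; apply: (@addIr _ (E (phi y))).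
  by rewrite -[RHS]ED subrK -!phiE -rmorphD; congr (iota _); rewrite -rmorphD subrK.
have phiM : monoid_morphism phi.
  split=> [|x y]; apply: E_inj; first by rewrite -phiE E1 !rmorph1.
  by rewrite EM -!phiE -rmorphM; congr (iota _); rewrite rmorphM.
have phiZ : scalable phi.
  move=> r x; apply: E_inj; rewrite EZ -!phiE -iotaZ; congr (iota _); exact: linearZ.
pose phil : {lrmorphism ker_alg D -> rees_alg I} :=
  HB.pack_for {lrmorphism ker_alg D -> rees_alg I} phi
    (GRing.isZmodMorphism.Build _ _ phi phiD) (GRing.isMonoidMorphism.Build _ _
      phi phiM)
    (GRing.isScalable.Build _ _ _ _ phi phiZ).
exists phil; exists psi => [x|q].
  by apply: val_inj; apply: iota_inj; rewrite psiE -phiE.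
by apply: E_inj; rewrite -phiE psiE.
Qed.
End KernelIso.
End Assembly.

(** * Derivations with constant coefficients *)

Section LinearDerivation.
Variables (R : comNzRingType) (a b : R).

Definition linear_der (p : {mpoly R[2]}) : {mpoly R[2]} :=
  a *: p^`M(0) + b *: p^`M(1).

Fact linear_der_linear : linear linear_der.
Proof.
by move=> c p q; rewrite /linear_der !mderivD !mderivZ !scalerDr !scalerA
  addrACA ![c * _]mulrC.
Qed.
HB.instance Definition _ := GRing.isLinear.Build R {mpoly R[2]} {mpoly R[2]} *:%R
  linear_der linear_der_linear.

Fact linear_derM p q : linear_der (p * q) = linear_der p * q + p * linear_der q.
Proof.
rewrite /linear_der !mderivM !scalerDr mulrDl mulrDr -!scalerAl -!scalerAr.
by rewrite addrACA.
Qed.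

Definition linear_derivation : derivation {mpoly R[2]} :=
  Derivation (derivation_val := linear_der) linear_derM.

(** With constant coefficients the derivation lowers the total degree. *)
Lemma linear_der_nilpotent : locally_nilpotent linear_derivation.
Proof.
move=> p; have [n] := ubnP (msize p); elim: n p => // n IHn p lt_pn.
have [p0|p0] := posnP (msize p).
  by exists 0%N; apply/eqP; rewrite -msize_poly_eq0 p0.
have [|m mP] := IHn (linear_der p); last by exists m.+1; rewrite iterSr.
rewrite -ltnS; apply: leq_trans lt_pn; rewrite ltnS /linear_der.
have le i c : (msize (c *: p^`M(i)) <= (msize p).-1)%N.
  exact: leq_trans (msizeZ_le _ _) (msize_mderiv _ _).
by rewrite -[msize p]prednK // ltnS (leq_trans (msizeD_le _ _)) // geq_max !le.
Qed.
End LinearDerivation.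

Lemma map_linear_der (R S : comNzRingType) (f : {rmorphism R -> S}) (a b : R) p :
  map_mpoly f (linear_der a b p) = linear_der (f a) (f b) (map_mpoly f p).
Proof.
rewrite /linear_der rmorphD /= !map_mpolyZ; congr (_ *: _ + _ *: _);
  by apply/mpolyP=> m; rewrite mcoeff_map_mpoly !mcoeff_deriv raddfMn mcoeff_map_mpoly.
Qed.

Lemma mderiv_var (R : comNzRingType) (i j : 'I_2) :
  ('X_j : {mpoly R[2]})^`M(i) = (j == i)%:R.
Proof.
rewrite mderivX mnm1E; case: eqP => [->|_]; last by rewrite scale0r.
rewrite scale1r (_ : (_ - _)%MM = 0%MM) ?mpolyX0 //.
by apply/mnmP=> k; rewrite mnmBE mnm0E subnn.
Qed.

Section LinearKernel.
Variable K : fieldType.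
Hypothesis charK : forall n, (0 < n)%N -> n%:R != 0 :> K.
Local Notation KXY := {mpoly K[2]}.
Local Notation ev p f := (map_poly (@mpolyC 2 K) p).[f].

Lemma mcoeff_linear_form (c : K) i :
  ('X_0 + c *: 'X_1 : KXY)@_U_(i) = if i == 0 then 1 else c.
Proof.
rewrite mcoeffD mcoeffZ !mcoeffXU; case: i => [[|[|//]] ?]; rewrite -!val_eqE /=.
  by rewrite mulr0 addr0.
by rewrite mulr1 add0r.
Qed.

Lemma linear_form_nonconstant (c : K) : (1 < msize ('X_0 + c *: 'X_1 : KXY)%R)%N.
Proof.
rewrite ltnNge; apply/negP=> /msize1_polyC/(congr1 (mcoeff U_(0%R))).
rewrite mcoeff_linear_form eqxx mcoeffC => /eqP;
  rewrite (_ : (U_(0%R) == 0)%MM = false).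
  by rewrite mulr0 oner_eq0.
by apply/eqP=> /mnmP/(_ ord0); rewrite mnm1E mnm0E eqxx.
Qed.

(** Rentschler's theorem gives a kernel K[g], and the linear form f is some q(g). Differentiating in
    X, 1 = q'(g) times a polynomial, so q' is constant, q is affine and K[f] = K[g]. *)
Lemma linear_der_kernel (a b : K) (x : KXY) : b != 0 ->
  linear_der a b x = 0 <-> exists p : {poly K}, x = ev p ('X_0 - (a / b) *: 'X_1).
Proof.
move=> b0; rewrite -scaleNr; set f := 'X_0 + _ : KXY.
have nz : exists x, linear_derivation a b x <> 0.
  exists 'X_1; rewrite /= /linear_der !mderiv_var eqxx scaler0 add0r => /eqP.
  by rewrite scaler_eq0 (negPf b0) oner_eq0.
have [g [g1 gP]] := rentschler charK (linear_der_nilpotent a b) nz.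
have [q qE] : exists q : {poly K}, f = ev q g.
  apply/gP; rewrite /= /linear_der !mderivD !mderivZ !mderiv_var !eqxx.
  rewrite !scaler0 addr0 add0r scalerA mulrN mulrC divfK // -scalerDl subrr.
  by rewrite scale0r.
have : ev q^`() g * g^`M(0) = 1.
  rewrite -deriv_map -[LHS](der_horner (D := partial K 0)); last exact: der_evC.
  by rewrite -qE /= mderivD mderivZ !mderiv_var eqxx scaler0 addr0.
set y := ev _ _ => y1; have y0 : y != 0.
  by apply: contra_eq_neq y1 => ->; rewrite mul0r eq_sym oner_eq0.
have h0 : g^`M(0) != 0.
  by apply: contra_eq_neq y1 => ->; rewrite mulr0 eq_sym oner_eq0.
have ys : (msize y <= 1)%N.
  have := congr1 (fun z : KXY => msize z) y1; rewrite /= msizeM // msize1.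
  rewrite (mpolySpred _ y0) (mpolySpred _ h0) addSn addnS /= => -[] /eqP.
  by rewrite addn_eq0 => /andP[/eqP->].
set c := y@_0%MM; have yE : y = c%:MP by exact: msize1_polyC.
have c0 : c != 0 by apply: contraNneq y0 => c0; rewrite yE c0.
have q'E : q^`() = c%:P by apply: (ev_inj g1); rewrite map_polyC hornerC -/y yE.
have qc : q = c%:P * 'X + (q`_0)%:P.
  apply/polyP=> -[|i]; rewrite coefD coefMX coefC /= ?add0r // addr0 coefC.
  have /polyP/(_ i) := q'E; rewrite coef_deriv coefC; case: i => [|i] //= E.
  by apply/eqP; move/eqP: E; rewrite -mulr_natr mulf_eq0 (negPf (charK _)) ?orbF.
have fE : f = c *: g + (q`_0)%:MP by rewrite qE {1}qc ev_affine.
rewrite fE ev_affine_range // -gP; reflexivity.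
Qed.
End LinearKernel.

Lemma map_mpoly_injective (R S : nzRingType) n (f : {rmorphism R -> S}) :
  injective f -> injective (@map_mpoly n R S f).
Proof.
move=> finj p q E; apply/mpolyP=> m; apply: finj.
by rewrite -!mcoeff_map_mpoly E.
Qed.

(** * The kernel of e d/dX - d d/dY on R[X,Y] *)

Section PolynomialRing.
Variables (R : idomainType) (noeR : noetherian R) (norR : normal_domain R).
Variables (K : fieldType) (tau : {rmorphism R -> K}).
Hypothesis charK : forall n, (0 < n)%N -> n%:R != 0 :> K.
Hypothesis tau_eq0 : forall a, (tau a == 0) = (a == 0).
Hypothesis tau_frac : forall x, exists a s, s != 0 /\ x = tau a / tau s.
Variables (d e : R).
Hypothesis d0 : d != 0.
Local Notation C := {mpoly R[2]}.
Local Notation KXY := {mpoly K[2]}.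
Local Notation ev p f := (map_poly (@mpolyC 2 K) p).[f].
Local Notation iota := (map_mpoly tau : {rmorphism C -> KXY}).

Let iotaZ (r : R) (b : C) : iota (r *: b) = tau r *: iota b.
Proof. exact: map_mpolyZ. Qed.

Let iota_inj : injective iota.
Proof. exact/map_mpoly_injective/(tau_inj tau_eq0). Qed.

Let td : tau d != 0. Proof. by rewrite tau_eq0. Qed.

Let f : KXY := 'X_0 + (tau e / tau d) *: 'X_1.

Lemma colon_coef_ideal r : (r \in coef_ideal tau iota f) = (r * e \in principal d).
Proof.
apply/coef_idealP/asboolP => [[p pE]|[c cE]].
  exists p@_U_(1%R); apply: (tau_inj tau_eq0); rewrite !rmorphM -mcoeff_map_mpoly.
  rewrite -[map_mpoly tau p]pE mcoeffZ mcoeff_linear_form /=; by field.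
exists (r *: 'X_0 + c *: 'X_1); rewrite rmorphD /= !map_mpolyZ !map_mpolyX.
rewrite /f scalerDr scalerA; congr (_ + _ *: _).
by rewrite mulrA -rmorphM cE rmorphM mulfK.
Qed.

(** The form [f] is already normalized: it has no constant term, its coefficient at X is 1, and d f
    has coefficients in R. *)
Lemma linear_form_rees (p : {poly K}) :
  inB iota (ev p f) <->
  exists2 q, q \in symbolic_rees (coef_ideal tau iota f) & p = map_poly tau q.
Proof.
have U0 (i : 'I_2) : (U_(i) != 0)%MM.
  by apply/eqP=> /mnmP/(_ i); rewrite mnm1E mnm0E eqxx.
apply: (kernel_rees noeR norR (mpoly_fibration R 2) tau_eq0 tau_frac iotaZ iota_inj).
- move=> a b [q qE]; exists (q - (q@_0%MM)%:MP); rewrite rmorphB -qE /= map_mpolyC.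
  transitivity (a *: f + b%:MP - b%:MP); first by rewrite addrK.
  congr (_ - _%:MP); rewrite -mcoeff_map_mpoly -[map_mpoly tau q]qE.
  rewrite mcoeffD mcoeffC eqxx mulr1 mcoeffZ mcoeffD mcoeffZ !mcoeffX.
  by rewrite !(negPf (U0 _)) mulr0 addr0 mulr0 add0r.
- move=> a [q qE]; exists q@_U_(0%R); rewrite -mcoeff_map_mpoly -[map_mpoly tau q]qE.
  by rewrite mcoeffZ mcoeff_linear_form /= mulr1.
- exists d => //; have : d \in coef_ideal tau iota f; last by move/coef_idealP.
  by rewrite colon_coef_ideal; apply/asboolP; exists e; rewrite mulrC.
Qed.

Lemma linear_der_kernel_form (b : C) :
  linear_derivation e (- d) b = 0 <-> exists p : {poly K}, iota b = ev p f.
Proof.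
have fE : f = 'X_0 - (tau e / tau (- d)) *: 'X_1.
  by rewrite rmorphN invrN mulrN scaleNr opprK.
rewrite fE -linear_der_kernel // ?rmorphN ?oppr_eq0 // -rmorphN.
rewrite -map_linear_der; split=> [->|E]; first by rewrite rmorph0.
by apply: iota_inj; rewrite [RHS]rmorph0.
Qed.
End PolynomialRing.

Lemma msize_affine (K : fieldType) n (u v : K) (f : {mpoly K[n]}) :
  u != 0 -> (1 < msize f)%N -> (1 < msize (u *: f + v%:MP)%R)%N.
Proof.
move=> u0; apply: contraTT; rewrite -!leqNgt => /msize1_polyC.
set c := _@_0%MM => E; suff -> : f = (u^-1 * (c - v))%:MP.
  by rewrite msizeC; case: (_ != 0).
by rewrite mpolyCM mpolyCB -E addrK mul_mpolyC scalerA mulVf ?scale1r.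
Qed.

Lemma symbolic_pow_neq0 (R : idomainType) (I : {pred R}) n :
  unmixed_height_one I -> exists2 r, r \in symbolic_pow I n & r != 0.
Proof.
move=> /unmixed_neq0[d Id d0]; exists (d ^+ n); last exact: expf_neq0.
apply/asboolP=> P _; apply/loc_idealP; first exact: ideal_pow_ideal.
exists 1; rewrite ?idealr1 // mul1r; elim: n => [|n IHn] //.
by rewrite exprS; apply: ideal_gen_in; exists d, (d ^+ n).
Qed.

Lemma inverse_lrmorphism (R : comNzRingType) (A B : comAlgType R)
    (phi : {lrmorphism A -> B}) : bijective phi ->
  exists psi : {lrmorphism B -> A}, cancel phi psi /\ cancel psi phi.
Proof.
move=> [psi phiK psiK]; have inj := can_inj phiK.
have psiB : zmod_morphism psi by move=> x y; apply: inj; rewrite rmorphB /= !psiK.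
have psiM : monoid_morphism psi.
  by split=> [|x y]; apply: inj; rewrite ?rmorph1 ?rmorphM /= !psiK.
have psiZ : scalable psi by move=> a x; apply: inj; rewrite linearZZ /= !psiK.
by exists (HB.pack_for {lrmorphism B -> A} psi
  (GRing.isZmodMorphism.Build _ _ psi psiB) (GRing.isMonoidMorphism.Build _ _ psi psiM)
  (GRing.isScalable.Build _ _ _ _ psi psiZ)).
Qed.

Lemma kernel_embedding_inert (R : comNzRingType) (C A : comAlgType R)
    (D : derivation C) (phi : {lrmorphism ker_alg D -> A}) :
  (forall x y : C, x * y = 0 -> x = 0 \/ y = 0) ->
  (forall n (x : C), (0 < n)%N -> x *+ n = 0 -> x = 0) ->
  locally_nilpotent D -> bijective phi ->
  exists j : {lrmorphism A -> C}, injective j /\ inert (fun c : C => exists a, c = j a).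
Proof.
move=> domC charC nilD /inverse_lrmorphism[psi [phiK psiK]].
pose i (a : A) : C := val (psi a).
have iB : zmod_morphism i by move=> a b; rewrite /i !rmorphB.
have iM : monoid_morphism i by split=> [|a b]; rewrite /i ?rmorph1 ?rmorphM.
have iZ : scalable i by move=> r a; rewrite /i !linearZ.
pose j : {lrmorphism A -> C} := HB.pack_for {lrmorphism A -> C} i
  (GRing.isZmodMorphism.Build _ _ i iB) (GRing.isMonoidMorphism.Build _ _ i iM)
  (GRing.isScalable.Build _ _ _ _ i iZ).
have jE (c : C) : D c = 0 -> exists a, c = j a.
  move=> /eqP Dc; have kc : c \in der_ker D := Dc.
  by exists (phi (Subalgebra kc)); rewrite /= /i phiK.
exists j; split; first by move=> x y /val_inj/(can_inj psiK).
split; first by move=> x y /domC[] ->; rewrite eqxx ?orbT.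
move=> x y x0 y0 [a xyE].
have Dxy : D (x * y) = 0 by rewrite xyE; apply/eqP: (valP (psi a)).
by have [/jE ? /jE ?] := der_ker_inert domC charC nilD x0 y0 Dxy.
Qed.

Theorem theorem5p2 (R : idomainType)
    (R_noetherian : noetherian R) (R_normal : normal_domain R)
    (R_rat : contains_rat R) :
  (forall (B : comAlgType R) (D : derivation B),
     affine_fibration 2 B -> locally_nilpotent D -> (exists b, D b <> 0) ->
     exists A_ : nat -> submodClosed (ker_alg D),
       [/\ grading A_,
           injective (fun r : R => r%:A : ker_alg D),
           forall x : ker_alg D, x \in A_ 0%N <-> exists r : R, x = r%:A,
           forall i : nat, (1 <= i)%N ->
             [/\ finite_module (submodule (A_ i)),
                 reflexive_module (submodule (A_ i))
               & has_rank (submodule (A_ i)) 1]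
         & ~ GRing.field_axiom R ->
           exists I : {pred R}, unmixed_height_one I /\
             exists f : {lrmorphism ker_alg D -> rees_alg I},
               graded_iso A_ (@rees_comp R I) f])
  /\
  (forall I : {pred R}, unmixed_height_one I ->
     exists C : comAlgType R, affine_fibration 2 C /\
       (exists D : derivation C,
          locally_nilpotent D /\
          exists A_ : nat -> submodClosed (ker_alg D),
            grading A_ /\
            exists f : {lrmorphism ker_alg D -> rees_alg I},
              graded_iso A_ (@rees_comp R I) f) /\
       (exists j : {lrmorphism rees_alg I -> C},
          injective j /\ inert (fun c : C => exists a, c = j a))).
Proof.
pose K := residue_field (zero_prime R); pose tau : {rmorphism R -> K} :=
  residue_map (zero_prime R).
have charK n (n0 : (0 < n)%N) : n%:R != 0 :> K := tau0_char R_rat n0.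
have tau_eq0 : forall a, (tau a == 0) = (a == 0) := @tau0_eq0 R.
have tau_frac : forall x : K, exists a s, s != 0 /\ x = tau a / tau s := @tau0_frac R.
split=> [B D fibB nilD nzD|I unmI].
  have [iota [iotaZ iotaI iotaS]] : exists iota : {rmorphism B -> {mpoly K[2]}},
      [/\ forall r b, iota (r *: b) = tau r *: iota b, injective iota
        & forall x, exists s b, s != 0 /\ iota b = tau s *: x].
    by have [iota [? ? ?]] := fibration_embedding fibB; exists iota.
  have [f [f1 kerf]] := kernel_generator charK tau_eq0 tau_frac iotaZ iotaI
    iotaS nilD nzD.
  have [u [v [u0 gsplit gint gnz]]] := kernel_generator_normalize R_noetherian
    fibB charK tau_eq0 tau_frac iotaZ iotaI iotaS f1.
  have g1 := msize_affine v u0 f1; set g := u *: f + v%:MP in g1 gsplit gint gnz.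
  (* An affine change of f leaves K[f], and so this description of the kernel, unchanged. *)
  have kerg b : D b = 0 <-> exists p : {poly K}, iota b = (map_poly (@mpolyC 2
    K) p).[g].
    by rewrite kerf ev_affine_range.
  have reesE := kernel_rees R_noetherian R_normal fibB tau_eq0 tau_frac iotaZ iotaI
    gsplit gint gnz.
  have unmI := coef_ideal_unmixed R_noetherian R_normal fibB tau_eq0 iotaZ iotaI gnz.
  have [phi phib] := kernel_rees_iso tau_eq0 iotaZ iotaI g1 kerg reesE.
  exists (fun i => rees_grading phi i : submodClosed (ker_alg D)); split.
  - exact: rees_grading_grading.
  - exact: rees_algebra_inj phi.
  - exact: rees_grading0.
  - move=> i _; have J0 := symbolic_pow_neq0 i unmI.
    have idJ := symbolic_pow_ideal (coef_ideal tau iota g) i.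
    have inj := @rees_coord_inj _ _ _ _ phib i.
    have im := @rees_coord_image _ _ _ _ phib i.
    split.
    + exact: (ideal_module_finite R_noetherian inj idJ im).
    + apply: (ideal_module_reflexive R_noetherian R_normal inj idJ im J0) => x.
      exact: symbolic_pow_divisorial.
    + exact: (ideal_module_rank inj im J0).
  - by move=> _; exists (coef_ideal tau iota g); split=> //; exists phi;
    exact: rees_graded_iso.
have [d [e [d0 IE]]] := unmixed_colon R_noetherian R_normal R_rat unmI.
pose iota : {rmorphism {mpoly R[2]} -> {mpoly K[2]}} := map_mpoly tau.
pose f : {mpoly K[2]} := 'X_0 + (tau e / tau d) *: 'X_1.
pose D := linear_derivation e (- d).
have nilD : locally_nilpotent D := linear_der_nilpotent e (- d).
have iotaZ (r : R) b : iota (r *: b) = tau r *: iota b := map_mpolyZ _ _ _.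
have iotaI : injective iota by exact/map_mpoly_injective/(tau_inj tau_eq0).
(* The type [rees_alg] depends on the predicate, so extensional equality of ideals is turned into
   equality of functions before rewriting. *)
have EI : coef_ideal tau iota f = I.
  by apply/funext => r; rewrite -[LHS]/(r \in coef_ideal tau iota f)
    colon_coef_ideal -?IE.
have : exists phi : {lrmorphism ker_alg D -> rees_alg (coef_ideal tau iota f)},
    bijective phi.
  exact: (kernel_rees_iso tau_eq0 iotaZ iotaI (linear_form_nonconstant _)
    (linear_der_kernel_form charK tau_eq0 e d0)
    (linear_form_rees R_noetherian R_normal tau_eq0 tau_frac e d0)).
rewrite EI => -[phi phib].
exists {mpoly R[2]}; split; first exact: mpoly_fibration.
split; last first.
  apply: (kernel_embedding_inert _ _ nilD phib).
    exact: embedded_domain iotaI.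
  exact: embedded_char iotaI.
exists D; split=> //; exists (fun i => rees_grading phi i : submodClosed (ker_alg D)).
split; first exact: rees_grading_grading.
by exists phi; exact: rees_graded_iso.
Qed.
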